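(* Consider the following diagram of closed quantum subgroups of $O_N^+$, in which all arrows are inclusions. The arrows drawn are: $H_N\to H_N^*\to H_N^+\to O_N^+$ (middle row); $\bar O_N\to\bar O_N^*\to O_N^+$ (top row); $O_N\to O_N^*\to O_N^+$ (bottom row); $H_N\to\bar O_N$ and $H_N\to O_N$; $H_N^*\to\bar O_N^*$ and $H_N^*\to O_N^*$. This diagram is both an intersection and generation diagram, in the sense that for any square subdiagram $A\subset B,C\subset D$ we have $$A=B\cap C\qquad\text{and}\qquad\langle B,C\rangle=D.$$ In particular, $\langle H_N^+,\bar O_N\rangle=O_N^+$.
   Context: $O_N^+$ is the free orthogonal quantum group: $C(O_N^+)$ is the universal $C^*$-algebra generated by self-adjoint elements $u_{ij}$, $1\le i,j\le N$, such that $u=(u_{ij})$ satisfies $u^t=u^{-1}$, with $\Delta(u_{ij})=\sum_k u_{ik}\otimes u_{kj}$. The other quantum groups are the closed quantum subgroups of $O_N^+$ obtained by imposing the following relations on the coordinates $u_{ij}$: - $O_N$ (orthogonal group): all $u_{ij}$ commute. - $\bar O_N$: distinct $u_{ij},u_{kl}$ anticommute if they lie on the same row or the same column, and commute otherwise. - $O_N^*$: $abc=cba$ for all $a,b,c\in\{u_{ij}\}$. - $\bar O_N^*$: $abc=\pm cba$ for $a,b,c\in\{u_{ij}\}$, the signs being those holding in $\bar O_N$, so that $\bar O_N\subset\bar O_N^*$. Explicitly, for $a=u_{i_1j_1}$, $b=u_{i_2j_2}$, $c=u_{i_3j_3}$ the sign is $s(i_1,i_2,i_3)s(j_1,j_2,j_3)$,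 where $s(x,y,z)=-1$ if $x,y,z$ are pairwise distinct and $s(x,y,z)=1$ otherwise. - $H_N^+$: the elements $p_{ij}=u_{ij}^2$ form a magic matrix, i.e. are projections summing to $1$ on each row and each column. - $H_N^*=H_N^+\cap O_N^*$. - $H_N$ (hyperoctahedral group, of signed permutation matrices) is $H_N^+\cap O_N$. For closed quantum subgroups $B,C\subset O_N^+$, $B\cap C$ is the closed quantum subgroup obtained by imposing the relations of both $B$ and $C$, and $\langle B,C\rangle$ is the smallest closed quantum subgroup of $O_N^+$ containing both $B$ and $C$; in Tannakian terms, the spaces $Hom(u^{\otimes k},u^{\otimes l})$ for $\langle B,C\rangle$ are the intersections of those for $B$ and $C$. Quantum groups are identified when they have the same Hopf $*$-algebra generated by the coordinates.
   Formalization: For the square H_N^* ⊂ O_N^*, \bar O_N^* ⊂ O_N^+ the intersection equality is claimed only for N ≠ 2: at N = 2 all signs are 1, so \bar O_2^* = O_2^*, strictly larger than H_2^*; squares are those bounded by four drawn arrows, larger rectangles being juxtapositions. *)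

(* Defs.v *)
From HB Require Import structures.
From mathcomp Require Import all_boot all_order all_algebra.
From mathcomp Require Import boolp classical_sets reals complex.
From mathcomp Require Import finmap monalg.

Set Implicit Arguments.
Unset Strict Implicit.
Unset Printing Implicit Defensive.

Import Order.TTheory GRing.Theory Num.Theory.

Local Open Scope classical_set_scope.
Local Open Scope ring_scope.

(* Unital C*-algebras over R[i].  The norm is a field of the structure, because
   Hierarchy Builder cannot join the normed modules of mathcomp-analysis with
   GRing.Algebra.  As algType is nontrivial (1 != 0), the zero algebra is
   excluded; this is harmless below, since every identity holds in it. *)
HB.mixin Record isCStarAlgebra (R : realType) (A : Type)
    & GRing.Algebra R[i] A := {
  star : A -> A ;
  starK : involutive star ;
  starD : {morph star : x y / x + y} ;
  starZ : forall (c : R[i]) (x : A), star (c *: x) = c^* *: star x ;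
  starM : forall x y : A, star (x * y) = star y * star x ;
  cnorm : A -> R ;
  cnorm_ge0 : forall x : A, 0 <= cnorm x ;
  cnorm0_eq0 : forall x : A, cnorm x = 0 -> x = 0 ;
  cnormD : forall x y : A, cnorm (x + y) <= cnorm x + cnorm y ;
  cnormZ : forall (c : R[i]) (x : A), cnorm (c *: x) = Normc.normc c * cnorm x ;
  cnormM : forall x y : A, cnorm (x * y) <= cnorm x * cnorm y ;
  cnorm_starM : forall x : A, cnorm (star x * x) = cnorm x ^+ 2 ;
  cnorm_complete : forall x : nat -> A,
    (forall e : R, 0 < e -> exists n, forall p q : nat,
       (n <= p)%N -> (n <= q)%N -> cnorm (x p - x q) < e) ->
    exists l : A, forall e : R, 0 < e -> exists n, forall p : nat,
       (n <= p)%N -> cnorm (x p - l) < e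
}.

#[short(type="cstarAlgType")]
HB.structure Definition CStarAlgebra (R : realType) :=
  {A of GRing.Algebra R[i] A & isCStarAlgebra R A}.

(* ncpoly R N is the free unital complex algebra on N^2 letters u_ij; the
   letter u_ij is encoded by the pair (i, j). *)
Definition word (N : nat) := {fmonom ('I_N * 'I_N)%type}.
Definition ncpoly (R : realType) (N : nat) := {malg R[i][word N]}.

Definition gen (R : realType) (N : nat) : 'M[ncpoly R N]_N :=
  \matrix_(i, j) << FMonom [:: (i, j)] >>.

Definition eval (R : realType) (N : nat) (A : algType R[i]) (u : 'M[A]_N)
    (P : ncpoly R N) : A :=
  \sum_(w <- msupp P) P@_w *: \prod_(x <- w : seq _) u x.1 x.2.

(* The Hopf *-algebra structure of the free algebra: u_ij^* = u_ij,
   Delta(u_ij) = sum_k u_ik (x) u_kj, epsilon(u_ij) = delta_ij and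
   S(u_ij) = u_ji, extended from words by (anti)multiplicativity.  The tensor
   square is the vector space with basis the pairs of words. *)
Definition poly_star (R : realType) (N : nat) (P : ncpoly R N) : ncpoly R N :=
  \sum_(w <- msupp P) << (P@_w)^* *g FMonom (rev w) >>.

Definition ncpoly2 (R : realType) (N : nat) :=
  {malg R[i][(word N * word N)%type]}.

Definition tensor (R : realType) (N : nat) (P Q : ncpoly R N) : ncpoly2 R N :=
  \sum_(v <- msupp P) \sum_(w <- msupp Q) << P@_v * Q@_w *g (v, w) >>.

Definition comul (R : realType) (N : nat) (P : ncpoly R N) : ncpoly2 R N :=
  \sum_(w <- msupp P) \sum_(k : (size w).-tuple 'I_N)
    << P@_w *g (FMonom (zip (unzip1 w) k), FMonom (zip k (unzip2 w))) >>.

Definition counit (R : realType) (N : nat) (P : ncpoly R N) : R[i] :=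
  \sum_(w <- msupp P) P@_w * \prod_(x <- w : seq _) (x.1 == x.2)%:R.

Definition antipode (R : realType) (N : nat) (P : ncpoly R N) : ncpoly R N :=
  \sum_(w <- msupp P)
    << P@_w *g FMonom (rev [seq (x.2, x.1) | x <- w : seq _]) >>.

(* A quantum group G inside O_N^+ is represented by the set of the
   noncommutative polynomials that vanish on its coordinates: this is the
   kernel of ncpoly R N -> C(G), so its Hopf *-algebra is the quotient, and
   equality of sets identifies quantum groups with the same Hopf *-algebra
   generated by the coordinates. *)
Definition qgrp (R : realType) (N : nat) := set (ncpoly R N).

(* Inclusion of quantum groups reverses the inclusion of vanishing ideals. *)
Definition qsub (R : realType) (N : nat) (G H : qgrp R N) : Prop := H `<=` G.

(* The closed quantum subgroups of O_N^+ correspond to the quotients of the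
   Hopf *-algebra of O_N^+, i.e. to the Hopf *-ideals of the free algebra
   containing the relations u u^t = u^t u = 1.  The clause on comul says that
   Delta(I) is contained in I (x) A + A (x) I, A the free algebra. *)
Record closed_qsubgroup (R : realType) (N : nat) (I : qgrp R N) : Prop := {
  cqs_0 : I 0 ;
  cqs_add : forall P Q, I P -> I Q -> I (P + Q) ;
  cqs_mull : forall P Q, I Q -> I (P * Q) ;
  cqs_mulr : forall P Q, I P -> I (P * Q) ;
  cqs_orth : forall i j,
    I ((gen R N *m (gen R N)^T - 1%:M) i j) /\
    I (((gen R N)^T *m gen R N - 1%:M) i j) ;
  cqs_star : forall P, I P -> I (poly_star P) ;
  cqs_comul : forall P, I P ->
    exists s : seq (ncpoly R N * ncpoly R N),
      (forall p, p \in s -> I p.1 \/ I p.2) /\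
      comul P = \sum_(p <- s) tensor p.1 p.2 ;
  cqs_counit : forall P, I P -> counit P = 0 ;
  cqs_antipode : forall P, I P -> I (antipode P)
}.

Definition relations (R : realType) (N : nat) :=
  forall A : cstarAlgType R, 'M[A]_N -> Prop.

Definition rel_Oplus (R : realType) (N : nat) : relations R N :=
  fun A u => (forall i j, star (u i j) = u i j) /\
             u *m u^T = 1%:M /\ u^T *m u = 1%:M.

(* The quantum subgroup of O_N^+ obtained by imposing the relations rel: a
   polynomial vanishes in the universal C*-algebra iff it vanishes on every
   matrix over a C*-algebra that satisfies the defining relations. *)
Definition impose (R : realType) (N : nat) (rel : relations R N) : qgrp R N :=
  [set P | forall (A : cstarAlgType R) (u : 'M[A]_N),
     rel_Oplus u -> rel A u -> eval u P = 0].

Definition qinter (R : realType) (N : nat) (G H : qgrp R N) : qgrp R N :=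
  impose (fun A u => (forall P, G P -> eval u P = 0) /\
                     (forall P, H P -> eval u P = 0)).

(* <G, H> = K, i.e. K is the smallest closed quantum subgroup of O_N^+
   containing both G and H. *)
Definition qgen (R : realType) (N : nat) (G H K : qgrp R N) : Prop :=
  [/\ closed_qsubgroup K, qsub G K, qsub H K &
      forall L : qgrp R N, closed_qsubgroup L -> qsub G L -> qsub H L ->
        qsub K L].

Definition rel_O (R : realType) (N : nat) : relations R N :=
  fun A u => forall i j k l, u i j * u k l = u k l * u i j.

Definition rel_Obar (R : realType) (N : nat) : relations R N :=
  fun A u => forall i j k l, (i, j) != (k, l) ->
    u i j * u k l =
      if (i == k) || (j == l) then - (u k l * u i j) else u k l * u i j.

Definition rel_Ostar (R : realType) (N : nat) : relations R N :=
  fun A u => forall i1 j1 i2 j2 i3 j3,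
    u i1 j1 * u i2 j2 * u i3 j3 = u i3 j3 * u i2 j2 * u i1 j1.

Definition sgn3 (R : realType) (N : nat) (x y z : 'I_N) : R[i] :=
  if [&& x != y, y != z & x != z] then -1 else 1.

Definition rel_Obarstar (R : realType) (N : nat) : relations R N :=
  fun A u => forall i1 j1 i2 j2 i3 j3,
    u i1 j1 * u i2 j2 * u i3 j3 =
      (sgn3 R i1 i2 i3 * sgn3 R j1 j2 j3) *: (u i3 j3 * u i2 j2 * u i1 j1).

Definition projection (R : realType) (A : cstarAlgType R) (p : A) : Prop :=
  star p = p /\ p * p = p.

Definition magic (R : realType) (N : nat) (A : cstarAlgType R) (p : 'M[A]_N) :
    Prop :=
  [/\ forall i j, projection (p i j),
      forall i, \sum_j p i j = 1 & forall j, \sum_i p i j = 1].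

Definition rel_Hplus (R : realType) (N : nat) : relations R N :=
  fun A u => magic (\matrix_(i, j) (u i j ^+ 2)).

Inductive vertex :=
  vH | vHstar | vHplus | vO | vOstar | vObar | vObarstar | vOplus.

Definition qg (R : realType) (N : nat) (X : vertex) : qgrp R N :=
  match X with
  | vOplus => impose (fun _ _ => True)
  | vO => impose (@rel_O R N)
  | vOstar => impose (@rel_Ostar R N)
  | vObar => impose (@rel_Obar R N)
  | vObarstar => impose (@rel_Obarstar R N)
  | vHplus => impose (@rel_Hplus R N)
  | vHstar => qinter (impose (@rel_Hplus R N)) (impose (@rel_Ostar R N))
  | vH => qinter (impose (@rel_Hplus R N)) (impose (@rel_O R N))
  end.

Arguments qg R N X : clear implicits.

Definition arrow (X Y : vertex) : bool :=
  match X, Y with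
  | vH, vHstar | vHstar, vHplus | vHplus, vOplus
  | vObar, vObarstar | vObarstar, vOplus
  | vO, vOstar | vOstar, vOplus
  | vH, vObar | vH, vO
  | vHstar, vObarstar | vHstar, vOstar => true
  | _, _ => false
  end.

(* The squares bounded by four drawn arrows.  Rectangles composed of several of
   them need no separate clause: the intersection and generation properties pass
   to juxtapositions. *)
Definition square (A B C D : vertex) : Prop :=
  B <> C /\ [&& arrow A B, arrow A C, arrow B D & arrow C D].

(* Four of the five squares have a side on the middle row.  The remaining one,
   with B and C the vertices O_N^* and bar O_N^*, is not an intersection square
   for N = 2: there are no three distinct indices, so all the signs are 1 and
   O_2^* = bar O_2^*, whereas H_2^* is strictly smaller. *)
Definition middle_row (X : vertex) : bool :=
  match X with vH | vHstar | vHplus => true | _ => false end.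

(* Main.v *)
Require Import Defs.
From HB Require Import structures.
From mathcomp Require Import all_boot all_order all_algebra.
From mathcomp Require Import boolp classical_sets reals complex.
From mathcomp Require Import finmap monalg mxtens zify ring lra.
From mathcomp Require mpoly.

(** A quantum subgroup of O_N^+ is a Hopf ideal I of the free algebra on the
    letters u_ij.  It is studied through the functionals vanishing on I, given
    by their values on words.  They are stable under convolution, because I is a
    coideal, and under prefixing and suffixing letters, because I is an ideal;
    the coefficients of every matrix model of I are among them.

    Intersections.  All the relations are polynomial, so that an intersection is
    given by the conjunction of the relations.  In H_N^+ the C*-identity gives
    u_ij^3 = u_ij, and if moreover the squares u_ij^2 are central then two
    different entries of a row or of a column have product zero
    (orthogonal_family).  Hence the products at which the signs of two vertices
    disagree vanish.  Conversely, for at least three indices the relations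
    a b c = c b a = - c b a produce these zeros, hence H_N^+.

    Generation.  Let L be a closed quantum subgroup containing the two given
    ones.  Its functionals contain those of the points g of O_N, or those of the
    models g_ij gamma_i (x) gamma_j of the twisted orthogonal group, where the
    gamma_i are Clifford generators, and those of the antidiagonal models of
    H_N^*.  The diagonal matrix of the gamma_i is a model of H_N^+ that exchanges
    the first two kinds.  In families depending rationally on a parameter,
    derivatives and coefficients are again functionals of L
    (rational_identity).

    For D = O_N^+ (Oplus_criterion) these are an infinitesimal rotation, a twisted
    one, and for each k a functional concentrated, in degree k, on the
    alternating word X = l0 l1 l0 ... (ann_alternating).  The commutator of the
    two rotations is diagonal.  Separating its eigenvalues, one finds that the
    vectors a(., X), for a a functional of L, and the images of the cups span the
    whole tensor power (Q_eq0).  Now let P vanish on L, with top degree k.  Its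
    matrix of coefficients in degree k kills all a(., X) b(X, .); by linear
    algebra it is a combination of terms with a cup on the rows or on the columns
    (ann_tensor), which the orthogonality relations replace by shorter words.  By
    induction on the degree, P is a consequence of these relations.

    For D = O_N^* (half_criterion) rotations and diagonal unitaries give, for every
    invertible complex matrix v, the functional that alternates v and v^-T along
    a word (ann_GL).  If u half-commutes and z = u_1j, the entries of x = u z and
    y = z u commute, and x y^T = z^2.  A polynomial vanishing at all pairs
    (v, v^-T) vanishes, up to powers of determinants, at (x, y), so that P(u) is
    killed by a power of z^2; as the squares u_1j^2 have sum 1, P(u) = 0
    (half_commuting_transfer).  The twisted case follows by applying this to
    gamma_i (x) gamma_j (x) u_ij.

    Closedness of the vertices D.  The polynomials killed by the finite-dimensional
    models of D form a Hopf ideal, by Kronecker products and transposition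
    (fdkernel_closed); the generation argument applied to this ideal shows that it
    is the ideal of D. *)

Set Implicit Arguments.
Unset Strict Implicit.
Unset Printing Implicit Defensive.

Import Order.TTheory GRing.Theory Num.Theory.

Local Open Scope ring_scope.

(** * Words, functionals and convolution *)

Section LinearExtension.
Variables (C : comNzRingType) (K : choiceType).
Implicit Types (P Q : {malg C[K]}).

(** Linear extension of a function on the basis: evaluations and functionals on
    the free algebra are of this form, which makes them linear at once. *)
Definition lext (V : lmodType C) (f : K -> V) P : V :=
  \sum_(k <- msupp P) P@_k *: f k.

Lemma lextEw (V : lmodType C) (f : K -> V) (d : {fset K}) P :
  (msupp P `<=` d)%fset -> lext f P = \sum_(k <- d) P@_k *: f k.
Proof.
move=> le; rewrite /lext (big_fset_incl _ le) // => k _ kP.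
by rewrite (mcoeff_outdom kP) scale0r.
Qed.

Lemma lext_is_linear (V : lmodType C) (f : K -> V) : linear (lext f).
Proof.
move=> a P Q; pose d := (msupp P `|` msupp Q)%fset.
have le : (msupp (a *: P + Q) `<=` d)%fset.
  apply: fsubset_trans (msuppD_le _ _) _.
  by apply: fsetUSS; [exact: msuppZ_le | exact: fsubset_refl].
rewrite (lextEw f le) (lextEw (d := d) f (fsubsetUl _ _)).
rewrite (lextEw (d := d) f (fsubsetUr _ _)).
rewrite scaler_sumr -big_split /=; apply: eq_bigr => k _.
by rewrite mcoeffD mcoeffZ scalerDl scalerA.
Qed.

HB.instance Definition _ (V : lmodType C) (f : K -> V) :=
  GRing.isLinear.Build C {malg C[K]} V _ (lext f) (lext_is_linear f).

Lemma lextU (V : lmodType C) (f : K -> V) c k :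
  lext f << c *g k >> = c *: f k.
Proof. by rewrite (lextEw f msuppU_le) big_seq_fset1 mcoeffUU. Qed.

Lemma malgUZ c k : << c *g k >> = c *: << k >> :> {malg C[K]}.
Proof. by apply/malgP => k'; rewrite mcoeffZ !mcoeffU mulr_natr. Qed.

Lemma malg_lin P : P = \sum_(k <- msupp P) P@_k *: << k >>.
Proof. by rewrite {1}[P]monalgE; apply: eq_bigr => k _; rewrite malgUZ. Qed.

End LinearExtension.

Section Words.
Variables (R : realType) (N : nat).
Local Notation C := R[i].
Local Notation letter := ('I_N * 'I_N)%type.
Local Notation poly := (ncpoly R N).

Definition wval (A : nzRingType) (u : 'M[A]_N) (w : seq letter) : A :=
  \prod_(x <- w) u x.1 x.2.

Lemma wval_nil (A : nzRingType) (u : 'M[A]_N) : wval u [::] = 1.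
Proof. exact: big_nil. Qed.
Lemma wval_cons (A : nzRingType) (u : 'M[A]_N) a w :
  wval u (a :: w) = u a.1 a.2 * wval u w.
Proof. exact: big_cons. Qed.
Lemma wval_cat (A : nzRingType) (u : 'M[A]_N) v w :
  wval u (v ++ w) = wval u v * wval u w.
Proof. exact: big_cat. Qed.

Lemma evalE (A : algType C) (u : 'M[A]_N) (P : poly) :
  eval u P = lext (fun w : word N => wval u w) P.
Proof. by []. Qed.

Lemma mulUU (c d : C) (v w : word N) :
  << c *g v >> * << d *g w >> = << c * d *g FMonom (v ++ w) >> :> poly.
Proof.
rewrite -[LHS]/(fgmul _ _) fgmulUU; congr (<< _ *g _ >>).
by apply/eqP; rewrite fmP fmM.
Qed.

Lemma oneU : 1 = << FMonom [::] >> :> poly.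
Proof. by congr << _ >>; apply/eqP; rewrite fmP fm1. Qed.

Lemma evalD (A : algType C) (u : 'M[A]_N) P Q :
  eval u (P + Q) = eval u P + eval u Q.
Proof. by rewrite !evalE linearD. Qed.

Lemma evalM (A : algType C) (u : 'M[A]_N) P Q :
  eval u (P * Q) = eval u P * eval u Q.
Proof.
rewrite malgME !evalE linear_sum mulr_suml; apply: eq_bigr => v _.
rewrite linear_sum mulr_sumr; apply: eq_bigr => w _.
by rewrite /= lextU fmM wval_cat -scalerAl -scalerAr scalerA.
Qed.

Lemma eval_gen (A : algType C) (u : 'M[A]_N) i j : eval u (gen R N i j) = u i j.
Proof. by rewrite mxE evalE lextU scale1r wval_cons wval_nil mulr1. Qed.

Lemma eval1 (A : algType C) (u : 'M[A]_N) : eval u 1 = 1.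
Proof. by rewrite oneU evalE lextU wval_nil scale1r. Qed.

(** The pairing of a polynomial with the functional that has the given values on
    words.  It is locked, to be used through its values on words only. *)
Fact pairing_key : unit. Proof. by []. Qed.
Definition pairing (f : seq letter -> C) : poly -> C :=
  locked_with pairing_key (lext (V := C^o) (fun w : word N => f w)).

Lemma pairing_is_linear f : linear_for *%R (pairing f).
Proof. by move=> a P Q; rewrite /pairing unlock linearP. Qed.
HB.instance Definition _ f :=
  GRing.isLinear.Build C poly C _ (pairing f) (pairing_is_linear f).

Lemma pairingZ f c P : pairing f (c *: P) = c * pairing f P.
Proof. exact: linearZ. Qed.

Lemma pairingU f c w : pairing f << c *g w >> = c * f w.
Proof. by rewrite /pairing unlock; exact: lextU. Qed.

Lemma pairingE f P : pairing f P = \sum_(w <- msupp P) P@_w * f w.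
Proof. by rewrite /pairing unlock. Qed.

(** The product of functionals dual to the coproduct. *)
Definition convol (f g : seq letter -> C) (w : seq letter) : C :=
  \sum_(k : (size w).-tuple 'I_N) f (zip (unzip1 w) k) * g (zip k (unzip2 w)).

Definition pairing2 (f g : seq letter -> C) (T : ncpoly2 R N) : C :=
  lext (V := C^o) (fun vw : word N * word N => (f vw.1 * g vw.2 : C^o)) T.

Lemma pairing2_is_linear f g : linear_for *%R (pairing2 f g).
Proof. by move=> a P Q; rewrite /pairing2 linearP. Qed.
HB.instance Definition _ f g :=
  GRing.isLinear.Build C (ncpoly2 R N) C _ (pairing2 f g)
    (pairing2_is_linear f g).

Lemma pairing2U f g c vw : pairing2 f g << c *g vw >> = c * (f vw.1 * g vw.2).
Proof. exact: lextU. Qed.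

Lemma pairing2_tensor f g P Q :
  pairing2 f g (tensor P Q) = pairing f P * pairing g Q.
Proof.
rewrite !pairingE linear_sum mulr_suml; apply: eq_bigr => v _.
rewrite linear_sum mulr_sumr; apply: eq_bigr => w _.
by rewrite /= pairing2U; ring.
Qed.

Lemma pairing2_comul f g P : pairing2 f g (comul P) = pairing (convol f g) P.
Proof.
rewrite pairingE linear_sum; apply: eq_bigr => w _.
rewrite linear_sum mulr_sumr; apply: eq_bigr => k _.
by rewrite /= pairing2U.
Qed.

Definition ann (I : qgrp R N) (f : seq letter -> C) : Prop :=
  forall P, I P -> pairing f P = 0.

Lemma eq_pairing f g P : f =1 g -> pairing f P = pairing g P.
Proof. by move=> e; rewrite !pairingE; apply: eq_bigr => w _; rewrite e. Qed.

Lemma pairing_sum (T : Type) (r : seq T) (c : T -> C) (F : T -> seq letter -> C) P :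
  pairing (fun w => \sum_(t <- r) c t * F t w) P =
  \sum_(t <- r) c t * pairing (F t) P.
Proof.
rewrite pairingE; under eq_bigr do rewrite mulr_sumr.
rewrite exchange_big; apply: eq_bigr => t _.
rewrite pairingE mulr_sumr; apply: eq_bigr => w _; ring.
Qed.

Section Annihilator.
Variables (I : qgrp R N) (hI : closed_qsubgroup I).

Lemma ann_ext f g : f =1 g -> ann I f -> ann I g.
Proof. by move=> e fI P IP; rewrite -(eq_pairing P e) fI. Qed.

Lemma ann_sum (T : Type) (r : seq T) (c : T -> C) F :
  (forall t, ann I (F t)) -> ann I (fun w => \sum_(t <- r) c t * F t w).
Proof.
by move=> FI P IP; rewrite pairing_sum big1 // => t _; rewrite FI // mulr0.
Qed.

Lemma ann_scale c f : ann I f -> ann I (fun w => c * f w).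
Proof.
move=> fI; apply: ann_ext (ann_sum [:: tt] (fun=> c) (fun=> fI)) => w.
by rewrite big_seq1.
Qed.

(** This is the meaning of the clause on the coproduct: f (x) g vanishes on
    I (x) A + A (x) I. *)
Lemma ann_convol f g : ann I f -> ann I g -> ann I (convol f g).
Proof.
move=> fI gI P IP; rewrite -pairing2_comul.
have [s [hs ->]] := cqs_comul hI IP.
rewrite linear_sum big_seq big1 //= => p /hs hp; rewrite pairing2_tensor.
by case: hp => [/fI|/gI] ->; rewrite (mul0r, mulr0).
Qed.

Lemma pairing_cat f v w P : pairing (fun x => f (v ++ x ++ w)) P =
  pairing f (<< FMonom v >> * P * << FMonom w >>).
Proof.
rewrite pairingE [P in RHS]malg_lin mulr_sumr mulr_suml linear_sum /=.
apply: eq_bigr => k _; rewrite -malgUZ !mulUU pairingU /= -catA.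
by rewrite mulr1 mul1r.
Qed.

Lemma ann_shift f v w : ann I f -> ann I (fun x => f (v ++ x ++ w)).
Proof.
move=> fI P IP; rewrite pairing_cat fI //.
by apply: cqs_mulr => //; apply: cqs_mull.
Qed.

(** The relations u u^t = u^t u = 1 lie in I, so that contracting two adjacent
    letters of a functional erases them. *)
Lemma ann_orth f v w i i' : ann I f ->
  \sum_c f (v ++ [:: (i, c); (i', c)] ++ w) = (i == i')%:R * f (v ++ w) /\
  \sum_c f (v ++ [:: (c, i); (c, i')] ++ w) = (i == i')%:R * f (v ++ w).
Proof.
move=> fI; have [h1 h2] := cqs_orth hI i i'.
have gg a b c d : gen R N a b * gen R N c d =
    << FMonom [:: (a, b); (c, d)] >> :> poly.
  by rewrite !mxE mulUU mulr1.
have e0 x : (x == i')%:R = (x == i')%:R * << FMonom [::] >> :> poly.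
  by rewrite -oneU mulr1.
split; apply/eqP; rewrite -subr_eq0; apply/eqP.
- have := ann_shift v w fI h1; rewrite !mxE linearB linear_sum /= => h.
  rewrite -[RHS]h; congr (_ - _).
    by apply: eq_bigr => c _; rewrite [_^T _ _]mxE gg pairingU mul1r.
  rewrite -mulr_natr mul1r; case: eqP => _; rewrite ?mul1r ?mul0r ?linear0 //.
  by rewrite [1]oneU pairingU mul1r.
- have := ann_shift v w fI h2; rewrite !mxE linearB linear_sum /= => h.
  rewrite -[RHS]h; congr (_ - _).
    by apply: eq_bigr => c _; rewrite [_^T _ _]mxE gg pairingU mul1r.
  rewrite -mulr_natr mul1r; case: eqP => _; rewrite ?mul1r ?mul0r ?linear0 //.
  by rewrite [1]oneU pairingU mul1r.
Qed.

Definition wcounit (w : seq letter) : C := \prod_(x <- w) (x.1 == x.2)%:R.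

Lemma ann_counit : ann I wcounit.
Proof. by move=> P /(cqs_counit hI); rewrite pairingE. Qed.

End Annihilator.
End Words.

(** * The C*-algebra of complex matrices *)

Section VectorNorm.
Variables (F : numClosedFieldType) (n : nat).
Local Open Scope sesquilinear_scope.
Local Notation "''[' u , v ]" := (dotmx u v) : ring_scope.
Local Notation "''[' u ]" := (dotmx u u) : ring_scope.
Implicit Types (u v : 'rV[F]_n) (x : 'M[F]_n).

Definition vnormC v : F := sqrtC '[v].

Lemma vnormC_ge0 v : 0 <= vnormC v.
Proof. by rewrite sqrtC_ge0 dnorm_ge0. Qed.

Lemma vnormC0_eq0 v : vnormC v = 0 -> v = 0.
Proof. by move/eqP; rewrite sqrtC_eq0 dnorm_eq0 => /eqP. Qed.

Lemma vnormC0 : vnormC 0 = 0.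
Proof. by rewrite /vnormC linear0l sqrtC0. Qed.

Lemma vnormCD u v : vnormC (u + v) <= vnormC u + vnormC v.
Proof. exact: (leif_le (triangle_lerif _ _ _)). Qed.

Lemma vnormCZ (c : F) v : vnormC (c *: v) = `|c| * vnormC v.
Proof.
have e : dotmx (c *: v) (c *: v) = `|c| ^+ 2 * '[v] by exact: dnormZ.
by rewrite /vnormC e sqrtCM ?nnegrE ?exprn_ge0 ?dnorm_ge0 // sqrCK.
Qed.

Lemma vnormC_delta i : vnormC (delta_mx 0 i) = 1.
Proof.
have e : '[delta_mx 0 i : 'rV[F]_n] = 1.
  rewrite dotmxE mxE (bigD1 i) //= !mxE !eqxx /= conjC1 mulr1 big1 ?addr0 //.
  by move=> l /negbTE h; rewrite !mxE h andbF mul0r.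
by rewrite /vnormC e sqrtC1.
Qed.

Lemma entry_le_vnormC v i : `|v 0 i| <= vnormC v.
Proof.
rewrite -ler_sqr ?nnegrE ?vnormC_ge0 // sqrtCK.
rewrite dotmxE mxE (bigD1 i) //= !mxE -normCK lerDl.
by apply: sumr_ge0 => j _; rewrite !mxE mul_conjC_ge0.
Qed.

(** Cauchy-Schwarz for |v x|^2 = <v x x^*, v>; it contains the C*-identity. *)
Lemma vnormC_mulmx v x :
  vnormC (v *m x) ^+ 2 <= vnormC (v *m (x *m x^t*)) * vnormC v.
Proof.
rewrite sqrtCK; set w := v *m (x *m x^t*).
have e : '[v *m x] = '[w, v] by rewrite /w !dotmxE trmx_mul map_mxM !mulmxA.
apply: le_trans (leif_le (CauchySchwarz_sqrt _ w v)).
by rewrite e real_ler_norm // -e ger0_real // dnorm_ge0.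
Qed.

End VectorNorm.

Section MatrixNorm.
Variables (R : realType) (n : nat).
Local Notation C := R[i].
Local Open Scope sesquilinear_scope.
Implicit Types (u v : 'rV[C]_n) (x y : 'M[C]_n).

Lemma normc_norm (z : C) : `|z| = real_complex R (Normc.normc z).
Proof. by case: z. Qed.

Lemma le_sqr (a b : R) : 0 <= a -> 0 <= b -> a ^+ 2 <= b ^+ 2 -> a <= b.
Proof. by move=> a0 b0; rewrite ler_pXn2r ?nnegrE. Qed.

Lemma normc_ReIm (z : C) :
  [/\ `|complex.Re z| <= Normc.normc z, `|complex.Im z| <= Normc.normc z &
      Normc.normc z <= `|complex.Re z| + `|complex.Im z|].
Proof.
case: z => a b /=; have h := sqr_ge0 a; have h' := sqr_ge0 b.
have ab : 0 <= a ^+ 2 + b ^+ 2 by exact: addr_ge0.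
split.
- by rewrite -sqrtr_sqr ler_sqrt // lerDl.
- by rewrite -sqrtr_sqr ler_sqrt // lerDr.
apply: le_sqr; rewrite ?addr_ge0 ?sqrtr_ge0 // sqr_sqrtr //.
rewrite sqrrD !real_normK ?num_real // -addrA lerD2l lerDr.
by rewrite mulrn_wge0 // mulr_ge0.
Qed.

Lemma normc_ge0 (z : C) : 0 <= Normc.normc z.
Proof. by have [h _ _] := normc_ReIm z; apply: le_trans h. Qed.

Lemma real_nonneg (z : C) : 0 <= z -> z = real_complex R (complex.Re z).
Proof. by move=> h; rewrite RRe_real // ger0_real. Qed.

Fact vnorm_key : unit. Proof. by []. Qed.
Definition vnorm : 'rV[C]_n -> R :=
  locked_with vnorm_key (fun v => complex.Re (vnormC v)).

Lemma vnormE v : vnormC v = real_complex R (vnorm v).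
Proof. by rewrite /vnorm unlock; exact/real_nonneg/vnormC_ge0. Qed.

Lemma vnorm_ge0 v : 0 <= vnorm v.
Proof. by have := vnormC_ge0 v; rewrite vnormE lecR. Qed.

Lemma vnorm0_eq0 v : vnorm v = 0 -> v = 0.
Proof. by move=> h; apply: vnormC0_eq0; rewrite vnormE h. Qed.

Lemma vnorm0 : vnorm 0 = 0.
Proof. by rewrite /vnorm unlock vnormC0. Qed.

Lemma vnorm_delta i : vnorm (delta_mx 0 i) = 1.
Proof. by rewrite /vnorm unlock vnormC_delta. Qed.

Lemma vnormD u v : vnorm (u + v) <= vnorm u + vnorm v.
Proof. by have := vnormCD u v; rewrite !vnormE -rmorphD lecR. Qed.

Lemma vnormZ (c : C) v : vnorm (c *: v) = Normc.normc c * vnorm v.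
Proof.
by apply: complexI; rewrite rmorphM /= -normc_norm -!vnormE vnormCZ.
Qed.

Lemma entry_le_vnorm v i : Normc.normc (v 0 i) <= vnorm v.
Proof. by have := entry_le_vnormC v i; rewrite vnormE normc_norm lecR. Qed.

Lemma vnorm_mulmx v x :
  vnorm (v *m x) ^+ 2 <= vnorm (v *m (x *m x^t*)) * vnorm v.
Proof. by have := vnormC_mulmx v x; rewrite !vnormE -rmorphXn -rmorphM lecR. Qed.

Lemma vnorm_sum (I : Type) (r : seq I) (F : I -> 'rV[C]_n) :
  vnorm (\sum_(i <- r) F i) <= \sum_(i <- r) vnorm (F i).
Proof.
elim: r => [|i r IH]; first by rewrite !big_nil vnorm0.
by rewrite !big_cons (le_trans (vnormD _ _)) // lerD2l.
Qed.

(** The operator norm is the least Lipschitz constant; the infimum is over a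
    nonempty set because the sum of the moduli of the entries is a bound. *)
Definition opbound x : set R :=
  [set c | 0 <= c /\ forall v, vnorm (v *m x) <= c * vnorm v]%classic.

Fact opnorm_key : unit. Proof. by []. Qed.
Definition opnorm : 'M[C]_n -> R := locked_with opnorm_key (fun x => inf (opbound x)).

Lemma opbound_entries x :
  opbound x (\sum_i \sum_j Normc.normc (x i j)).
Proof.
have c0 := normc_ge0.
split=> [|v]; first by apply: sumr_ge0 => i _; apply: sumr_ge0 => j _.
rewrite {1}[x]matrix_sum_delta mulmx_sumr mulr_suml.
apply: le_trans (vnorm_sum _ _) _; apply: ler_sum => i _.
rewrite mulmx_sumr mulr_suml; apply: le_trans (vnorm_sum _ _) _.
apply: ler_sum => j _; rewrite -scalemxAr vnormZ ler_wpM2l //.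
have -> : v *m delta_mx i j = v 0 i *: delta_mx 0 j.
  apply/rowP => k; rewrite !mxE (bigD1 i) //= mxE eqxx /= big1 ?addr0 //.
  by move=> l /negbTE h; rewrite mxE h mulr0.
by rewrite vnormZ vnorm_delta mulr1 entry_le_vnorm.
Qed.

Lemma opbound_inf x : has_inf (opbound x).
Proof.
split; first by exists (\sum_i \sum_j Normc.normc (x i j)); exact: opbound_entries.
by exists 0 => c [].
Qed.

Lemma opnorm_ge0 x : 0 <= opnorm x.
Proof. by rewrite /opnorm unlock; apply: lb_le_inf; [exact: (opbound_inf x).1 | move=> c []]. Qed.

Lemma opnorm_le x c : 0 <= c ->
  (forall v, vnorm (v *m x) <= c * vnorm v) -> opnorm x <= c.
Proof. by rewrite /opnorm unlock => c0 h; apply: ge_inf; [exact: (opbound_inf x).2 |]. Qed.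

Lemma opnormP x v : vnorm (v *m x) <= opnorm x * vnorm v.
Proof.
have [v0|nv] := eqVneq (vnorm v) 0.
  by rewrite (vnorm0_eq0 v0) mul0mx vnorm0 mulr0.
have vp : 0 < vnorm v by rewrite lt_def nv vnorm_ge0.
rewrite -ler_pdivrMr // /opnorm unlock; apply: lb_le_inf; first exact: (opbound_inf x).1.
by move=> c [_ h]; rewrite ler_pdivrMr.
Qed.

Lemma opnorm_le_entries x : opnorm x <= \sum_i \sum_j Normc.normc (x i j).
Proof. by have [] := opbound_entries x; exact: opnorm_le. Qed.

Lemma entry_le_opnorm x i j : Normc.normc (x i j) <= opnorm x.
Proof.
have := entry_le_vnorm (row i x) j; rewrite mxE rowE => h; apply: (le_trans h).
by apply: le_trans (opnormP _ _) _; rewrite vnorm_delta mulr1.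
Qed.

Lemma opnorm0_eq0 x : opnorm x = 0 -> x = 0.
Proof.
move=> h; apply/matrixP => i j; rewrite mxE; apply: Normc.eq0_normc.
apply/eqP; rewrite eq_le; apply/andP; split.
  by rewrite -h entry_le_opnorm.
exact: normc_ge0.
Qed.

Lemma opnormD x y : opnorm (x + y) <= opnorm x + opnorm y.
Proof.
apply: opnorm_le; first by rewrite addr_ge0 ?opnorm_ge0.
move=> v; rewrite mulmxDr mulrDl.
by apply: le_trans (vnormD _ _) _; apply: lerD; exact: opnormP.
Qed.

Lemma opnormM x y : opnorm (x *m y) <= opnorm x * opnorm y.
Proof.
apply: opnorm_le; first by rewrite mulr_ge0 ?opnorm_ge0.
move=> v; rewrite mulmxA; apply: le_trans (opnormP _ _) _.
rewrite [opnorm x * _]mulrC -mulrA.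
by rewrite ler_wpM2l ?opnorm_ge0 ?opnormP.
Qed.

Lemma opnormZ (c : C) x : opnorm (c *: x) = Normc.normc c * opnorm x.
Proof.
have c0 := normc_ge0.
have le (d : C) y : opnorm (d *: y) <= Normc.normc d * opnorm y.
  apply: opnorm_le; first by rewrite mulr_ge0 ?opnorm_ge0.
  by move=> v; rewrite -scalemxAr vnormZ -mulrA ler_wpM2l ?opnormP.
apply/eqP; rewrite eq_le le /=.
have [->|nc] := eqVneq c 0.
  by rewrite Normc.normc0 mul0r opnorm_ge0.
have nc0 : 0 < Normc.normc c.
  rewrite lt_def c0 andbT; apply: contra_neq nc; exact: Normc.eq0_normc.
rewrite -ler_pdivlMl // -Normc.normcV.
by have := le c^-1 (c *: x); rewrite scalerA mulVf // scale1r.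
Qed.

(** |v x|^2 <= |v x x^*| |v| <= |x x^*| |v|^2. *)
Lemma opnorm_sqr_le x : opnorm x ^+ 2 <= opnorm (x *m x^t*).
Proof.
set b := opnorm (x *m _); have b0 : 0 <= b by exact: opnorm_ge0.
suff h : opnorm x <= Num.sqrt b.
  by rewrite -(sqr_sqrtr b0) lerXn2r ?nnegrE ?opnorm_ge0 ?sqrtr_ge0.
apply: opnorm_le => [|v]; first exact: sqrtr_ge0.
apply: le_sqr; rewrite ?mulr_ge0 ?vnorm_ge0 ?sqrtr_ge0 //.
rewrite exprMn sqr_sqrtr //; apply: le_trans (vnorm_mulmx _ _) _.
by rewrite [vnorm v ^+ 2]expr2 mulrA ler_wpM2r ?vnorm_ge0 ?opnormP.
Qed.

Lemma opnorm_starM x : opnorm (x^t* *m x) = opnorm x ^+ 2.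
Proof.
have le y : opnorm y <= opnorm (y^t*).
  have [-> |ny] := eqVneq (opnorm y) 0; first exact: opnorm_ge0.
  have yp : 0 < opnorm y by rewrite lt_def ny opnorm_ge0.
  rewrite -(ler_pM2l yp) -expr2; apply: le_trans (opnorm_sqr_le y) _.
  exact: opnormM.
have e y : opnorm (y^t*) = opnorm y.
  by apply/eqP; rewrite eq_le le -{2}[y]trmxCK le.
apply/eqP; rewrite eq_le; apply/andP; split.
  by apply: le_trans (opnormM _ _) _; rewrite e expr2.
by have := opnorm_sqr_le (x^t*); rewrite trmxCK e.
Qed.

(** The limit is the supremum of the eventual lower bounds. *)
Lemma real_cauchy (a : nat -> R) :
  (forall e : R, 0 < e -> exists m, forall p q : nat,
     (m <= p)%N -> (m <= q)%N -> `|a p - a q| < e) ->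
  exists l : R, forall e : R, 0 < e -> exists m, forall p : nat,
     (m <= p)%N -> `|a p - l| < e.
Proof.
move=> ca; pose S : set R := [set t | exists m, forall p, (m <= p)%N -> t <= a p]%classic.
have bd e : 0 < e -> exists m, forall p, (m <= p)%N ->
    S (a p - e) /\ (forall t, S t -> t <= a p + e).
  move=> e0; have [m hm] := ca e e0; exists m => p mp; split.
    exists m => q mq; have := hm p q mp mq; rewrite ltr_norml => /andP[_].
    by rewrite ltrBlDr => /ltW h; rewrite lerBlDr addrC.
  move=> t [m' hm']; have := hm' _ (leq_maxr m m') => h; apply: (le_trans h).
  have := hm _ p (leq_maxl m m') mp; rewrite ltr_norml => /andP[_].
  by rewrite ltrBlDl => /ltW.
have [m0 hm0] := bd 1 ltr01; have [S1 U1] := hm0 m0 (leqnn _).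
exists (sup S) => e e0; have [m hm] := bd (e / 2) (divr_gt0 e0 (ltr0n _ 2)).
exists m => p mp; have [Sp Up] := hm p mp.
have lo : a p - e / 2 <= sup S.
  by apply: ub_le_sup => //; exists (a m0 + 1) => t /U1.
have hi : sup S <= a p + e / 2.
  by apply: ge_sup; [exists (a m0 - 1) | move=> t /Up].
by rewrite ltr_norml; apply/andP; split; lra.
Qed.

(** The operator norm is equivalent to the entries, so that a Cauchy sequence
    converges entry by entry, in real and imaginary parts. *)
Lemma opnorm_complete (x : nat -> 'M[C]_n) :
  (forall e : R, 0 < e -> exists m, forall p q : nat,
     (m <= p)%N -> (m <= q)%N -> opnorm (x p - x q) < e) ->
  exists l, forall e : R, 0 < e -> exists m, forall p : nat,
     (m <= p)%N -> opnorm (x p - l) < e.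
Proof.
move=> cx.
have cent i j : exists l : C, forall e : R, 0 < e -> exists m, forall p : nat,
    (m <= p)%N -> Normc.normc (x p i j - l) < e.
  have cre e : 0 < e -> exists m, forall p q : nat, (m <= p)%N -> (m <= q)%N ->
      `|complex.Re (x p i j) - complex.Re (x q i j)| < e /\
      `|complex.Im (x p i j) - complex.Im (x q i j)| < e.
    move=> e0; have [m hm] := cx e e0; exists m => p q mp mq.
    have lt := le_lt_trans (entry_le_opnorm _ i j) (hm p q mp mq).
    have [h1 h2 _] := normc_ReIm ((x p - x q) i j).
    by split; [apply: le_lt_trans lt; apply: le_trans h1 | apply: le_lt_trans lt; apply: le_trans h2];
      rewrite !mxE; case: (x p i j) (x q i j) => [? ?] [? ?].
  have [a ha] : exists l : R, forall e : R, 0 < e -> exists m, forall p : nat,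
     (m <= p)%N -> `|complex.Re (x p i j) - l| < e.
    by apply: real_cauchy => e /cre[m hm]; exists m => p q mp mq; have [] := hm p q mp mq.
  have [b hb] : exists l : R, forall e : R, 0 < e -> exists m, forall p : nat,
     (m <= p)%N -> `|complex.Im (x p i j) - l| < e.
    by apply: real_cauchy => e /cre[m hm]; exists m => p q mp mq; have [] := hm p q mp mq.
  exists (Complex a b) => e e0.
  have e2 : 0 < e / 2 by exact: divr_gt0.
  have [m1 h1] := ha _ e2; have [m2 h2] := hb _ e2.
  exists (maxn m1 m2) => p; rewrite geq_max => /andP[/h1 p1 /h2 p2].
  have [_ _ h] := normc_ReIm (x p i j - Complex a b).
  apply: le_lt_trans h _; move: p1 p2; case: (x p i j) => c d /= p1 p2.
  lra.
have [l hl] : exists l : 'M[C]_n, forall i j (e : R), 0 < e -> exists m, forall p : nat,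
    (m <= p)%N -> Normc.normc (x p i j - l i j) < e.
  exists (\matrix_(i, j) projT1 (cid (cent i j))) => i j e e0; rewrite mxE.
  by case: (cid _) => l /= /(_ e e0).
exists l => e e0.
pose d := e / (n * n).+1%:R; have d0 : 0 < d by rewrite divr_gt0.
have [m hm] : exists m : 'I_n -> 'I_n -> nat, forall i j (p : nat),
    (m i j <= p)%N -> Normc.normc (x p i j - l i j) < d.
  exists (fun i j => projT1 (cid (hl i j d d0))) => i j.
  by case: (cid _).
exists (\max_i \max_j m i j)%N => p hp.
apply: le_lt_trans (opnorm_le_entries _) _.
apply: (@le_lt_trans _ _ (\sum_(i < n) \sum_(j < n) d)).
  apply: ler_sum => i _; apply: ler_sum => j _; apply/ltW; rewrite !mxE; apply: hm.
  apply: leq_trans hp; apply: leq_trans (leq_bigmax i).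
  exact: (leq_bigmax (F := fun j => m i j) j).
rewrite !sumr_const !card_ord -mulrnA -mulr_natr /d -mulrA.
by rewrite gtr_pMr // ltr_pdivrMl ?ltr0n // mulr1 ltr_nat.
Qed.

End MatrixNorm.

Section MatrixCStar.
Variables (R : realType) (n : nat).
Local Notation C := R[i].
Local Open Scope sesquilinear_scope.

Definition mxstar (x : 'M[C]_n.+1) : 'M[C]_n.+1 := x^t*.

Lemma mxstarK : involutive mxstar.
Proof. by move=> x; exact: trmxCK. Qed.
Lemma mxstarD : {morph mxstar : x y / x + y}.
Proof. by move=> x y; apply/matrixP => i j; rewrite !mxE rmorphD. Qed.
Lemma mxstarZ (c : C) x : mxstar (c *: x) = c^* *: mxstar x.
Proof. by apply/matrixP => i j; rewrite !mxE rmorphM. Qed.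
Lemma mxstarM x y : mxstar (x * y) = mxstar y * mxstar x.
Proof. by rewrite /mxstar trmx_mul map_mxM. Qed.

HB.instance Definition _ := isCStarAlgebra.Build R 'M[C]_n.+1
  mxstarK mxstarD mxstarZ mxstarM (@opnorm_ge0 R n.+1) (@opnorm0_eq0 R n.+1)
  (@opnormD R n.+1) (@opnormZ R n.+1) (@opnormM R n.+1) (@opnorm_starM R n.+1)
  (@opnorm_complete R n.+1).

End MatrixCStar.

(** * Tensor splitting and Kronecker products *)

Section Tuples.

Lemma big_tupleS (V : zmodType) (I : finType) (n : nat)
    (F : n.+1.-tuple I -> V) :
  \sum_t F t = \sum_a \sum_(t : n.-tuple I) F [tuple of a :: t].
Proof.
rewrite pair_big /=.
rewrite (reindex (fun p : I * n.-tuple I => [tuple of p.1 :: p.2])) //=.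
exists (fun t : n.+1.-tuple I => (thead t, behead_tuple t)) => [[a t]|t] _.
  by congr pair; apply: val_inj.
by rewrite [RHS]tuple_eta.
Qed.

Lemma big_tuple0 (V : zmodType) (I : finType) (F : 0.-tuple I -> V) :
  \sum_t F t = F [tuple].
Proof.
rewrite (bigD1 [tuple]) //= big1 ?addr0 // => t /negP[].
by apply/eqP; exact: tuple0.
Qed.

End Tuples.

Section Convolution.
Variables (R : realType) (N : nat).
Local Notation C := R[i].
Local Notation letter := ('I_N * 'I_N)%type.

Lemma convol_nil (f g : seq letter -> C) :
  convol f g [::] = f [::] * g [::].
Proof. by rewrite /convol /= big_tuple0. Qed.

Lemma convol_cons (f g : seq letter -> C) a w :
  convol f g (a :: w) =
  \sum_c convol (fun v => f ((a.1, c) :: v)) (fun v => g ((c, a.2) :: v)) w.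
Proof. by rewrite /convol /= big_tupleS. Qed.

Lemma convolZ (c d : C) (f g : seq letter -> C) w :
  convol (fun v => c * f v) (fun v => d * g v) w = c * d * convol f g w.
Proof.
by rewrite /convol mulr_sumr; apply: eq_bigr => k _ /=; ring.
Qed.

End Convolution.

Section TensorRank.
Variables (R : realType) (N : nat).
Local Notation C := R[i].
Local Notation letter := ('I_N * 'I_N)%type.
Local Notation poly := (ncpoly R N).

Lemma tensorE (P Q : poly) : tensor P Q =
  lext (fun v => lext (fun w => << (v, w) >> : ncpoly2 R N) Q) P.
Proof.
apply: eq_bigr => v _; rewrite scaler_sumr; apply: eq_bigr => w _.
by rewrite scalerA -malgUZ.
Qed.

Lemma tensorP (a : C) (P P' Q : poly) :
  tensor (a *: P + P') Q = a *: tensor P Q + tensor P' Q.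
Proof. by rewrite !tensorE linearP. Qed.

Lemma tensorr_is_linear P : linear (tensor P : poly -> ncpoly2 R N).
Proof.
move=> a Q Q'; rewrite !tensorE scaler_sumr -big_split /=.
apply: eq_bigr => v _.
by rewrite linearP scalerDr !scalerA mulrC.
Qed.
HB.instance Definition _ P :=
  GRing.isLinear.Build C poly (ncpoly2 R N) _ (tensor P) (tensorr_is_linear P).

Lemma tensorUU (c d : C) (v w : word N) :
  tensor << c *g v >> << d *g w >> = << c * d *g (v, w) >>.
Proof. by rewrite tensorE !lextU scalerA -malgUZ. Qed.

(** A tensor killed by f (x) g for all f, g in a family of functionals lies in
    I (x) A + A (x) I, where I is the common kernel of the family.  If the left
    factor of the first term is not in I, some f detects it, and the relations
    obtained by applying f (x) g say that its right factor can be corrected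
    modulo I by the other right factors; this shortens the tensor. *)
Lemma tensor_split (Phi : (seq letter -> C) -> Prop) (I : qgrp R N) :
  (forall P, I P <-> forall f, Phi f -> pairing f P = 0) ->
  forall s : seq (poly * poly),
  (forall f g, Phi f -> Phi g ->
     \sum_(p <- s) pairing f p.1 * pairing g p.2 = 0) ->
  exists s' : seq (poly * poly),
    (forall p, p \in s' -> I p.1 \/ I p.2) /\
    \sum_(p <- s) tensor p.1 p.2 = \sum_(p <- s') tensor p.1 p.2.
Proof.
move=> hI s; have [n] := ubnP (size s); elim: n s => // n IH [|[a b] s] /=.
  by move=> _ _; exists [::].
rewrite ltnS => sn h.
have [Ia|nIa] := pselect (I a).
  have [f g ff gg|s' [hs' es']] := IH s sn.
    have := h f g ff gg; rewrite big_cons /=.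
    by have /hI/(_ f ff) -> := Ia; rewrite mul0r add0r.
  exists ((a, b) :: s'); split; last by rewrite !big_cons es'.
  by move=> p; rewrite inE => /orP[/eqP->|/hs']; [left|].
have [f0 [Pf0 nf0]] : exists f0, Phi f0 /\ pairing f0 a != 0.
  apply: contrapT => hn; apply: nIa; apply/hI => f Pf.
  by apply/eqP; apply: contrapT => /negP nf; apply: hn; exists f.
pose k (p : poly * poly) : C := pairing f0 p.1 / pairing f0 a.
pose b' := b + \sum_(p <- s) k p *: p.2.
have Ib' : I b'.
  apply/hI => g Pg; rewrite linearD linear_sum /=.
  have := h f0 g Pf0 Pg; rewrite big_cons /= => e.
  apply: (mulfI nf0); rewrite mulr0; apply: etrans e; rewrite mulrDr mulr_sumr; congr (_ + _).
  by apply: eq_bigr => p _; rewrite linearZ /= mulrA [_ * k p]mulrC divfK.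
pose t (p : poly * poly) := (p.1 - k p *: a, p.2).
have et : tensor a b + \sum_(p <- s) tensor p.1 p.2 =
          tensor a b' + \sum_(p <- [seq t p | p <- s]) tensor p.1 p.2.
  rewrite linearD linear_sum -addrA; congr (_ + _).
  rewrite big_map -big_split; apply: eq_bigr => p _ /=.
  have -> : p.1 - k p *: a = (- k p) *: a + p.1 by rewrite addrC scaleNr.
  by rewrite linearZ /= tensorP scaleNr addNKr.
have [|f g ff gg|s' [hs' es']] := IH [seq t p | p <- s].
- by rewrite size_map.
- rewrite big_map; have := h f g ff gg; rewrite big_cons /=.
  have /hI/(_ g gg) := Ib'; rewrite linearD linear_sum /= => /eqP.
  rewrite addr_eq0 => /eqP ->; rewrite mulrN mulr_sumr addrC -sumrB => e.
  apply: etrans e; apply: eq_bigr => p _ /=.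
  by rewrite linearB /= !pairingZ; ring.
exists ((a, b') :: s'); split; last first.
  by rewrite [LHS]big_cons [RHS]big_cons; apply: etrans et _; congr (_ + _).
by move=> p; rewrite inE => /orP[/eqP->|/hs']; [right|].
Qed.

Lemma comul_tensors (P : poly) : exists s : seq (poly * poly),
  comul P = \sum_(p <- s) tensor p.1 p.2.
Proof.
pose G (w : word N) (k : (size w).-tuple 'I_N) : poly * poly :=
  (<< P@_w *g FMonom (zip (unzip1 w) k) >>, << FMonom (zip k (unzip2 w)) >>).
exists (flatten [seq [seq G w k | k <- enum {: (size w).-tuple 'I_N}]
                | w <- enum_fset (msupp P)]).
rewrite big_flatten big_map; apply: eq_bigr => w _.
rewrite big_map big_enum; apply: eq_bigr => k _.
by rewrite tensorUU mulr1.
Qed.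

End TensorRank.

Section Kronecker.
Variables (R : realType) (N : nat).
Local Notation C := R[i].
Local Notation letter := ('I_N * 'I_N)%type.
Local Notation poly := (ncpoly R N).

Lemma starE n (A : 'M[C]_n.+1) i j : star A i j = (A j i)^*.
Proof. by rewrite !mxE. Qed.

Definition tens m n (A : 'M[C]_m.+1) (B : 'M[C]_n.+1) :
  'M[C]_((n + m * n.+1).+1) := A *t B.

(** The row of a Kronecker product indexed by a pair of rows. *)
Definition tix m n (i : 'I_m.+1) (j : 'I_n.+1) : 'I_((n + m * n.+1).+1) :=
  @mxtens_index m.+1 n.+1 (i, j).

Section Fixed.
Variables (m n : nat).
Implicit Types (A : 'M[C]_m.+1) (B : 'M[C]_n.+1).

Lemma tensE A B i j k l :
  tens A B (tix i j) (tix k l) = A i k * B j l.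
Proof. exact: tensmxE. Qed.

Lemma tens_eqP (X Y : 'M[C]_((n + m * n.+1).+1)) :
  (forall (i k : 'I_m.+1) (j l : 'I_n.+1),
     X (tix i j) (tix k l) =
     Y (tix i j) (tix k l)) -> X = Y.
Proof.
move=> e; apply/matrixP => a b.
rewrite -(@mxtens_unindexK m.+1 n.+1 a) -(@mxtens_unindexK m.+1 n.+1 b).
case: (@mxtens_unindex m.+1 n.+1 a) => i j.
case: (@mxtens_unindex m.+1 n.+1 b) => k l; exact: e.
Qed.

Lemma tensM A A' B B' : tens A B * tens A' B' = tens (A * A') (B * B').
Proof. exact: (tensmx_mul A B A' B'). Qed.

Lemma tens11 : tens (1 : 'M[C]_m.+1) (1 : 'M[C]_n.+1) = 1.
Proof.
apply: tens_eqP => i k j l; rewrite tensE !mxE.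
rewrite (inj_eq (can_inj (@mxtens_indexK m.+1 n.+1)) (i, j)) xpair_eqE.
by case: (i == k); case: (j == l); rewrite ?mul1r ?mul0r.
Qed.

Lemma tens_suml (I : Type) (r : seq I) (F : I -> 'M[C]_m.+1) B :
  tens (\sum_(i <- r) F i) B = \sum_(i <- r) tens (F i) B.
Proof.
apply: tens_eqP => i k j l; rewrite tensE !summxE mulr_suml.
by apply: eq_bigr => x _; rewrite tensE.
Qed.

Lemma tens_sumr (I : Type) (r : seq I) A (F : I -> 'M[C]_n.+1) :
  tens A (\sum_(i <- r) F i) = \sum_(i <- r) tens A (F i).
Proof.
apply: tens_eqP => i k j l; rewrite tensE !summxE mulr_sumr.
by apply: eq_bigr => x _; rewrite tensE.
Qed.

Lemma tensZ (c d : C) A B : tens (c *: A) (d *: B) = (c * d) *: tens A B.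
Proof. by apply: tens_eqP => i k j l; rewrite [RHS]mxE !tensE !mxE; ring. Qed.

Lemma tens0l B : tens (0 : 'M[C]_m.+1) B = 0.
Proof. by apply: tens_eqP => i k j l; rewrite tensE !mxE mul0r. Qed.
Lemma tens0r A : tens A (0 : 'M[C]_n.+1) = 0.
Proof. by apply: tens_eqP => i k j l; rewrite tensE !mxE mulr0. Qed.

Lemma star_tens A B : star (tens A B) = tens (star A) (star B).
Proof.
by apply: tens_eqP => i k j l; rewrite tensE !starE tensE rmorphM.
Qed.

(** The coproduct of two models: its coefficients are the convolutions of the
    coefficients of the factors, which is why the common kernel of a class of
    models stable under this operation is a Hopf ideal. *)
Definition mxconvol (u : 'M['M[C]_m.+1]_N) (u' : 'M['M[C]_n.+1]_N) :
    'M['M[C]_((n + m * n.+1).+1)]_N :=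
  \matrix_(i, j) \sum_k tens (u i k) (u' k j).

Lemma mxconvol_convol u u' w i j k l :
  wval (mxconvol u u') w (tix i j) (tix k l) =
  convol (fun v => wval u v i k) (fun v => wval u' v j l) w.
Proof.
suff -> : wval (mxconvol u u') w = \sum_(t : (size w).-tuple 'I_N)
    tens (wval u (zip (unzip1 w) t)) (wval u' (zip t (unzip2 w))).
  by rewrite summxE; apply: eq_bigr => t _; rewrite tensE.
elim: w => [|[a b] w IH]; first by rewrite big_tuple0 /= !wval_nil tens11.
rewrite wval_cons big_tupleS mxE /= IH mulr_suml; apply: eq_bigr => c _.
rewrite mulr_sumr; apply: eq_bigr => t _.
by rewrite tensM !wval_cons.
Qed.

End Fixed.
End Kronecker.

(** * Finite-dimensional models *)

Section FiniteModels.
Variables (R : realType) (N : nat).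
Local Notation C := R[i].
Local Notation letter := ('I_N * 'I_N)%type.
Local Notation poly := (ncpoly R N).

Lemma eval_pairing n (u : 'M['M[C]_n.+1]_N) (P : poly) s t :
  eval u P s t = pairing (fun w => wval u w s t) P.
Proof.
rewrite pairingE evalE summxE; apply: eq_bigr => w _; by rewrite mxE.
Qed.

Lemma ann_model (I : qgrp R N) n (u : 'M['M[C]_n.+1]_N) s t :
  (forall P, I P -> eval u P = 0) -> ann I (fun w => wval u w s t).
Proof. by move=> h P /h e; rewrite -eval_pairing e mxE. Qed.

Lemma star0 (A : cstarAlgType R) : star (0 : A) = 0.
Proof. by have := starZ 0 (0 : A); rewrite scale0r conjC0 scale0r. Qed.

Lemma star_sum (A : cstarAlgType R) (T : Type) (r : seq T) (F : T -> A) :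
  star (\sum_(i <- r) F i) = \sum_(i <- r) star (F i).
Proof.
exact: (big_morph star (@starD R A) (star0 A)).
Qed.

Lemma star1 (A : cstarAlgType R) : star (1 : A) = 1.
Proof. by rewrite -[LHS]mulr1 -{2}[1]starK -starM mulr1 starK. Qed.

Lemma star_wval (A : cstarAlgType R) (u : 'M[A]_N) w :
  (forall i j, star (u i j) = u i j) -> star (wval u w) = wval u (rev w).
Proof.
move=> su; elim: w => [|a w IH]; first by rewrite wval_nil star1.
by rewrite wval_cons starM su IH rev_cons -cats1 wval_cat wval_cons wval_nil mulr1.
Qed.

Lemma eval_star (A : cstarAlgType R) (u : 'M[A]_N) P :
  (forall i j, star (u i j) = u i j) -> eval u (poly_star P) = star (eval u P).
Proof.
move=> su; rewrite evalE linear_sum evalE star_sum; apply: eq_bigr => w _.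
by rewrite /= lextU starZ star_wval.
Qed.

(** The model u_ij |-> u_ji^T, which implements the antipode. *)
Definition trmodel n (u : 'M['M[C]_n.+1]_N) : 'M['M[C]_n.+1]_N :=
  \matrix_(i, j) (u j i)^T.

Lemma wval_trmodel n (u : 'M['M[C]_n.+1]_N) w :
  wval (trmodel u) w = (wval u (rev [seq (x.2, x.1) | x <- w]))^T.
Proof.
elim: w => [|a w IH]; first by rewrite !wval_nil trmx1.
rewrite wval_cons IH /= rev_cons -cats1 wval_cat wval_cons wval_nil mulr1 mxE.
by rewrite [RHS]trmx_mul.
Qed.

Lemma eval_antipode n (u : 'M['M[C]_n.+1]_N) P :
  eval u (antipode P) = (eval (trmodel u) P)^T.
Proof.
rewrite !evalE !linear_sum; apply: eq_bigr => w _.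
by rewrite /= lextU linearZ /= wval_trmodel trmxK.
Qed.

Lemma orth_sums (A : nzRingType) (u : 'M[A]_N) :
  (u *m u^T = 1%:M /\ u^T *m u = 1%:M) <->
  (forall i j, \sum_k u i k * u j k = (i == j)%:R /\
               \sum_k u k i * u k j = (i == j)%:R).
Proof.
split=> [[e1 e2] i j|h].
  have := congr1 (fun m : 'M_N => m i j) e1.
  have := congr1 (fun m : 'M_N => m i j) e2.
  rewrite !mxE => {e1 e2} e2 e1; split.
    by rewrite -e1; apply: eq_bigr => k _; rewrite !mxE.
  by rewrite -e2; apply: eq_bigr => k _; rewrite !mxE.
split; apply/matrixP => i j; rewrite !mxE; have [h1 h2] := h i j.
  by rewrite -h1; apply: eq_bigr => k _; rewrite !mxE.
by rewrite -h2; apply: eq_bigr => k _; rewrite !mxE.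
Qed.

Lemma mxconvol_Oplus m n (u : 'M['M[C]_m.+1]_N) (u' : 'M['M[C]_n.+1]_N) :
  rel_Oplus u -> rel_Oplus u' -> rel_Oplus (mxconvol u u').
Proof.
move=> [su /orth_sums ou] [su' /orth_sums ou']; split.
  move=> i j; rewrite mxE star_sum; apply: eq_bigr => k _.
  by rewrite star_tens su su'.
have key (v : 'I_N -> 'I_N -> 'M[C]_m.+1) (v' : 'I_N -> 'I_N -> 'M[C]_n.+1) i j :
    (forall k l, \sum_c v' k c * v' l c = (k == l)%:R) ->
    \sum_k v i k * v j k = (i == j)%:R ->
    \sum_c (\sum_k tens (v i k) (v' k c)) * (\sum_k tens (v j k) (v' k c))
      = (i == j)%:R :> 'M[C]_((n + m * n.+1).+1).
  move=> h' h; under eq_bigr do rewrite mulr_suml.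
  under eq_bigr do under eq_bigr do rewrite mulr_sumr.
  rewrite exchange_big /=; under eq_bigr do rewrite exchange_big /=.
  transitivity (\sum_k tens (v i k * v j k) 1 : 'M[C]_((n + m * n.+1).+1)).
    apply: eq_bigr => k _; rewrite (bigD1 k) //= [X in _ + X]big1 ?addr0.
      by under eq_bigr do rewrite tensM; rewrite -tens_sumr h' eqxx.
    move=> l lk; under eq_bigr do rewrite tensM.
    by rewrite -tens_sumr h' eq_sym (negbTE lk) tens0r.
  rewrite -tens_suml h; case: eqP => _; first exact: tens11.
  exact: tens0l.
have key2 (v : 'I_N -> 'I_N -> 'M[C]_m.+1) (v' : 'I_N -> 'I_N -> 'M[C]_n.+1) i j :
    (forall k l, \sum_c v c k * v c l = (k == l)%:R) ->
    \sum_k v' k i * v' k j = (i == j)%:R ->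
    \sum_c (\sum_k tens (v c k) (v' k i)) * (\sum_k tens (v c k) (v' k j))
      = (i == j)%:R :> 'M[C]_((n + m * n.+1).+1).
  move=> h' h; under eq_bigr do rewrite mulr_suml.
  under eq_bigr do under eq_bigr do rewrite mulr_sumr.
  rewrite exchange_big /=; under eq_bigr do rewrite exchange_big /=.
  transitivity (\sum_k tens 1 (v' k i * v' k j) : 'M[C]_((n + m * n.+1).+1)).
    apply: eq_bigr => k _; rewrite (bigD1 k) //= [X in _ + X]big1 ?addr0.
      by under eq_bigr do rewrite tensM; rewrite -tens_suml h' eqxx.
    move=> l lk; under eq_bigr do rewrite tensM.
    by rewrite -tens_suml h' eq_sym (negbTE lk) tens0l.
  rewrite -tens_sumr h; case: eqP => _; first exact: tens11.
  exact: tens0r.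
apply/orth_sums => i j; split.
  under eq_bigr do rewrite !mxE.
  by apply: key => [k l|]; [exact: (ou' k l).1 | exact: (ou i j).1].
under eq_bigr do rewrite !mxE.
by apply: key2 => [k l|]; [exact: (ou k l).2 | exact: (ou' i j).2].
Qed.

Lemma trmodel_Oplus n (u : 'M['M[C]_n.+1]_N) :
  rel_Oplus u -> rel_Oplus (trmodel u).
Proof.
move=> [su /orth_sums ou]; split.
  by move=> i j; rewrite mxE -{2}[u j i]su; apply/matrixP => s t; rewrite !mxE.
have T1 (b : bool) : (b%:R : 'M[C]_n.+1)^T = b%:R.
  by case: b; rewrite ?trmx1 ?trmx0.
apply/orth_sums => i j; have [h1 h2] := ou j i; rewrite eq_sym; split.
  rewrite -T1 -h2 linear_sum /=; apply: eq_bigr => k _.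
  by rewrite !mxE [RHS]trmx_mul.
rewrite -T1 -h1 linear_sum /=; apply: eq_bigr => k _.
by rewrite !mxE [RHS]trmx_mul.
Qed.

(** The one-dimensional model u_ij |-> delta_ij, which implements the counit. *)
Definition onemodel : 'M['M[C]_1]_N := 1%:M.

Lemma onemodelE i j : onemodel i j = (i == j)%:R.
Proof. by rewrite mxE. Qed.

Lemma onemodel_Oplus : rel_Oplus onemodel.
Proof.
split; last by rewrite /onemodel trmx1 mulmx1.
move=> i j; rewrite onemodelE; case: (i == j); first exact: star1.
by apply/matrixP => s t; rewrite !mxE conjC0.
Qed.

Lemma wval_onemodel w : wval onemodel w 0 0 = wcounit R w.
Proof.
elim: w => [|a w IH]; first by rewrite wval_nil /wcounit big_nil mxE eqxx.
have -> : wcounit R (a :: w) = (a.1 == a.2)%:R * wcounit R w by exact: big_cons.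
rewrite wval_cons -IH onemodelE; case: (_ == _).
  by rewrite !mul1r.
by rewrite !mul0r mxE.
Qed.

Definition fdkernel (rel : relations R N) : qgrp R N :=
  [set P | forall n (u : 'M['M[C]_n.+1]_N),
     rel_Oplus u -> rel 'M[C]_n.+1 u -> eval u P = 0]%classic.

Lemma impose_fdkernel rel P : impose rel P -> fdkernel rel P.
Proof. by move=> h n u; exact: h. Qed.

(** Stability under mxconvol gives the coproduct, by tensor_split applied to the
    coefficients of the models; trmodel gives the antipode and onemodel the
    counit. *)
Lemma fdkernel_closed (rel : relations R N) :
  (forall m n (u : 'M['M[C]_m.+1]_N) (u' : 'M['M[C]_n.+1]_N),
     rel 'M[C]_m.+1 u -> rel 'M[C]_n.+1 u' ->
     rel 'M[C]_((n + m * n.+1).+1) (mxconvol u u')) ->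
  (forall n (u : 'M['M[C]_n.+1]_N),
     rel 'M[C]_n.+1 u -> rel 'M[C]_n.+1 (trmodel u)) ->
  rel 'M[C]_1 onemodel ->
  closed_qsubgroup (fdkernel rel).
Proof.
move=> htens htr hone.
pose Phi (f : seq letter -> C) := exists n (u : 'M['M[C]_n.+1]_N) s t,
  [/\ rel_Oplus u, rel 'M[C]_n.+1 u & f = fun w => wval u w s t].
have hPhi P : fdkernel rel P <-> forall f, Phi f -> pairing f P = 0.
  split=> [h f [n [u [s [t [ou ru ->]]]]]|h n u ou ru].
    by rewrite -eval_pairing h ?mxE.
  apply/matrixP => s t; rewrite eval_pairing mxE; apply: h.
  by exists n, u, s, t.
split.
- by move=> n u _ _; rewrite evalE linear0.
- by move=> P Q hP hQ n u ou ru; rewrite evalD hP // hQ // addr0.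
- by move=> P Q hQ n u ou ru; rewrite evalM hQ // mulr0.
- by move=> P Q hP n u ou ru; rewrite evalM hP // mul0r.
- move=> i j; split=> n u [_ /orth_sums ou] _; have [h1 h2] := ou i j.
    rewrite !mxE evalE linearB linear_sum /=.
    have -> : lext (fun w : word N => wval u w) ((i == j)%:R : poly) = (i == j)%:R.
      by case: (i == j); rewrite ?linear0 // -evalE eval1.
    rewrite -h1; apply/eqP; rewrite subr_eq0; apply/eqP; apply: eq_bigr => k _.
    by rewrite -evalE evalM eval_gen [X in eval u X]mxE eval_gen.
  rewrite !mxE evalE linearB linear_sum /=.
  have -> : lext (fun w : word N => wval u w) ((i == j)%:R : poly) = (i == j)%:R.
    by case: (i == j); rewrite ?linear0 // -evalE eval1.
  rewrite -h2; apply/eqP; rewrite subr_eq0; apply/eqP; apply: eq_bigr => k _.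
  by rewrite -evalE evalM eval_gen [X in eval u X]mxE eval_gen.
- move=> P hP n u ou ru; rewrite eval_star; last exact: ou.1.
  by rewrite hP // star0.
- move=> P hP; have [s es] := comul_tensors P.
  have [|s' [hs' es']] := tensor_split hPhi (s := s).
    move=> f g [m [u [a [b [ou ru ->]]]]] [n [u' [c [d [ou' ru' ->]]]]].
    have := pairing2_comul (fun w => wval u w a b) (fun w => wval u' w c d) P.
    rewrite es linear_sum => e.
    transitivity (pairing (convol (fun w => wval u w a b) (fun w => wval u' w c d)) P).
      by rewrite -e; apply: eq_bigr => p _; rewrite /= pairing2_tensor.
    rewrite -(eq_pairing P (fun w => mxconvol_convol u u' w a c b d)).
    rewrite -eval_pairing hP ?mxE //; first exact: mxconvol_Oplus.
    exact: htens.
  by exists s'; rewrite es.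
- move=> P hP; have := hP 0%N onemodel onemodel_Oplus hone.
  move/matrixP/(_ 0 0); rewrite eval_pairing mxE.
  by rewrite (eq_pairing P wval_onemodel) pairingE.
- move=> P hP n u ou ru; rewrite eval_antipode hP ?trmx0 //.
    exact: trmodel_Oplus.
  exact: htr.
Qed.

End FiniteModels.

(** * Classes of functionals and derivations *)

Section TupleSums.
Variables (C : comNzRingType) (N : nat).
Implicit Types (F : seq 'I_N -> C).

(** Sum over the words of length n; the summand is a function on all words, so
    that lengths can be rewritten without casts. *)
Definition tsum n F : C := \sum_(t : n.-tuple 'I_N) F t.

Lemma tsum0 F : tsum 0 F = F [::].
Proof. exact: big_tuple0. Qed.

Lemma tsumS n F : tsum n.+1 F = \sum_c tsum n (fun s => F (c :: s)).
Proof. exact: big_tupleS. Qed.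

Lemma eq_tsum n F G : (forall s, size s = n -> F s = G s) -> tsum n F = tsum n G.
Proof. by move=> e; apply: eq_bigr => t _; rewrite e ?size_tuple. Qed.

Lemma tsum_eq0 n F : (forall s, size s = n -> F s = 0) -> tsum n F = 0.
Proof. by move=> e; apply: big1 => t _; rewrite e ?size_tuple. Qed.

Lemma tsum_sum (I : Type) (r : seq I) n (F : I -> seq 'I_N -> C) :
  tsum n (fun s => \sum_(i <- r) F i s) = \sum_(i <- r) tsum n (F i).
Proof. exact: exchange_big. Qed.

Lemma tsumD n F G : tsum n (fun s => F s + G s) = tsum n F + tsum n G.
Proof. exact: big_split. Qed.

Lemma tsum_mulr n F c : tsum n (fun s => F s * c) = tsum n F * c.
Proof. by rewrite /tsum mulr_suml. Qed.

Lemma tsum_mull n F c : tsum n (fun s => c * F s) = c * tsum n F.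
Proof. by rewrite /tsum mulr_sumr. Qed.

Lemma tsum_exchange m n (F : seq 'I_N -> seq 'I_N -> C) :
  tsum m (fun s => tsum n (F s)) = tsum n (fun t => tsum m (F^~ t)).
Proof. exact: exchange_big. Qed.

Lemma tsum_cat m n F :
  tsum (m + n) F = tsum m (fun s => tsum n (fun t => F (s ++ t))).
Proof.
elim: m F => [|m IH] F; first by rewrite tsum0.
by rewrite addSn !tsumS; apply: eq_bigr => c _; rewrite IH.
Qed.

Lemma tsum_rcons n F :
  tsum n.+1 F = tsum n (fun s => \sum_c F (rcons s c)).
Proof.
rewrite -addn1 tsum_cat; apply: eq_tsum => s _.
by rewrite tsumS; apply: eq_bigr => c _; rewrite tsum0 cats1.
Qed.

Lemma zip_unzip12 (T U : Type) (s : seq T) (t : seq U) : size s = size t ->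
  unzip1 (zip s t) = s /\ unzip2 (zip s t) = t.
Proof. by move=> e; rewrite unzip1_zip ?unzip2_zip ?e. Qed.

End TupleSums.

Section FunctionalClass.
Variables (R : realType) (N : nat).
Local Notation C := R[i].
Local Notation letter := ('I_N * 'I_N)%type.

Lemma convol_tsum (f g : seq letter -> C) i j : size i = size j ->
  convol f g (zip i j) = tsum (size j) (fun k => f (zip i k) * g (zip k j)).
Proof.
move=> e; have [e1 e2] := zip_unzip12 e.
rewrite /convol e1 e2 -[LHS]/(tsum _ (fun k => f (zip i k) * g (zip k j))).
by rewrite size_zip e minnn.
Qed.

(** The properties of the annihilator of a Hopf ideal that are used below.  They
    are stable under transposition, i.e. under u_ij |-> u_ji. *)
Record funclass (E : (seq letter -> C) -> Prop) : Prop := {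
  fc_ext : forall f g, f =1 g -> E f -> E g;
  fc_sum : forall (T : Type) (r : seq T) (c : T -> C) F,
    (forall t, E (F t)) -> E (fun w => \sum_(t <- r) c t * F t w);
  fc_convol : forall f g, E f -> E g -> E (convol f g);
  fc_shift : forall f v w, E f -> E (fun x => f (v ++ x ++ w));
  fc_orth : forall f v w i i', E f ->
    \sum_c f (v ++ [:: (i, c); (i', c)] ++ w) = (i == i')%:R * f (v ++ w);
  fc_orth' : forall f v w i i', E f ->
    \sum_c f (v ++ [:: (c, i); (c, i')] ++ w) = (i == i')%:R * f (v ++ w);
  fc_counit : E (@wcounit R N)
}.

Lemma ann_funclass (I : qgrp R N) : closed_qsubgroup I -> funclass (ann I).
Proof.
move=> hI; split.
- exact: ann_ext.
- by move=> T r c F; exact: ann_sum.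
- exact: ann_convol.
- exact: ann_shift.
- by move=> f v w i i' /(ann_orth hI v w i i')[].
- by move=> f v w i i' /(ann_orth hI v w i i')[].
- exact: ann_counit.
Qed.

Definition swapw (w : seq letter) : seq letter := [seq (x.2, x.1) | x <- w].

Definition tr_class (E : (seq letter -> C) -> Prop) f := E (fun w => f (swapw w)).

Lemma swapwK w : swapw (swapw w) = w.
Proof. by rewrite /swapw -map_comp; apply: map_id_in => [[]]. Qed.

Lemma swapw_zip i j : swapw (zip i j) = zip j i.
Proof. by elim: i j => [|a i IH] [|b j] //=; rewrite -IH. Qed.

Lemma zip_unzip (w : seq letter) : zip (unzip1 w) (unzip2 w) = w.
Proof. exact: zip_unzip. Qed.

Lemma convol_swapw (f g : seq letter -> C) w :
  convol f g (swapw w) =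
  convol (fun v => g (swapw v)) (fun v => f (swapw v)) w.
Proof.
rewrite -[w]zip_unzip swapw_zip !convol_tsum ?size_map //.
by apply: eq_tsum => k _; rewrite !swapw_zip mulrC.
Qed.

Lemma tr_funclass E : funclass E -> funclass (tr_class E).
Proof.
move=> hE; split.
- by move=> f g e; apply: (fc_ext hE) => w.
- by move=> T r c F hF; exact: (fc_sum hE r c hF).
- move=> f g hf hg; apply: (fc_ext hE) (fc_convol hE hg hf) => w.
  exact/esym/convol_swapw.
- move=> f v w hf; apply: (fc_ext hE) (fc_shift hE (swapw v) (swapw w) hf) => x.
  by rewrite /swapw !map_cat -!/(swapw _) !swapwK.
- move=> f v w i i' hf.
  have := fc_orth' hE (swapw v) (swapw w) i i' hf.
  rewrite /swapw map_cat -!/(swapw _) !swapwK => <-; apply: eq_bigr => c _.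
  by rewrite !map_cat -!/(swapw _) !swapwK.
- move=> f v w i i' hf.
  have := fc_orth hE (swapw v) (swapw w) i i' hf.
  rewrite /swapw map_cat -!/(swapw _) !swapwK => <-; apply: eq_bigr => c _.
  by rewrite !map_cat -!/(swapw _) !swapwK.
- apply: (fc_ext hE) (fc_counit hE) => w.
  by rewrite /wcounit big_map; apply: eq_bigr => x _; rewrite eq_sym.
Qed.

Section Derivations.
Implicit Types (eta : seq 'I_N -> C) (j : seq 'I_N).

(** A functional b is a matrix b(i, j) in each degree, which acts on the right on
    the vectors eta, seen as functions on the words i. *)
Definition act (b : seq letter -> C) eta j : C :=
  tsum (size j) (fun i => eta i * b (zip i j)).

(** The derivative at the identity of a word in a one-parameter family tangent to
    d: one letter is replaced by d and the others by the identity.  The factor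
    kappa is multiplied over the letters before the differentiated one; it is
    the sign produced by moving an anticommuting element to the left. *)
Fixpoint deriv (kappa : 'I_N -> C) (d : 'I_N -> 'I_N -> C) (s : C)
    (w : seq letter) : C :=
  if w is x :: w' then
    s * d x.1 x.2 * wcounit R w' +
    (x.1 == x.2)%:R * deriv kappa d (s * kappa x.2) w'
  else 0.

Lemma tsum_wcounit eta j :
  tsum (size j) (fun i => eta i * wcounit R (zip i j)) = eta j.
Proof.
elim: j eta => [|c j IH] eta; first by rewrite tsum0 /wcounit big_nil mulr1.
rewrite tsumS (bigD1 c) //= [X in _ + X]big1 ?addr0.
  rewrite -[RHS](IH (fun t => eta (c :: t))); apply: eq_tsum => t _.
  by rewrite /wcounit big_cons eqxx mul1r.
move=> i ic; apply: tsum_eq0 => t _.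
by rewrite /wcounit big_cons /= (negbTE ic) mul0r mulr0.
Qed.

Lemma act_deriv kappa d s eta j (l0 : 'I_N) :
  act (deriv kappa d s) eta j =
  \sum_(p < size j) s * (\prod_(c <- take p j) kappa c) *
     \sum_c d c (nth l0 j p) * eta (set_nth l0 j p c).
Proof.
rewrite /act; elim: j s eta => [|c j IH] s eta.
  by rewrite tsum0 big_ord0 mulr0.
rewrite tsumS big_ord_recl /= big_nil mulr1.
transitivity (\sum_i (s * (d i c * eta (i :: j)) + (i == c)%:R *
    tsum (size j) (fun t => eta (i :: t) * deriv kappa d (s * kappa c) (zip t j)))).
  apply: eq_bigr => i _; rewrite -[eta (i :: j)](tsum_wcounit (fun t => eta (i :: t))).
  rewrite -!tsum_mull -[RHS]big_split /=; apply: eq_bigr => t _; ring.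
rewrite big_split /= -mulr_sumr; congr (_ + _).
rewrite (bigD1 c) //= eqxx mul1r big1 ?addr0; last first.
  by move=> i /negbTE ->; rewrite mul0r.
rewrite IH; apply: eq_bigr => p _; rewrite /= big_cons; ring.
Qed.

End Derivations.
End FunctionalClass.

(** * The weight operator *)

Section KeyLemma.
Variables (R : realType) (N : nat).
Local Notation C := R[i].
Local Notation letter := ('I_N * 'I_N)%type.
Variables (E : (seq letter -> C) -> Prop) (hE : funclass E).
Variables (l0 l1 : 'I_N).
Hypothesis l01 : l0 != l1.

(** The signs of the twisted rotation: l0 and l1 anticommute with the product of
    the two Clifford generators that they index, the other letters commute with
    it. *)
Definition kap (c : 'I_N) : C := if (c == l0) || (c == l1) then -1 else 1.
Definition dR (a b i j : 'I_N) : C :=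
  ((i == a) && (j == b))%:R - ((i == b) && (j == a))%:R.
Definition dB (i j : 'I_N) : C :=
  ((i == l0) && (j == l1))%:R + ((i == l1) && (j == l0))%:R.

Definition rot a b : seq letter -> C := deriv (fun=> 1) (dR a b) 1.
Definition twrot : seq letter -> C := deriv kap dB 1.

Hypothesis hR : forall a b, a != b -> E (rot a b).
Hypothesis hB : E twrot.

Implicit Types (eta : seq 'I_N -> C) (j w : seq 'I_N).

Definition alternate (b : nat) : 'I_N := if odd b then l1 else l0.
Local Notation lt := alternate.
Definition altword b k := mkseq (fun p => lt (p + b)) k.
Local Notation altw := altword.

Lemma altw0 b : altw b 0 = [::]. Proof. by []. Qed.

Lemma size_altw b k : size (altw b k) = k. Proof. exact: size_mkseq. Qed.

Lemma altwS b k : altw b k.+1 = lt b :: altw b.+1 k.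
Proof.
rewrite /altword /mkseq /= (iotaDl 1 0) -map_comp; congr cons.
by apply: eq_map => p /=; rewrite addnS.
Qed.

Lemma altw_cat b m n : altw b (m + n) = altw b m ++ altw (b + m) n.
Proof.
elim: m b => [|m IH] b; first by rewrite addn0.
by rewrite addSn !altwS IH addSnnS.
Qed.

Lemma altw_rcons b k : rcons (altw b k) (lt (b + k)) = altw b k.+1.
Proof. by rewrite -cats1 -addn1 altw_cat !altwS. Qed.

(** The vectors orthogonal to the orbit of the alternating word and to the
    images of the cups; the aim is to prove that they vanish. *)
Record Qspace (k : nat) eta : Prop := {
  Q_orth : forall a, E a ->
    tsum k (fun i => eta i * a (zip i (altw 0 k))) = 0;
  Q_cap : forall s t, (size s + size t).+2 = k ->
    \sum_c eta (s ++ [:: c; c] ++ t) = 0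
}.

Lemma Q_lin k (c : C) eta eta' : Qspace k eta -> Qspace k eta' ->
  Qspace k (fun j => c * eta j + eta' j).
Proof.
move=> [h1 h2] [h1' h2']; split.
  move=> a Ea.
  transitivity (c * tsum k (fun i => eta i * a (zip i (altw 0 k))) +
                tsum k (fun i => eta' i * a (zip i (altw 0 k)))).
    by rewrite -tsum_mull -tsumD; apply: eq_tsum => s _; ring.
  by rewrite h1 // h1' // mulr0 addr0.
move=> s t st; rewrite big_split -mulr_sumr /= h2 // h2' // mulr0 addr0 //.
Qed.

Lemma Q_ext k eta eta' : (forall j, size j = k -> eta j = eta' j) ->
  Qspace k eta -> Qspace k eta'.
Proof.
move=> e [h1 h2]; split.
  by move=> a Ea; apply: etrans (h1 a Ea); apply: eq_tsum => s sk; rewrite e.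
move=> s t st; apply: etrans (h2 s t st); apply: eq_bigr => c _; rewrite e //.
by rewrite -st !size_cat /= !addnS.
Qed.

(** Convolution keeps the orbit stable, and the orthogonality relations keep the
    cups stable. *)
Lemma Q_act k eta b : Qspace k eta -> E b -> Qspace k (act b eta).
Proof.
move=> [h1 h2] Eb; split.
  move=> a Ea; apply: etrans (h1 _ (fc_convol hE Eb Ea)).
  under eq_tsum => j sj do rewrite /act sj -tsum_mulr.
  rewrite tsum_exchange; apply: eq_tsum => i si.
  rewrite convol_tsum ?si ?size_altw // -tsum_mull.
  by apply: eq_tsum => j _; rewrite mulrA.
move=> s t st.
have sz c : size (s ++ [:: c; c] ++ t) = (size s + (size t).+2)%N.
  by rewrite !size_cat.
rewrite /act; under eq_bigr do rewrite sz.
rewrite -tsum_sum tsum_cat; apply: tsum_eq0 => i1 si1.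
rewrite tsumS; under eq_bigr do rewrite tsumS.
rewrite exchange_big; transitivity (\sum_p \sum_q tsum (size t) (fun i2 =>
    eta (i1 ++ [:: q; p] ++ i2) * ((q == p)%:R * b (zip i1 s ++ zip i2 t)))).
  apply: eq_bigr => p _; apply: eq_bigr => q _; apply: eq_tsum => i2 si2.
  rewrite -mulr_sumr; congr (_ * _); rewrite -(fc_orth hE) //.
  by apply: eq_bigr => c _; rewrite zip_cat.
transitivity (tsum (size t) (fun i2 =>
    (\sum_p eta (i1 ++ [:: p; p] ++ i2)) * b (zip i1 s ++ zip i2 t))).
  under [in RHS]eq_tsum do rewrite mulr_suml.
  rewrite tsum_sum; apply: eq_bigr => p _.
  rewrite (bigD1 p) //= [X in _ + X]big1 ?addr0.
    by apply: eq_tsum => i2 _; rewrite eqxx mul1r.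
  by move=> q /negbTE qp; apply: tsum_eq0 => i2 _; rewrite qp mul0r mulr0.
by apply: tsum_eq0 => i2 si2; rewrite h2 ?mul0r // si1 si2.
Qed.

Lemma act_rot a b eta j : act (rot a b) eta j =
  \sum_(p < size j) ((nth l0 j p == b)%:R * eta (set_nth l0 j p a) -
                     (nth l0 j p == a)%:R * eta (set_nth l0 j p b)).
Proof.
rewrite /rot (act_deriv _ _ _ _ _ l0); apply: eq_bigr => p _.
rewrite big1_eq !mul1r /dR.
under eq_bigr do rewrite mulrBl; rewrite sumrB; congr (_ - _).
  rewrite (bigD1 a) //= eqxx [X in _ + X]big1 ?addr0 // => c /negbTE ->.
  by rewrite mul0r.
rewrite (bigD1 b) //= eqxx [X in _ + X]big1 ?addr0 // => c /negbTE ->.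
by rewrite mul0r.
Qed.

(** In coordinates, both derivations are sums over the positions p of the letters
    l0, l1 of a flip l0 <-> l1 at p, with the sign rsg for the rotation and with
    the sign ksg, of the prefix, for the twisted one. *)
Definition oth (c : 'I_N) := if c == l0 then l1 else if c == l1 then l0 else c.
Definition flip p j := set_nth l0 j p (oth (nth l0 j p)).
Definition rsg (c : 'I_N) : C := (c == l1)%:R - (c == l0)%:R.
Definition esg (c : 'I_N) : C := ((c == l0) || (c == l1))%:R.
Definition ksg p j : C := \prod_(c <- take p j) kap c.

Let l10 : (l1 == l0) = false. Proof. by rewrite eq_sym (negbTE l01). Qed.

Lemma letterP c : [\/ c = l0, c = l1 | c != l0 /\ c != l1].
Proof.
case: (eqVneq c l0) => c0; first by constructor 1.
by case: (eqVneq c l1) => c1; [constructor 2 | constructor 3].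
Qed.

Let simpl_letters := (eqxx, l10, negbTE l01).

Lemma othK c : oth (oth c) = c.
Proof.
by rewrite /oth; case: (letterP c) => [->|->|[/negbTE c0 /negbTE c1]];
  rewrite ?simpl_letters ?c0 ?c1 ?simpl_letters ?c0 ?c1.
Qed.

Lemma rsg_oth c : rsg (oth c) = - rsg c.
Proof.
by rewrite /oth /rsg; case: (letterP c) => [->|->|[/negbTE c0 /negbTE c1]];
  rewrite ?simpl_letters ?c0 ?c1 ?simpl_letters ?c0 ?c1 /=; ring.
Qed.

Lemma esg_oth c : esg (oth c) = esg c.
Proof.
by rewrite /oth /esg; case: (letterP c) => [->|->|[/negbTE c0 /negbTE c1]];
  rewrite ?simpl_letters ?c0 ?c1 ?simpl_letters ?c0 ?c1 ?orbT.
Qed.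

Lemma kap_oth c : kap (oth c) = kap c.
Proof.
by rewrite /oth /kap; case: (letterP c) => [->|->|[/negbTE c0 /negbTE c1]];
  rewrite ?simpl_letters ?c0 ?c1 ?simpl_letters ?c0 ?c1 ?orbT.
Qed.

Lemma rsg_esg c : rsg c * esg c = rsg c.
Proof.
by rewrite /esg /rsg; case: (letterP c) => [->|->|[/negbTE c0 /negbTE c1]];
  rewrite ?simpl_letters ?c0 ?c1 /=; ring.
Qed.

Lemma act_rot01 eta j : act (rot l0 l1) eta j =
  \sum_(0 <= p < size j) rsg (nth l0 j p) * eta (flip p j).
Proof.
rewrite act_rot big_mkord; apply: eq_bigr => p _; rewrite /rsg /flip /oth.
by case: (letterP (nth l0 j p)) => [->|->|[/negbTE c0 /negbTE c1]];
  rewrite ?simpl_letters ?c0 ?c1 /=; ring.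
Qed.

Lemma act_twrot eta j : act twrot eta j =
  \sum_(0 <= p < size j) esg (nth l0 j p) * ksg p j * eta (flip p j).
Proof.
rewrite /twrot (act_deriv _ _ _ _ _ l0) big_mkord; apply: eq_bigr => p _.
rewrite mul1r -/(ksg p j); rewrite [esg _ * _]mulrC -mulrA; congr (_ * _).
rewrite /dB; under eq_bigr do rewrite mulrDl; rewrite big_split /=.
rewrite (bigD1 l0) //= eqxx [X in _ + X + _]big1 ?addr0; last first.
  by move=> c /negbTE ->; rewrite mul0r.
rewrite (bigD1 l1) //= eqxx [X in _ + (_ + X)]big1 ?addr0; last first.
  by move=> c /negbTE ->; rewrite mul0r.
rewrite /flip /oth /esg.
by case: (letterP (nth l0 j p)) => [->|->|[/negbTE c0 /negbTE c1]];
  rewrite ?simpl_letters ?c0 ?c1 /=; ring.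
Qed.

Lemma size_flip p j : (p < size j)%N -> size (flip p j) = size j.
Proof. by move=> pj; rewrite size_set_nth; apply/maxn_idPr. Qed.

Lemma nth_flip p q j : nth l0 (flip p j) q =
  if q == p then oth (nth l0 j p) else nth l0 j q.
Proof. by rewrite nth_set_nth. Qed.

Lemma flip_flip p j : (p < size j)%N -> flip p (flip p j) = j.
Proof.
move=> pj; apply: (@eq_from_nth _ l0); first by rewrite !size_flip ?size_flip.
move=> q _; rewrite nth_flip; case: eqP => [->|qp].
  by rewrite nth_flip eqxx othK.
by rewrite nth_flip; case: eqP.
Qed.

Lemma flipC p q j : (p < size j)%N -> (q < size j)%N ->
  flip p (flip q j) = flip q (flip p j).
Proof.
move=> pj qj; have [->|pq] := eqVneq p q; first by [].
apply: (@eq_from_nth _ l0); first by rewrite !size_flip ?size_flip.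
have pq' := negbTE pq; have qp' : (q == p) = false by rewrite eq_sym.
move=> r _; rewrite !nth_flip pq' qp'.
by case: (r =P p) => // ->; rewrite pq'.
Qed.

Lemma ksg_flip p q j : (p < size j)%N -> ksg q (flip p j) = ksg q j.
Proof.
move=> pj; suff e : map kap (flip p j) = map kap j.
  have k i : ksg q i = \prod_(x <- take q (map kap i)) x.
    by rewrite -map_take big_map.
  by rewrite !k e.
apply: (@eq_from_nth _ 0); rewrite !size_map size_flip // => i ij.
rewrite !(nth_map l0) ?size_flip // nth_flip; case: eqP => // ->.
exact: kap_oth.
Qed.

Definition weight j : C := \sum_(0 <= p < size j) rsg (nth l0 j p) * ksg p j.

(** Flips at distinct positions commute and keep the other signs, so that the
    commutator only retains twice the same position, where the flips cancel: it
    is diagonal, with eigenvalue weight. *)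
Lemma commutator_weight eta j :
  act (rot l0 l1) (act twrot eta) j - act twrot (act (rot l0 l1) eta) j =
  2%:R * (weight j * eta j).
Proof.
rewrite act_rot01 act_twrot.
under eq_big_nat => p /andP[_ pj].
  rewrite act_twrot size_flip //; rewrite mulr_sumr; over.
under [X in _ - X]eq_big_nat => p /andP[_ pj].
  rewrite act_rot01 size_flip //; rewrite mulr_sumr; over.
rewrite [X in _ - X]exchange_big /= -sumrB /weight mulr_suml mulr_sumr.
rewrite !big_mkord; apply: eq_bigr => p _; rewrite !big_mkord -sumrB.
rewrite (bigD1 p) //= [X in _ + X]big1 ?addr0.
  rewrite !nth_flip eqxx flip_flip // ksg_flip // esg_oth rsg_oth.
  set x := nth l0 j p.
  transitivity (2%:R * (rsg x * esg x * ksg p j * eta j)); first by ring.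
  by rewrite rsg_esg; ring.
move=> q /negbTE qp; rewrite !nth_flip ksg_flip // flipC //.
have qp' : (nat_of_ord q == p) = false by [].
rewrite qp' eq_sym qp'; ring.
Qed.

Lemma Q_weight k eta : Qspace k eta -> Qspace k (fun j => weight j * eta j).
Proof.
move=> hQ; have h1 := Q_act (Q_act hQ hB) (hR l01).
have h2 := Q_act (Q_act hQ (hR l01)) hB.
apply: Q_ext (Q_lin 2%:R^-1 h1 (Q_lin (- 2%:R^-1) h2 (Q_lin (-1) hQ hQ))).
move=> j _ /=; have := commutator_weight eta j.
set A := act _ _ _; set B := act _ _ _ => e.
have -> : weight j * eta j = 2%:R^-1 * (A - B).
  by rewrite e mulKf // pnatr_eq0.
ring.
Qed.

Lemma Q_weight_poly k eta (L : seq C) : Qspace k eta ->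
  Qspace k (fun j => \prod_(x <- L) (weight j - x) * eta j).
Proof.
move=> hQ; elim: L => [|x L IH].
  by apply: Q_ext hQ => j _; rewrite big_nil mul1r.
have := Q_lin (- x) IH (Q_weight IH); apply: Q_ext => j _.
rewrite big_cons; ring.
Qed.

(** A linear relation between coordinates that holds on the whole space can be
    applied to any polynomial in the diagonal operator, in particular to the one
    that vanishes at all eigenvalues but x. *)
Lemma Q_split k (I : finType) (P : pred I) (c : I -> C) (W : I -> seq 'I_N) :
  (forall eta, Qspace k eta -> \sum_(i | P i) c i * eta (W i) = 0) ->
  forall eta (x : C), Qspace k eta ->
  \sum_(i | P i && (weight (W i) == x)) c i * eta (W i) = 0.
Proof.
move=> h eta x hQ.
pose L := [seq weight (W i) | i <- enum I & weight (W i) != x].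
have := h _ (Q_weight_poly L hQ).
rewrite (bigID (fun i => weight (W i) == x)) /= [X in _ + X]big1 ?addr0.
  have nz : \prod_(y <- L) (x - y) != 0.
    rewrite prodf_seq_neq0; apply/allP => y yL; rewrite implyTb subr_eq0 eq_sym.
    have /mapP[i0] := yL.
    by rewrite mem_filter => /andP[hi _] ->.
  move=> e; apply: (mulfI nz); rewrite mulr0; apply: etrans e; rewrite mulr_sumr.
  by apply: eq_bigr => i /andP[_ /eqP ->]; ring.
move=> i /andP[_ hi].
have -> : \prod_(y <- L) (weight (W i) - y) = 0.
  apply/eqP; rewrite prodf_seq_eq0; apply/hasP; exists (weight (W i)).
    by apply: map_f; rewrite mem_filter hi mem_enum.
  by rewrite subrr eqxx.
by rewrite mul0r mulr0.
Qed.

Lemma weight_cons c j : weight (c :: j) = rsg c + kap c * weight j.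
Proof.
rewrite /weight [size _]/= big_nat_recl //= /ksg big_nil mulr1; congr (_ + _).
rewrite mulr_sumr; apply: eq_bigr => p _; rewrite /= big_cons; ring.
Qed.

Lemma weight_nil : weight [::] = 0.
Proof. exact: big_nil. Qed.

Lemma rsg_lt b : rsg (lt b) = - (-1) ^+ b.
Proof.
rewrite /rsg /alternate -signr_odd.
by case: odd; rewrite !simpl_letters /= ?expr0 ?expr1; ring.
Qed.

Lemma kap_lt b : kap (lt b) = -1.
Proof. by rewrite /kap /lt; case: odd; rewrite eqxx ?orbT. Qed.

Lemma weight_altw b n j :
  weight (altw b n ++ j) = - (-1) ^+ b * n%:R + (-1) ^+ n * weight j.
Proof.
elim: n b => [|n IH] b; first by rewrite altw0 /= mulr0 add0r mul1r.
rewrite altwS /= weight_cons IH rsg_lt kap_lt -natr1 !exprS; ring.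
Qed.

Lemma weight_altw_end b n : weight (altw b n) = - (-1) ^+ b * n%:R.
Proof. by rewrite -[altw b n]cats0 weight_altw weight_nil mulr0 addr0. Qed.

Lemma weight_other c j : c != l0 -> c != l1 -> weight (c :: j) = weight j.
Proof.
move=> /negbTE c0 /negbTE c1; rewrite weight_cons /rsg /kap c0 c1 /=; ring.
Qed.

End KeyLemma.

(** * Spanning by the orbit of the alternating word *)

Section TridiagonalSystem.
Variable C : numClosedFieldType.

(** The quadratic form of this tridiagonal system is
    m * sum |z_p|^2 + sum |z_p + z_{p+1}|^2, hence positive definite. *)
Lemma tridiagonal_eq0 (m k : nat) (z : nat -> C) : (0 < m)%N ->
  (forall p, (p < k.+1)%N -> m%:R * z p =
     - (if (0 < p)%N then z p.-1 + z p else 0)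
     - (if (p < k)%N then z p + z p.+1 else 0)) ->
  forall p, (p < k.+1)%N -> z p = 0.
Proof.
move=> m0 h.
have e : \sum_(p < k.+1) m%:R * (z p * (z p)^*) +
         \sum_(p < k) (z p + z p.+1) * (z p + z p.+1)^* = 0.
  have -> : \sum_(p < k.+1) m%:R * (z p * (z p)^*) =
    - (\sum_(p < k.+1) (if (0 < p)%N then z p.-1 + z p else 0) * (z p)^*)
    - (\sum_(p < k.+1) (if (p < k)%N then z p + z p.+1 else 0) * (z p)^*).
    rewrite -!sumrN -big_split; apply: eq_bigr => p _ /=.
    by rewrite mulrA h ?ltn_ord // mulrDl !mulNr.
  rewrite big_ord_recl /= mul0r add0r [X in _ - X]big_ord_recr /= ltnn mul0r addr0.
  rewrite -!sumrN -!big_split big1 //= => p _; rewrite ltn_ord rmorphD /=.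
  by rewrite /bump /=; ring.
have eq_le_zero (x : C) : x = 0 -> x <= 0 by move=> ->.
have zz (x : C) : 0 <= x * x^* by rewrite mul_conjC_ge0.
have : \sum_(p < k.+1) m%:R * (z p * (z p)^*) = 0.
  apply/eqP; rewrite eq_le; apply/andP; split.
    apply: le_trans (eq_le_zero _ e); rewrite lerDl; exact: sumr_ge0.
  by apply: sumr_ge0 => p _; rewrite mulr_ge0.
move/eqP; rewrite psumr_eq0 => [/allP hz|p _]; last by rewrite mulr_ge0.
move=> p pk; have := hz (Ordinal pk) (mem_index_enum _).
rewrite implyTb mulf_eq0 pnatr_eq0 (gtn_eqF m0) /= mul_conjC_eq0.
by move/eqP.
Qed.

End TridiagonalSystem.

Section KeyLemmaEnd.
Variables (R : realType) (N : nat).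
Local Notation C := R[i].
Local Notation letter := ('I_N * 'I_N)%type.
Variables (E : (seq letter -> C) -> Prop) (hE : funclass E).
Variables (l0 l1 : 'I_N).
Hypothesis l01 : l0 != l1.
Hypothesis hR : forall a b, a != b -> E (rot R a b).
Hypothesis hB : E (twrot R l0 l1).
Implicit Types (eta : seq 'I_N -> C).

Local Notation lt := (alternate l0 l1).
Local Notation altw := (altword l0 l1).
Local Notation Q := (Qspace E l0 l1).
Local Notation weight := (weight R l0 l1).

Definition other (c : 'I_N) := (c != l0) && (c != l1).

Lemma other_lt c b : other c -> (lt b == c) = false.
Proof.
by rewrite /other /alternate => /andP[/negbTE h0 /negbTE h1]; case: odd; rewrite eq_sym.
Qed.

Lemma lt2 b : lt b.+2 = lt b. Proof. by rewrite /alternate /= negbK. Qed.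

Lemma lt_neq b : (lt b == lt b.+1) = false.
Proof. by rewrite /alternate /=; case: odd; rewrite /= ?(negbTE l01) // eq_sym (negbTE l01). Qed.

Lemma nth_altw b k p : (p < k)%N -> nth l0 (altw b k) p = lt (p + b).
Proof. by move=> pk; rewrite nth_mkseq. Qed.

Lemma lt_odd p q : (lt p == lt q) = (odd p == odd q).
Proof.
rewrite /alternate; case: (odd p); case: (odd q); rewrite ?eqxx ?(negbTE l01) //.
by rewrite eq_sym (negbTE l01).
Qed.

Lemma altw_split k p : (p < k)%N ->
  altw 0 k = altw 0 p ++ lt p :: altw p.+1 (k - p.+1).
Proof.
by move=> pk; rewrite -altwS -(altw_cat _ _ 0 p); congr (altword _ _ _ _); lia.
Qed.

Lemma set1E k p c : (p < k)%N ->
  set_nth l0 (altw 0 k) p c = altw 0 p ++ c :: altw p.+1 (k - p.+1).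
Proof.
move=> pk; rewrite set_nthE size_altw pk (altw_split pk).
by rewrite take_size_cat ?size_altw // drop_cat size_altw ltnNge leqnSn /= subSnn /= drop0.
Qed.

Lemma set2E k p q c d : (p < q)%N -> (q < k)%N ->
  set_nth l0 (set_nth l0 (altw 0 k) p c) q d =
  altw 0 p ++ c :: altw p.+1 (q - p.+1) ++ d :: altw q.+1 (k - q.+1).
Proof.
move=> pq qk; have pk := ltn_trans pq qk; rewrite set1E // set_nthE.
have -> : altw p.+1 (k - p.+1) =
    altw p.+1 (q - p.+1) ++ lt q :: altw q.+1 (k - q.+1).
  rewrite -altwS.
  have -> : altw q (k - q.+1).+1 = altw (p.+1 + (q - p.+1)) (k - q.+1).+1.
    by congr (altword _ _ _ _); lia.
  by rewrite -altw_cat; congr (altword _ _ _ _); lia.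
set A := altw p.+1 _; set B := altw q.+1 _.
have sA : size (altw 0 p ++ c :: A) = q.
  by rewrite size_cat /= !size_altw; lia.
have -> : altw 0 p ++ c :: A ++ lt q :: B = (altw 0 p ++ c :: A) ++ lt q :: B.
  by rewrite -catA.
rewrite size_cat sA /= -addSnnS leq_addr take_size_cat // drop_cat sA.
by rewrite ltnNge leqnSn /= subSnn /= drop0 -catA.
Qed.

Lemma set2C k p q c : set_nth l0 (set_nth l0 (altw 0 k) p c) q c =
  set_nth l0 (set_nth l0 (altw 0 k) q c) p c.
Proof. by rewrite set_set_nth /=; case: eqP => // ->; rewrite set_set_nth eqxx. Qed.

Lemma sign2 (x : C) p : (-1) ^+ p * ((-1) ^+ p * x) = x.
Proof. exact: signrMK. Qed.

(** The weights below separate the words that differ from the alternating word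
    at few positions. *)
Lemma weight1 k p c : (p < k)%N -> other c ->
  weight (set_nth l0 (altw 0 k) p c) = (k - p.+1)%:R - p%:R.
Proof.
move=> pk /andP[c0 c1]; rewrite set1E // weight_altw // weight_other //.
rewrite weight_altw_end // expr0 exprS; have := sqrr_sign C p.
by move: ((-1) ^+ p) => s h; ring: h.
Qed.

Lemma weight2 k p q c : (p < q)%N -> (q < k)%N -> other c ->
  weight (set_nth l0 (set_nth l0 (altw 0 k) p c) q c) =
  (q - p.+1)%:R - p%:R - (k - q.+1)%:R.
Proof.
move=> pq qk /andP[c0 c1]; rewrite set2E // weight_altw // weight_other //.
rewrite weight_altw // weight_other // weight_altw_end //.
have -> : (-1) ^+ q.+1 = (-1) ^+ p * (-1) ^+ (q - p.+1) :> C.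
  by rewrite -exprD -signr_odd -[RHS]signr_odd; congr (_ ^+ nat_of_bool _); lia.
rewrite expr0 exprS; have := sqrr_sign C p; have := sqrr_sign C (q - p.+1).
by move: ((-1) ^+ p) ((-1) ^+ (q - p.+1)) => s t ht hs; ring: ht hs.
Qed.

Lemma weight_wrong k p : (p < k)%N ->
  weight (set_nth l0 (altw 0 k) p (lt p.+1)) = 1 - p%:R - (k - p.+1)%:R.
Proof.
move=> pk; rewrite set1E // weight_altw // weight_cons // rsg_lt // kap_lt.
rewrite weight_altw_end // !exprS expr0; have := sqrr_sign C p.
by move: ((-1) ^+ p) => s h; ring: h.
Qed.

Section Values.
Variables (k : nat).
Local Notation X := (altw 0 k).

Lemma Q_altw eta : Q k eta -> eta X = 0.
Proof.
move=> hQ; rewrite -(tsum_wcounit eta X) size_altw.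
exact (Q_orth hQ (fc_counit hE)).
Qed.

(** Rotating the letter at p into c gives a relation between the words with one
    letter c, and these words have different weights. *)
Lemma Q_single eta p c : Q k eta -> (p < k)%N -> other c ->
  eta (set_nth l0 X p c) = 0.
Proof.
move=> hQ pk oc.
have h eta' : Q k eta' ->
    \sum_(q < k | lt q == lt p) (-1) * eta' (set_nth l0 X q c) = 0.
  move=> hQ'; have pc : lt p != c by rewrite other_lt.
  have := Q_altw (Q_act hE hQ' (hR pc)); rewrite (act_rot l0) size_altw => e.
  apply: etrans e; rewrite big_mkcond; apply: eq_bigr => q _.
  by rewrite nth_altw // addn0 (other_lt _ oc); case: (lt q == lt p) => /=; ring.
have := Q_split hE l01 hR hB h (weight (set_nth l0 X p c)) hQ.
rewrite (bigD1 (Ordinal pk)) /= ?eqxx // big1 ?addr0.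
  by move/eqP; rewrite mulN1r oppr_eq0 => /eqP.
move=> q /andP[/andP[_]]; rewrite !weight1 // subr_eq addrAC eq_sym subr_eq.
rewrite -!natrD eqr_nat => /eqP eq; case/eqP; apply: val_inj => /=.
have := ltn_ord q; lia.
Qed.

(** The coordinates at the words where the letter at p is changed to the other
    one of l0, l1, and where the letters at p and p+1 are changed to c. *)
Definition zval eta p : C := eta (set_nth l0 X p (lt p.+1)).
Definition yval eta p c : C := eta (set_nth l0 (set_nth l0 X p c) p.+1 c).

(** Start from the word with c at p, whose coordinates vanish on the whole space,
    and rotate c into the letter of p+1.  Besides putting that letter at p, the
    rotation puts a second c at the positions q of the same letter; the weight singles out
    q = p-1 and q = p+1. *)
Lemma Q_line eta p c : Q k eta -> (p < k)%N -> other c ->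
  zval eta p = (if (0 < p)%N then yval eta p.-1 c else 0) +
               (if (p.+1 < k)%N then yval eta p c else 0).
Proof.
move=> hQ pk oc; pose v := set_nth l0 X p c; pose a := lt p.+1.
pose W (q : 'I_k) := if (q : nat) == p then set_nth l0 X p a else set_nth l0 v q c.
pose cf (q : 'I_k) : C := if (q : nat) == p then 1 else -1.
have h eta' : Q k eta' ->
    \sum_(q < k | ((q : nat) == p) || (lt q == a)) cf q * eta' (W q) = 0.
  move=> hQ'; have ac : a != c by rewrite other_lt.
  have := Q_single (Q_act hE hQ' (hR ac)) pk oc.
  rewrite -/v (act_rot l0) size_set_nth size_altw (maxn_idPr pk) => e.
  apply: etrans e; rewrite big_mkcond; apply: eq_bigr => q _.
  rewrite nth_set_nth /= nth_altw // addn0 /cf /W.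
  case: eqP => [->|qp] /=.
    by rewrite eqxx (eq_sym c) (other_lt _ oc) /v set_set_nth eqxx /=; ring.
  by rewrite (other_lt _ oc); case: (lt q == a) => /=; ring.
have := Q_split hE l01 hR hB h (weight (set_nth l0 X p a)) hQ.
have wW (q : 'I_k) : (q : nat) != p ->
    (weight (W q) == weight (set_nth l0 X p a)) =
    ((q : nat) == p.+1) || (q.+1 == p).
  move=> qp; rewrite /W (negbTE qp) weight_wrong //.
  have qk := ltn_ord q; rewrite /v; case: (ltngtP q p) qp => // qp _.
    rewrite set2C weight2 // -subr_eq0.
    have -> : (p - q.+1)%:R - q%:R - (k - p.+1)%:R - (1 - p%:R - (k - p.+1)%:R) =
        (p - q.+1 + p)%:R - (q + 1)%:R :> C by rewrite !natrD; ring.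
    by rewrite subr_eq0 eqr_nat; apply/eqP/orP => [e|[] /eqP]; [right; apply/eqP|..]; lia.
  rewrite weight2 // -subr_eq0.
  have -> : (q - p.+1)%:R - p%:R - (k - q.+1)%:R - (1 - p%:R - (k - p.+1)%:R) =
      (q - p.+1 + (k - p.+1))%:R - (1 + (k - q.+1))%:R :> C by rewrite !natrD; ring.
  by rewrite subr_eq0 eqr_nat; apply/eqP/orP => [e|[] /eqP]; [left; apply/eqP|..]; lia.
rewrite (bigD1 (Ordinal pk)) /=; last by rewrite /W /= !eqxx.
rewrite {1}/cf {1}/W /= eqxx mul1r => /eqP; rewrite addr_eq0 => /eqP e.
rewrite /zval {}e -sumrN.
transitivity (\sum_(q < k) (if q.+1 == p then yval eta p.-1 c else 0) +
              \sum_(q < k) (if (q : nat) == p.+1 then yval eta p c else 0)).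
  rewrite -big_split big_mkcond; apply: eq_bigr => q _ /=.
  rewrite -[q == Ordinal pk]/((q : nat) == p).
  have [qp|qp] := eqVneq (q : nat) p.
    by rewrite andbF; case: eqP; case: eqP; rewrite ?addr0 //; lia.
  rewrite andbT /= wW // /cf /W (negbTE qp) mulN1r opprK lt_odd /= /v.
  have [e1|n1] := eqVneq (q : nat) p.+1; have [e2|n2] := eqVneq q.+1 p.
  - by lia.
  - by rewrite e1 /= eqxx add0r.
  - by rewrite -e2 /= negbK eqxx addr0 /yval set2C.
  - by rewrite andbF addr0.
congr (_ + _).
  case: p pk @v @a @W @cf h wW => [|p] pk _ _ _ _ _ _ /=.
    by apply: big1 => q _.
  have pk' : (p < k)%N by lia.
  rewrite (bigD1 (Ordinal pk')) //= eqxx big1 ?addr0 // => q /eqP qp.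
  by rewrite eqSS; case: eqP => // e; case: qp; apply: val_inj.
case: ifP => p1k.
  rewrite (bigD1 (Ordinal p1k)) //= eqxx big1 ?addr0 // => q /eqP qp.
  by case: eqP => // e; case: qp; apply: val_inj.
by apply: big1 => q _; case: eqP => // e; have := ltn_ord q; rewrite e p1k.
Qed.

(** Contraction at p and p+1: the letters l0 and l1 contribute the two words with
    a wrong letter, the others a pair of letters c. *)
Lemma Q_cap_values eta p : Q k eta -> (p.+1 < k)%N ->
  zval eta p + zval eta p.+1 + \sum_(c | other c) yval eta p c = 0.
Proof.
move=> hQ pk.
have word c : set_nth l0 (set_nth l0 X p c) p.+1 c =
    altw 0 p ++ [:: c; c] ++ altw p.+2 (k - p.+2).
  by rewrite set2E // subnn.
have := Q_cap hQ (s := altw 0 p) (t := altw p.+2 (k - p.+2)).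
rewrite !size_altw => /(_ ltac:(lia)).
rewrite (bigD1 l0) //= (bigD1 l1) /=; last by rewrite eq_sym.
rewrite addrA => e; apply: etrans e; congr (_ + _); last first.
  by apply: eq_bigr => c _; rewrite /yval word.
have h0 : set_nth l0 X p (lt p.+1) =
    altw 0 p ++ [:: lt p.+1; lt p.+1] ++ altw p.+2 (k - p.+2).
  rewrite set1E; last by lia.
  have -> : (k - p.+1 = (k - p.+2).+1)%N by lia.
  by rewrite altwS.
have h1 : set_nth l0 X p.+1 (lt p.+2) =
    altw 0 p ++ [:: lt p; lt p] ++ altw p.+2 (k - p.+2).
  by rewrite set1E // lt2 -altw_rcons cat_rcons.
rewrite /zval h0 h1 /alternate /=; case: (odd p) => //=; exact: addrC.
Qed.

Lemma Q_alternating_sum eta : Q k eta ->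
  \sum_(p < k) (-1) ^+ p * zval eta p = 0.
Proof.
move=> hQ; have := Q_altw (Q_act hE hQ (hR l01)); rewrite (act_rot l0) size_altw.
move/eqP; rewrite -oppr_eq0 -sumrN => /eqP e; apply: etrans e.
apply: eq_bigr => p _; rewrite nth_altw // addn0 /zval /alternate /= -signr_odd.
have l10 : (l1 == l0) = false by rewrite eq_sym (negbTE l01).
by case: (odd p); rewrite /= ?eqxx ?l10 ?(negbTE l01) ?expr0 ?expr1 /=; ring.
Qed.

End Values.

(** With a third letter, the relations of Q_line and Q_cap_values form the positive
    definite system of tridiagonal_eq0; with only two letters, Q_cap_values says that
    zval alternates in sign, and the rotation of the alternating word gives one
    more relation. *)
Lemma Q_last k eta i : Q k.+1 eta -> eta (rcons (altw 0 k) i) = 0.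
Proof.
move=> hQ.
have word : rcons (altw 0 k) i = set_nth l0 (altw 0 k.+1) k i.
  by rewrite set1E // subnn cats1.
have [oi|] := boolP (other i); first by rewrite word (Q_single hQ).
rewrite negb_and !negbK => hi.
have [->|il] := eqVneq i (lt k); first by rewrite -[k in lt k]add0n altw_rcons Q_altw.
have {hi il} -> : i = lt k.+1.
  by move: hi il; rewrite /alternate /=; case: (odd k) => /= /orP[] /eqP ->; rewrite ?eqxx.
have -> : rcons (altw 0 k) (lt k.+1) = set_nth l0 (altw 0 k.+1) k (lt k.+1).
  by rewrite set1E // subnn cats1.
rewrite -/(zval k.+1 eta k).
pose m := #|[pred c | other c]|.
have [m0|mp] := posnP m.
  have none c : other c = false by have := card0_eq m0 c.
  have hz p : (p < k)%N -> zval k.+1 eta p.+1 = - zval k.+1 eta p.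
    move=> pk; have := Q_cap_values hQ (p := p) ltac:(lia).
    rewrite big_pred0 // addr0 => /eqP; rewrite addrC addr_eq0 => /eqP ->.
    by [].
  have zp p : (p <= k)%N -> zval k.+1 eta p = (-1) ^+ p * zval k.+1 eta 0.
    elim: p => [|p IH] pk; first by rewrite mul1r.
    by rewrite hz // IH ?exprS; [ring | lia].
  have := Q_alternating_sum hQ.
  rewrite (eq_bigr (fun=> zval k.+1 eta 0)); last first.
    by move=> p _; rewrite zp ?sign2 //; have := ltn_ord p; lia.
  rewrite sumr_const card_ord => /eqP; rewrite mulrn_eq0 /= => /eqP z0.
  by rewrite zp // z0 mulr0.
apply: (tridiagonal_eq0 mp) (ltnSn k) => p pk.
have mE : m%:R * zval k.+1 eta p =
    (if (0 < p)%N then \sum_(c | other c) yval k.+1 eta p.-1 c else 0) +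
    (if (p < k)%N then \sum_(c | other c) yval k.+1 eta p c else 0).
  transitivity (\sum_(c | other c) zval k.+1 eta p).
    by rewrite sumr_const mulr_natl.
  rewrite (eq_bigr _ (fun c oc => Q_line hQ pk oc)) big_split ltnS /=.
  by congr (_ + _); case: ifP => // _; rewrite big1_eq.
rewrite {}mE; congr (_ + _); case: ifP => h; rewrite ?oppr0 //.
  apply/eqP; rewrite -addr_eq0 addrC; apply/eqP.
  have := Q_cap_values hQ (p := p.-1) ltac:(lia).
  by rewrite prednK.
apply/eqP; rewrite -addr_eq0 addrC; apply/eqP.
by have := Q_cap_values hQ (p := p) ltac:(lia).
Qed.

(** Induction on the length, by fixing the last letter i0.  That eta(. i0) is
    again orthogonal to the orbit follows from Q_last, applied to the images of
    eta by the functionals a(. (i0, i')). *)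
Lemma Q_eq0 k eta : Q k eta -> forall j, size j = k -> eta j = 0.
Proof.
elim: k eta => [|k IH] eta hQ j.
  move/size0nil => ->; have := Q_orth hQ (fc_counit hE).
  by rewrite tsum0 /wcounit big_nil mulr1.
case/lastP: j => // j i0; rewrite size_rcons => -[sj].
apply: (IH (fun j => eta (rcons j i0))) => //; split.
  move=> a Ea.
  (* Contracting the pairs (i, i') and (i0, i') over i', by u u^t = 1, leaves
     a(s, X) if i = i0 and 0 otherwise. *)
  pose b i' (w : seq letter) : C := a ([::] ++ w ++ [:: (i0, i')]).
  have Eb i' : E (b i') by exact: (fc_shift hE [::] [:: (i0, i')] Ea).
  transitivity (\sum_i' act (b i') eta (rcons (altw 0 k) i')); last first.
    by apply: big1 => i' _; apply: Q_last; exact: Q_act.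
  rewrite /act; under eq_bigr do rewrite size_rcons size_altw tsum_rcons.
  rewrite -tsum_sum; apply: eq_tsum => s ss; rewrite exchange_big /=.
  transitivity (\sum_i eta (rcons s i) * ((i == i0)%:R * a (zip s (altw 0 k)))).
    rewrite (bigD1 i0) //= eqxx mul1r [X in _ + X]big1 ?addr0 //.
    by move=> i /negbTE ->; rewrite mul0r mulr0.
  apply: eq_bigr => i _; rewrite -mulr_sumr; congr (_ * _).
  have := fc_orth hE (zip s (altw 0 k)) [::] i i0 Ea; rewrite cats0 => <-.
  apply: eq_bigr => c _; rewrite /b -!cats1 zip_cat ?size_altw //=.
  by rewrite -catA.
move=> s t st; rewrite -[RHS](Q_cap hQ (s := s) (t := rcons t i0)).
  by apply: eq_bigr => c _; rewrite !rcons_cat.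
by rewrite size_rcons addnS st.
Qed.

End KeyLemmaEnd.

(** * Annihilators of tensor products *)

Section LinearAlgebra.
Variable C : fieldType.

(** Vectors of S are added to M until the rank stops growing. *)
Lemma subspace_mx n (S : 'rV[C]_n -> Prop) : S 0 ->
  (forall (a : C) u v, S u -> S v -> S (a *: u + v)) ->
  exists M : 'M[C]_n, forall v, S v <-> (v <= M)%MS.
Proof.
move=> S0 SL.
suff h d (M : 'M[C]_n) : (n - \rank M < d)%N ->
    (forall v, (v <= M)%MS -> S v) ->
    exists M' : 'M[C]_n, forall v, S v <-> (v <= M')%MS.
  apply: (h n.+1 0); first by rewrite mxrank0 subn0.
  by move=> v; rewrite submx0 => /eqP ->.
elim: d M => // d IH M rM hM.
have [h|nh] := pselect (forall v, S v -> (v <= M)%MS).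
  by exists M => v; split; [exact: h | exact: hM].
have [v [Sv nvM]] : exists v, S v /\ ~~ (v <= M)%MS.
  apply: contrapT => hn; apply: nh => v Sv.
  by apply: contrapT => /negP nv; apply: hn; exists v.
apply: (IH (M + v)%MS).
  have lt : (\rank M < \rank (M + v))%N.
    rewrite ltn_neqAle mxrankS ?addsmxSl // andbT; apply/negP => /eqP e.
    move/negP: nvM; apply; have := mxrank_leqif_sup (addsmxSl M v).
    by case=> _; rewrite e eqxx => /esym; apply: submx_trans (addsmxSr _ _).
  by have := rank_leq_col (M + v)%MS; lia.
move=> w /sub_addsmxP[[a b] ->] /=.
have -> : b *m v = b 0 0 *: v by rewrite {1}[b]mx11_scalar mul_scalar_mx.
by rewrite addrC; apply: SL => //; apply: hM; exact: submxMl.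
Qed.

(** Duality: a subspace S of the kernel of U with no common annihilator with U is
    that whole kernel. *)
Lemma dual_span n m (S : 'rV[C]_n -> Prop) (U : 'M[C]_(m, n)) : S 0 ->
  (forall (a : C) u v, S u -> S v -> S (a *: u + v)) ->
  (forall v, S v -> v *m U^T = 0) ->
  (forall w : 'rV[C]_n, (forall v, S v -> v *m w^T = 0) -> U *m w^T = 0 -> w = 0) ->
  forall v : 'rV[C]_n, v *m U^T = 0 -> S v.
Proof.
move=> S0 SL SU h v vU; have [M hM] := subspace_mx S0 SL.
have MK : (M <= kermx U^T)%MS.
  apply/row_subP => i; apply/sub_kermxP; apply: SU; apply/hM; exact: row_sub.
have full : \rank (M + U)%MS = n.
  have := mxrank_ker (col_mx M U)^T.
  have -> : kermx (col_mx M U)^T = 0.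
    apply/eqP; rewrite -submx0; apply/row_subP => i; rewrite submx0.
    set w := row i _.
    have : w *m (col_mx M U)^T = 0 by apply/sub_kermxP; exact: row_sub.
    move/(congr1 trmx); rewrite trmx_mul trmxK trmx0 mul_col_mx => e.
    have := congr1 usubmx e; have := congr1 dsubmx e.
    rewrite col_mxKu col_mxKd !linear0 => e2 e1.
    apply/eqP; apply: h e2 => v' /hM /submxP[D ->].
    by rewrite -mulmxA e1 mulmx0.
  rewrite mxrank0 mxrank_tr => /esym/eqP.
  rewrite subn_eq0 => le; apply/eqP; rewrite eqn_leq rank_leq_col /=.
  by rewrite (addsmxE M U).
apply/hM; have /sub_kermxP/submx_trans-> // : v *m U^T = 0 by [].
have := mxrank_leqif_sup MK; case=> _ <-; rewrite eqn_leq mxrankS //=.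
rewrite mxrank_ker mxrank_tr; have := mxrank_adds_leqif M U; case=> le _.
by rewrite full in le; lia.
Qed.

(** For W the whole space and K the annihilator of the row space V of U, the
    annihilator of K (x) K is V (x) W + W (x) V. *)
Lemma ann_tensor n m (U : 'M[C]_(m, n)) (p : 'M[C]_n) :
  (forall v w : 'rV[C]_n, v *m U^T = 0 -> w *m U^T = 0 -> v *m p *m w^T = 0) ->
  exists Y Z, p = U^T *m Y + Z *m U.
Proof.
move=> h; pose K := kermx U^T.
have KK : K *m p *m K^T = 0.
  apply/matrixP => i j; rewrite [RHS]mxE.
  have := h (row i K) (row j K).
  have r l : row l K *m U^T = 0 by apply/sub_kermxP; exact: row_sub.
  move=> /(_ (r i) (r j)) /matrixP /(_ 0 0); rewrite [RHS]mxE => <-.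
  rewrite -row_mul tr_row !mxE; apply: eq_bigr => l _; by rewrite !mxE.
have bi (w : 'M[C]_n) : w *m K^T = 0 -> (w <= U)%MS.
  move=> wK; have sU : (U <= kermx K^T)%MS.
    apply/sub_kermxP; apply: trmx_inj; rewrite trmx_mul trmxK trmx0.
    exact: mulmx_ker.
  have := mxrank_leqif_sup sU; case=> le e.
  have /sub_kermxP/submx_trans -> // : w *m K^T = 0 by [].
  rewrite -e eqn_leq le /= mxrank_ker mxrank_tr mxrank_ker mxrank_tr.
  by have := rank_leq_col U; lia.
have /submxP[Y eY] : ((p *m K^T)^T <= U)%MS.
  apply: bi; apply: trmx_inj; rewrite trmx_mul !trmxK trmx0.
  by rewrite mulmxA.
pose G := pinvmx K^T.
have /submxP[Z eZ] : (p - p *m K^T *m G <= U)%MS.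
  apply: bi; rewrite mulmxBl -[p *m K^T *m G]mulmxA -[p *m (K^T *m G) *m _]mulmxA.
  by rewrite mulmxKpV ?submx_refl // subrr.
exists (Y^T *m G), Z; rewrite -eZ mulmxA -trmx_mul -eY trmxK.
by rewrite addrC subrK.
Qed.

End LinearAlgebra.

(** * Top-degree parts and cups *)

Section MainTheorem.
Variables (R : realType) (N : nat).
Local Notation C := R[i].
Local Notation letter := ('I_N * 'I_N)%type.
Local Notation poly := (ncpoly R N).

(** The two derivations are stable under transposition, up to sign, so that the
    spanning property also holds on the other side. *)
Lemma tr_rot (I : qgrp R N) a b : closed_qsubgroup I ->
  ann I (rot R a b) -> tr_class (ann I) (rot R a b).
Proof.
move=> hI h; apply: ann_ext (ann_scale (-1) h) => w; rewrite /rot.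
suff gen s : -1 * deriv (fun=> 1) (dR R a b) s w =
  deriv (fun=> 1) (dR R a b) s (swapw w) by exact: gen.
elim: w s => [|[i j] w IH] s /=; first by rewrite mulr0.
rewrite -/(swapw w) -(IH (s * 1)) mulrDr; congr (_ + _).
  have -> : wcounit R (swapw w) = wcounit R w.
    by rewrite /wcounit big_map; apply: eq_bigr => x _; rewrite eq_sym.
  by rewrite /dR; case: (i == a); case: (i == b); case: (j == a); case: (j == b) => /=; ring.
by rewrite eq_sym !mulr1; case: (j == i) => /=; ring.
Qed.

Lemma tr_twrot (I : qgrp R N) l0 l1 : closed_qsubgroup I ->
  ann I (twrot R l0 l1) -> tr_class (ann I) (twrot R l0 l1).
Proof.
move=> hI; apply: ann_ext => w; rewrite /twrot.
suff gen s : deriv (kap R l0 l1) (dB R l0 l1) s w =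
  deriv (kap R l0 l1) (dB R l0 l1) s (swapw w) by exact: gen.
elim: w s => [|[i j] w IH] s //=; rewrite -/(swapw w); congr (_ + _).
  have -> : wcounit R (swapw w) = wcounit R w.
    by rewrite /wcounit big_map; apply: eq_bigr => x _; rewrite eq_sym.
  by rewrite /dB; case: (i == l0); case: (i == l1); case: (j == l0); case: (j == l1) => /=; ring.
by rewrite eq_sym; case: eqP => [->|_]; rewrite ?IH // !mul0r.
Qed.

Section Degree.
Variable k : nat.
Local Notation T := (k.-tuple 'I_N).

Lemma sum_word (V : lmodType C) (F : seq 'I_N -> V) (w : seq 'I_N) :
  \sum_(t : T) ((t : seq 'I_N) == w)%:R *: F t =
  if size w == k then F w else 0.
Proof.
case: eqP => [sw|nw]; last first.
  apply: big1 => t _; case: eqP => [e|_]; last by rewrite scale0r.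
  by case: nw; rewrite -e size_tuple.
rewrite (bigD1 (Tuple (introT eqP sw))) //= eqxx scale1r big1 ?addr0 // => t.
move/eqP=> nt; case: eqP => [e|_]; last by rewrite scale0r.
by case: nt; apply: val_inj.
Qed.

Definition small (P : poly) := forall w, P@_w != 0 -> (size w < k)%N.

Lemma small_lin (c : C) P Q : small P -> small Q -> small (c *: P + Q).
Proof.
move=> hP hQ w; rewrite mcoeffD mcoeffZ.
have [e|/hQ //] := eqVneq Q@_w 0.
have [e'|/hP //] := eqVneq P@_w 0.
by rewrite e e' mulr0 addr0 eqxx.
Qed.

Lemma small0 : small 0.
Proof. by move=> w; rewrite mcoeff0 eqxx. Qed.

Definition monom (w : seq letter) : poly := << FMonom w >>.

Definition coef (P : poly) (i j : seq 'I_N) : C := P@_(FMonom (zip i j)).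

Definition top (P : poly) : poly :=
  \sum_(i : T) \sum_(j : T) coef P i j *: monom (zip i j).

Lemma small_top (P : poly) : (forall w : word N, P@_w != 0 -> (size w < k.+1)%N) -> small (P - top P).
Proof.
move=> hP w nz; rewrite ltnNge; apply/negP => kw.
have tw : (top P)@_w = if size w == k then P@_w else 0.
  rewrite raddf_sum /=.
  transitivity (\sum_(i : T) ((i : seq 'I_N) == unzip1 w)%:R *:
      (\sum_(j : T) ((j : seq 'I_N) == unzip2 w)%:R *: (P@_(FMonom (zip i j)) : C^o))).
    apply: eq_bigr => i _; rewrite raddf_sum scaler_sumr; apply: eq_bigr => j _.
    rewrite /= mcoeffZ mcoeffU1 scalerA /GRing.scale /= mulrC -natrM mulnb.
    congr (_%:R * _); congr nat_of_bool.
    rewrite fmP /=; apply/eqP/andP => [<-|[/eqP -> /eqP ->]]; last exact: zip_unzip.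
    by rewrite unzip1_zip ?unzip2_zip ?size_tuple // !eqxx.
  rewrite (sum_word (fun i => \sum_(j : T) ((j : seq 'I_N) == unzip2 w)%:R *:
      (P@_(FMonom (zip i j)) : C^o))) size_map.
  case: eqP => // sw.
  rewrite (sum_word (fun j => (P@_(FMonom (zip (unzip1 w) j)) : C^o))) size_map sw eqxx.
  by rewrite zip_unzip fmK.
move: nz; rewrite mcoeffB tw; case: (size w =P k) => sw; first by rewrite subrr eqxx.
rewrite subr0 => /hP; rewrite ltnS leq_eqVlt ltnNge kw orbF => /eqP.
by move: sw.
Qed.

Lemma pairing_top (f : seq letter -> C) (P : poly) : (forall w : word N, P@_w != 0 -> (size w < k.+1)%N) ->
  (forall w : seq letter, (size w < k)%N -> f w = 0) ->
  pairing f P = \sum_(i : T) \sum_(j : T) coef P i j * f (zip i j).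
Proof.
move=> hP hf; transitivity (pairing f (P - top P + top P)); first by rewrite subrK.
rewrite linearD /= [X in X + _](_ : _ = 0) ?add0r; last first.
  rewrite pairingE big_seq big1 // => w wP; rewrite hf ?mulr0 //.
  by apply: (small_top hP); rewrite mcoeff_neq0.
rewrite /top !linear_sum /=; apply: eq_bigr => i _.
rewrite !linear_sum /=; apply: eq_bigr => j _.
by rewrite pairingZ -[monom _]scale1r -malgUZ pairingU mul1r.
Qed.

Local Notation n := #|{: T}|.
(** Cups are indexed by a position and a word of length k - 2.  Positions larger
    than k - 2 give repetitions of the last cup. *)
Definition cupidx := ('I_k * (k - 2).-tuple 'I_N)%type.
Local Notation m := #|{: cupidx}|.

Definition cupw (s : cupidx) c := take s.1 s.2 ++ [:: c; c] ++ drop s.1 s.2.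

Definition tupv (t : 'I_n) : T := enum_val t.
Definition cupv (s : 'I_m) : cupidx := enum_val s.

Definition cupmx : 'M[C]_(m, n) :=
  \matrix_(s, t) \sum_c ((tupv t : seq 'I_N) == cupw (cupv s) c)%:R.

Lemma sum_tupv (V : zmodType) (F : T -> V) : \sum_t F (tupv t) = \sum_t F t.
Proof.
rewrite [RHS](reindex tupv) //; apply: onW_bij; exact: enum_val_bij.
Qed.

Lemma sum_cup (V : lmodType C) (F : seq 'I_N -> V) s :
  \sum_t cupmx s t *: F (tupv t) =
  if (1 < k)%N then \sum_c F (cupw (cupv s) c) else 0.
Proof.
transitivity (\sum_c \sum_(t : T) ((t : seq 'I_N) == cupw (cupv s) c)%:R *: F t).
  rewrite exchange_big -sum_tupv; apply: eq_bigr => t _.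
  by rewrite mxE scaler_suml.
case: ifP => k1.
  apply: eq_bigr => c _; rewrite sum_word.
  have -> : size (cupw (cupv s) c) = k; last by rewrite eqxx.
  by rewrite !size_cat /= addnCA -size_cat cat_take_drop size_tuple; lia.
apply: big1 => c _; rewrite sum_word.
case: eqP => // e; have : size (cupw (cupv s) c) = 2.
  rewrite !size_cat /= addnCA -size_cat cat_take_drop size_tuple.
  by have := ltn_ord (cupv s).1; lia.
by have := ltn_ord (cupv s).1; lia.
Qed.

Section Span.
Variables (E : (seq letter -> C) -> Prop) (hE : funclass E).
Variables (l0 l1 : 'I_N).
Hypothesis l01 : l0 != l1.
Hypothesis hR : forall a b, a != b -> E (rot R a b).
Hypothesis hB : E (twrot R l0 l1).
Local Notation X := (altword l0 l1 0 k).

(** Q_eq0 rephrased by duality: the vectors killed by the cups are exactly those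
    of the orbit of the alternating word. *)
Lemma orbit_span (v : 'rV[C]_n) : v *m cupmx^T = 0 ->
  exists2 a, E a & forall t, v 0 t = a (zip (tupv t) X).
Proof.
pose S (v : 'rV[C]_n) := exists2 a, E a & forall t, v 0 t = a (zip (tupv t) X).
apply: (@dual_span _ _ _ S).
- exists (fun w => \sum_(t <- [::] : seq unit) 1 * wcounit R w).
    by apply: (fc_sum hE) => _; exact: fc_counit.
  by move=> t; rewrite mxE big_nil.
- move=> c u w [a Ea ha] [b Eb hb].
  exists (fun w => \sum_(x <- [:: true; false]) (if x then c else 1) * (if x then a else b) w).
    by apply: (fc_sum hE) => -[].
  by move=> t; rewrite !big_cons big_nil !mxE ha hb mul1r addr0.
- move=> w [a Ea ha]; apply/rowP => s; rewrite !mxE.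
  transitivity (\sum_t cupmx s t *: (a (zip (tupv t) X) : C^o)).
    by apply: eq_bigr => t _; rewrite ha [cupmx^T _ _]mxE mulrC.
  rewrite (sum_cup (fun i => (a (zip i X) : C^o))); case: ifP => // k1.
  set p := nat_of_ord (cupv s).1; set r := tval (cupv s).2.
  have sr : size r = (k - 2)%N by rewrite size_tuple.
  have sp : (size (take p r) <= k - 2)%N by rewrite size_take sr; case: ltnP => //; lia.
  set q := size (take p r) in sp.
  have sd : size (drop p r) = (k - 2 - q)%N.
    by have := congr1 size (cat_take_drop p r); rewrite size_cat sr -/q; lia.
  have eX : X = altword l0 l1 0 q ++ [:: alternate l0 l1 q; alternate l0 l1 q.+1] ++ altword l0 l1 q.+2 (k - 2 - q).
    have -> : k = (q + (k - 2 - q).+2)%N by lia.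
    by rewrite altw_cat !altwS; congr (_ ++ _ :: _ :: altword _ _ _ _); lia.
  rewrite eX /cupw -/p -/r.
  have -> : \sum_c (a (zip (take p r ++ [:: c; c] ++ drop p r)
      (altword l0 l1 0 q ++ [:: alternate l0 l1 q; alternate l0 l1 q.+1] ++ altword l0 l1 q.+2 (k - 2 - q))) : C^o) =
      \sum_c a (zip (take p r) (altword l0 l1 0 q) ++ [:: (c, alternate l0 l1 q); (c, alternate l0 l1 q.+1)]
                 ++ zip (drop p r) (altword l0 l1 q.+2 (k - 2 - q))).
    by apply: eq_bigr => c _; rewrite zip_cat ?size_altw.
  by rewrite (fc_orth' hE) // lt_neq // mul0r.
- move=> w hw hU; apply/rowP => t; rewrite mxE.
  pose eta (j : seq 'I_N) : C := oapp (fun t : T => w 0 (enum_rank t)) 0 (insub j).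
  have et (t' : 'I_n) : eta (tupv t') = w 0 t'.
    by rewrite /eta valK /= enum_valK.
  rewrite -et; apply: (Q_eq0 hE l01 hR hB (k := k)); last exact: size_tuple.
  split.
    move=> a Ea; rewrite /tsum -sum_tupv.
    have := hw (\row_t a (zip (tupv t) X)) _.
    move=> /(_ (ex_intro2 _ _ a Ea (fun t => mxE _ _ _ _)))/matrixP/(_ 0 0).
    rewrite !mxE => e; apply: etrans e; apply: eq_bigr => t' _.
    by rewrite !mxE et mulrC.
  move=> s1 s2 ss.
  have k1 : (1 < k)%N by lia.
  have s1k : (size s1 < k)%N by lia.
  have sz : size (s1 ++ s2) == (k - 2)%N by rewrite size_cat; lia.
  pose s : cupidx := (Ordinal s1k, Tuple sz).
  have := sum_cup (fun i => (eta i : C^o)) (enum_rank s); rewrite k1.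
  rewrite /cupw /cupv enum_rankK /= take_size_cat // drop_size_cat // => <-.
  have /matrixP/(_ (enum_rank s) 0) := hU; rewrite !mxE => e; apply: etrans e.
  by apply: eq_bigr => t' _; rewrite et [w^T _ _]mxE.
Qed.

End Span.
End Degree.
End MainTheorem.

(** * Reduction of the degree modulo orthogonality *)

Section MainOplus.
Variables (R : realType) (N : nat).
Local Notation C := R[i].
Local Notation letter := ('I_N * 'I_N)%type.
Local Notation poly := (ncpoly R N).
Variables (I : qgrp R N) (hI : closed_qsubgroup I).
Variables (A : algType C) (u : 'M[A]_N).
Hypothesis ou : u *m u^T = 1%:M /\ u^T *m u = 1%:M.

Lemma eval0 : eval u 0 = 0.
Proof. by rewrite evalE linear0. Qed.

Lemma evalB P Q : eval u (P - Q) = eval u P - eval u Q.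
Proof. by rewrite !evalE linearB. Qed.

Lemma evalZ (c : C) P : eval u (c *: P) = c *: eval u P.
Proof. by rewrite !evalE linearZ. Qed.

Lemma eval_sum (T : Type) (r : seq T) (F : T -> poly) :
  eval u (\sum_(t <- r) F t) = \sum_(t <- r) eval u (F t).
Proof. by rewrite evalE linear_sum. Qed.

Lemma eval_monom (w : seq letter) : eval u (monom R w) = wval u w.
Proof. by rewrite evalE lextU scale1r. Qed.

(** Reduction to words shorter than k, modulo polynomials that lie in I and
    vanish at u. *)
Definition reduces (k : nat) (P : poly) := exists Q : poly,
  [/\ small k Q, I (P - Q) & eval u (P - Q) = 0].

Lemma reduces0 k : reduces k 0.
Proof.
exists 0; rewrite subr0; split; [exact: small0 | exact: cqs_0 | ].
exact: eval0.
Qed.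

Lemma cqs_scale c P : I P -> I (c *: P).
Proof.
by move=> IP; rewrite -[P]mul1r scalerAl; exact: cqs_mull.
Qed.

Lemma reduces_lin k (c : C) P P' :
  reduces k P -> reduces k P' -> reduces k (c *: P + P').
Proof.
move=> [Q [sQ IQ eQ]] [Q' [sQ' IQ' eQ']]; exists (c *: Q + Q').
have -> : c *: P + P' - (c *: Q + Q') = c *: (P - Q) + (P' - Q').
  by rewrite scalerBr opprD addrACA.
split; first exact: small_lin.
  by apply: cqs_add => //; exact: cqs_scale.
by rewrite evalD evalZ eQ eQ' scaler0 addr0.
Qed.

Lemma small_monom k (w : seq letter) : (size w < k)%N -> small k (monom R w).
Proof.
by move=> sw v; rewrite mcoeffU1; have [<-|_] := eqVneq (FMonom w) v; rewrite ?eqxx.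
Qed.

Lemma sandwich_ring (S : nzRingType) (v w b : S) (F : 'I_N -> S) :
  v * (\sum_c F c - b) * w = \sum_c v * F c * w - v * b * w.
Proof. by rewrite mulrBr mulrBl mulr_sumr mulr_suml. Qed.

Lemma sandwich (v w b : poly) (F : 'I_N -> poly) :
  v * (\sum_c F c - b) * w = \sum_c v * F c * w - v * b * w.
Proof. exact: sandwich_ring. Qed.

Lemma bool_mid (S : nzRingType) (b : bool) (v w : S) :
  v * b%:R * w = b%:R * (v * w).
Proof. by case: b; rewrite ?mulr1 ?mul1r // mulr0 !mul0r. Qed.

Lemma reduces_sandwich k v w (f : 'I_N -> seq letter) (x y : 'I_N) (B : poly) :
  (size v + size w < k)%N ->
  B = \sum_c monom R (f c) - (x == y)%:R -> I B -> eval u B = 0 ->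
  reduces k (\sum_c monom R (v ++ f c ++ w)).
Proof.
move=> sk eB IB uB; exists ((x == y)%:R * monom R (v ++ w)).
have mm v' w' : monom R v' * monom R w' = monom R (v' ++ w').
  by rewrite mulUU mulr1.
have m1 : \sum_c monom R v * monom R (f c) * monom R w =
    \sum_c monom R (v ++ f c ++ w).
  by apply: eq_bigr => c _; rewrite !mm catA.
have m2 : monom R v * (x == y)%:R * monom R w = (x == y)%:R * monom R (v ++ w).
  have e1 := bool_mid (x == y) (monom R v) (monom R w).
  rewrite -mm. exact: e1.
have e := sandwich (monom R v) (monom R w) ((x == y)%:R) (fun c => monom R (f c)).
have {e m1 m2}<- : monom R v * B * monom R w =
    \sum_c monom R (v ++ f c ++ w) - (x == y)%:R * monom R (v ++ w).
  have e1 := congr1 (fun B => monom R v * B * monom R w) eB.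
  have e2 := congr2 (fun a b : poly => a - b) m1 m2.
  have e3 := etrans e1 e.
  exact (etrans e3 e2).
split; last by rewrite !evalM uB mulr0 mul0r.
  case: (x == y); last by rewrite mul0r; exact: small0.
  by rewrite mul1r; apply: small_monom; rewrite size_cat.
by apply: (cqs_mulr hI); exact: (cqs_mull hI).
Qed.

Lemma eval_orth x y : eval u ((gen R N *m (gen R N)^T - 1%:M) x y) = 0 /\
  eval u (((gen R N)^T *m gen R N - 1%:M) x y) = 0.
Proof.
have /orth_sums/(_ x y)[o1 o2] := ou.
have en (b : bool) : eval u (b%:R : poly) = b%:R.
  by case: b; rewrite ?eval1 // eval0.
split; rewrite !mxE evalB en eval_sum.
  rewrite -o1; apply/eqP; rewrite subr_eq0; apply/eqP; apply: eq_bigr => c _.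
  by rewrite [_^T _ _]mxE evalM !eval_gen.
rewrite -o2; apply/eqP; rewrite subr_eq0; apply/eqP; apply: eq_bigr => c _.
by rewrite [_^T _ _]mxE evalM !eval_gen.
Qed.

Lemma gen_orthE x y :
  (gen R N *m (gen R N)^T - 1%:M) x y = \sum_c monom R [:: (x, c); (y, c)] - (x == y)%:R /\
  ((gen R N)^T *m gen R N - 1%:M) x y = \sum_c monom R [:: (c, x); (c, y)] - (x == y)%:R.
Proof.
by split; rewrite !mxE; congr (_ - _); apply: eq_bigr => c _;
  rewrite [_^T _ _]mxE !mxE mulUU mulr1.
Qed.

Lemma reduces_cap k v w x y : (size v + size w < k)%N ->
  reduces k (\sum_c monom R (v ++ [:: (c, x); (c, y)] ++ w)) /\
  reduces k (\sum_c monom R (v ++ [:: (x, c); (y, c)] ++ w)).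
Proof.
move=> sk; have [h1 h2] := cqs_orth hI x y; have [e1 e2] := eval_orth x y.
have [g1 g2] := gen_orthE x y.
by split; [exact: reduces_sandwich sk g2 h2 e2 | exact: reduces_sandwich sk g1 h1 e1].
Qed.

Section Top.
Variable k : nat.
Local Notation T := (k.-tuple 'I_N).

Lemma cup_split (s : 'I_#|{: cupidx N k}|) (j : T) : (1 < k)%N ->
  exists v w x y, (size v + size w < k)%N /\
    forall c, zip (cupw (cupv s) c) j = v ++ [:: (c, x); (c, y)] ++ w.
Proof.
move=> k1; rewrite /cupw; set r := take _ _; set t := drop _ _.
have srt : (size r + size t = k - 2)%N.
  by rewrite -size_cat cat_take_drop size_tuple.
have sj : size (j : seq 'I_N) = k by rewrite size_tuple.
move: (j : seq 'I_N) sj => {}j sj.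
case e: (drop (size r) j) => [|x [|y j']].
- by have := congr1 size e; rewrite size_drop sj /=; lia.
- by have := congr1 size e; rewrite size_drop sj /=; lia.
have sj' : size j' = size t by have := congr1 size e; rewrite size_drop sj /=; lia.
exists (zip r (take (size r) j)), (zip t j'), x, y; split.
  by rewrite !size_zip size_take sj; lia.
move=> c; rewrite -[j in LHS](cat_take_drop (size r)) e zip_cat //.
by rewrite size_take sj; case: ltnP => //; lia.
Qed.

(** The sum of cups is taken with the module structure in general statements and
    with the ring structure in the free algebra; the two are identified once. *)
Definition lsum (V : lmodType C) (F : 'I_N -> V) : V := \sum_c F c.

Lemma poly_lsum (F : 'I_N -> poly) : lsum F = \sum_c F c.
Proof. by []. Qed.

Lemma sum_cup_closed (V : lmodType C) (S : V -> Prop) (F : seq 'I_N -> V) s :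
  S 0 -> ((1 < k)%N -> S (lsum (fun c => F (cupw (cupv s) c)))) ->
  S (\sum_t cupmx R N k s t *: F (tupv t)).
Proof. by move=> S0 h; rewrite sum_cup; case: ifP. Qed.

Lemma reduces_cup s (j : T) :
  reduces k (\sum_t cupmx R N k s t *: monom R (zip (tupv t) j)) /\
  reduces k (\sum_t cupmx R N k s t *: monom R (zip j (tupv t))).
Proof.
split;
  [apply: (sum_cup_closed (S := reduces k) (F := fun i => monom R (zip i j)))
  |apply: (sum_cup_closed (S := reduces k) (F := fun i => monom R (zip j i)))];
  [exact: reduces0 | | exact: reduces0 | ] => k1;
  have [v [w [x [y [sk e]]]]] := cup_split s j k1; rewrite poly_lsum.
  have [r1 _] := reduces_cap x y sk.
  by under eq_bigr do rewrite e.
have sk' : (size (swapw v) + size (swapw w) < k)%N by rewrite !size_map.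
have [_ r2] := reduces_cap x y sk'.
have e' c : zip j (cupw (cupv s) c) = swapw v ++ [:: (x, c); (y, c)] ++ swapw w.
  by rewrite -swapw_zip e /swapw !map_cat.
by under eq_bigr do rewrite e'.
Qed.

End Top.

Lemma convol_small k (f g : seq letter -> C) :
  (forall w, (size w < k)%N -> f w = 0) \/ (forall w, (size w < k)%N -> g w = 0) ->
  forall w, (size w < k)%N -> convol f g w = 0.
Proof.
move=> h w sw; apply: big1 => t _.
by case: h => h; rewrite h ?mul0r ?mulr0 // size_zip size_map size_tuple minnn.
Qed.

Variables (l0 l1 : 'I_N).
Hypothesis l01 : l0 != l1.
Hypothesis hR : forall a b, a != b -> ann I (rot R a b).
Hypothesis hB : ann I (twrot R l0 l1).
Local Notation X := (altword l0 l1 0).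
Hypothesis hchi : forall k, exists chi, [/\ ann I chi,
  (forall w, (size w < k)%N -> chi w = 0) &
  forall i j, size i = k -> size j = k ->
    chi (zip i j) = ((i == X k) && (j == X k))%:R].

Lemma factor_sum (V : lmodType C) (S : V -> Prop) n m (F : 'I_n -> 'I_n -> V)
    (p : 'M[C]_n) (U Y : 'M[C]_(m, n)) (Z : 'M[C]_(n, m)) :
  S 0 -> (forall (c : C) v w, S v -> S w -> S (c *: v + w)) ->
  p = U^T *m Y + Z *m U ->
  (forall s j, S (\sum_t U s t *: F t j) /\ S (\sum_t U s t *: F j t)) ->
  S (\sum_i \sum_j p i j *: F i j).
Proof.
move=> S0 SL e SU.
have Ssum (J : Type) (r : seq J) (c : J -> C) (G : J -> V) :
    (forall i, S (G i)) -> S (\sum_(i <- r) c i *: G i).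
  by move=> SG; elim: r => [|i r IH]; rewrite ?big_nil ?big_cons //; exact: SL.
have -> : \sum_i \sum_j p i j *: F i j =
    1 *: (\sum_j 1 *: (\sum_s Y s j *: \sum_t U s t *: F t j))
  + \sum_i 1 *: (\sum_s Z i s *: \sum_t U s t *: F i t).
  rewrite e; under eq_bigr do under eq_bigr do rewrite mxE scalerDl.
  under eq_bigr do rewrite big_split /=.
  rewrite scale1r big_split /= exchange_big /=; congr (_ + _); apply: eq_bigr => j _.
    under eq_bigr do rewrite mxE scaler_suml.
    rewrite exchange_big scale1r /=; apply: eq_bigr => s _; rewrite scaler_sumr.
    by apply: eq_bigr => t _; rewrite scalerA [U^T _ _]mxE mulrC.
  under eq_bigr do rewrite mxE scaler_suml.
  rewrite exchange_big scale1r /=; apply: eq_bigr => s _; rewrite scaler_sumr.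
  by apply: eq_bigr => t _; rewrite scalerA.
by apply: SL; apply: (Ssum _ _ (fun=> 1)) => j; apply: Ssum => s; case: (SU s j).
Qed.

(** For a, b in the annihilator, the convolution a * chi * b vanishes on the words
    shorter than k and has the values a(i, X) b(X, j) in degree k.  So the
    matrix of the coefficients of P in degree k annihilates the tensor square of
    the orbit, hence is a sum of terms with a cup on the left or on the right,
    which the orthogonality relations shorten. *)
Lemma reduces_top k P : I P -> (forall w : word N, P@_w != 0 -> (size w < k.+1)%N) ->
  reduces k (top k P).
Proof.
move=> IP sP; pose T := (k.-tuple 'I_N).
have [chi [chiI chi0 chiX]] := hchi k.
pose p : 'M[C]_#|{: T}| := \matrix_(i, j) coef P (tupv i) (tupv j).
have [|Y [Z eYZ]] := @ann_tensor _ _ _ (cupmx R N k) p.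
  move=> v w /(orbit_span (ann_funclass hI) l01 hR hB)[a Ia ea].
  have trR c d : c != d -> tr_class (ann I) (rot R c d) by move/hR/tr_rot; exact.
  move/(orbit_span (tr_funclass (ann_funclass hI)) l01 trR (tr_twrot hI hB)) => [b Ib eb].
  have Iab := ann_convol hI (ann_convol hI Ia chiI) Ib.
  have := Iab P IP; rewrite (pairing_top sP); last first.
    by apply: convol_small; left; apply: convol_small; right.
  move=> e; apply/matrixP => i j; rewrite !ord1 [RHS]mxE mxE; apply: etrans e.
  under eq_bigr do rewrite mxE mulr_suml.
  rewrite exchange_big -(sum_tupv (fun i => \sum_j _)); apply: eq_bigr => s _.
  rewrite -(sum_tupv (fun j => _ * _)); apply: eq_bigr => t _.
  rewrite [w^T _ _]mxE [p _ _]mxE ea eb [a _ * _]mulrC -mulrA; congr (_ * _).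
  rewrite convol_tsum ?size_tuple //.
  have -> : tsum k (fun l => convol a chi (zip (tupv s) l) *
       b (swapw (zip l (tupv t)))) =
     tsum k (fun l => (l == X k)%:R * (a (zip (tupv s) (X k)) * b (zip (tupv t) l))).
    apply: eq_tsum => l sl; rewrite swapw_zip mulrA [_%:R * _]mulrC; congr (_ * _).
    rewrite convol_tsum ?size_tuple // sl.
    have -> : tsum k (fun q => a (zip (tupv s) q) * chi (zip q l)) =
       tsum k (fun q => (q == X k)%:R * (a (zip (tupv s) q) * (l == X k)%:R)).
      apply: eq_tsum => q sq; rewrite chiX // -mulnb natrM; ring.
    transitivity (\sum_(q : T) ((q : seq 'I_N) == X k)%:R *:
       (a (zip (tupv s) q) * (l == X k)%:R : C^o)); first by [].
    by rewrite (sum_word k (fun q => (a (zip (tupv s) q) * (l == X k)%:R : C^o)))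
         size_altw eqxx.
  transitivity (\sum_(q : T) ((q : seq 'I_N) == X k)%:R *:
       (a (zip (tupv s) (X k)) * b (zip (tupv t) q) : C^o)); last by [].
  by rewrite (sum_word k (fun q => (a (zip (tupv s) (X k)) * b (zip (tupv t) q) : C^o)))
         size_altw eqxx.
have -> : top k P = \sum_i \sum_j p i j *: monom R (zip (tupv i) (tupv j)).
  rewrite /top -sum_tupv; apply: eq_bigr => i _; rewrite -sum_tupv.
  by apply: eq_bigr => j _; rewrite mxE.
apply: (factor_sum (S := reduces k)
  (F := fun i j => monom R (zip (tupv i) (tupv j))) _ _ eYZ).
- exact: reduces0.
- by move=> c v w; exact: reduces_lin.
- by move=> s j; exact: reduces_cup.
Qed.

(** Induction on the degree: reduces_top replaces the top-degree part of P by
    shorter words, modulo elements of I. *)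
Theorem Oplus_criterion P : I P -> eval u P = 0.
Proof.
suff gen k (Q : poly) : I Q -> (forall w : word N, Q@_w != 0 -> (size w < k)%N) ->
    eval u Q = 0.
  move=> IP; apply: (gen (\max_(w <- msupp P) (size w)).+1 P IP) => w nz.
  rewrite ltnS; apply: (@leq_bigmax_seq _ _ xpredT (fun w : word N => size w)) => //.
  by rewrite -mcoeff_neq0.
elim: k Q => [|k IH] Q IQ sQ.
  rewrite [Q](_ : _ = 0) ?eval0 //; apply/malgP => w; rewrite mcoeff0.
  by apply/eqP; apply: contraT => /sQ.
have [Q' [sQ' IQ' eQ']] := reduces_top IQ sQ.
have sm := small_top sQ.
have := IH (Q - (top k Q - Q')); rewrite evalB eQ' subr0; apply.
  rewrite -scaleN1r; apply: cqs_add => //; exact: cqs_scale.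
have -> : Q - (top k Q - Q') = 1 *: (Q - top k Q) + Q'.
  by rewrite scale1r opprB addrA addrAC.
exact: small_lin.
Qed.

End MainOplus.

(** * Alternating products and twists *)

Section Functionals.
Variables (R : realType) (N : nat).
Local Notation C := R[i].
Local Notation letter := ('I_N * 'I_N)%type.
Local Notation poly := (ncpoly R N).

(** The product v_a y_b v_c y_d over the letters of the word: the functionals of
    half-liberated groups are of this form with y = v^-T. *)
Fixpoint alt (A : nzRingType) (v y : 'M[A]_N) (w : seq letter) : A :=
  if w is a :: w' then v a.1 a.2 * alt y v w' else 1.

Lemma alt_wval (A : nzRingType) (g : 'M[A]_N) w : alt g g w = wval g w.
Proof. by elim: w => [|a w IH]; rewrite ?wval_nil ?wval_cons //= IH. Qed.

Lemma convol_alt (v y v' y' : 'M[C]_N) w :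
  convol (alt v y) (alt v' y') w = alt (v *m v') (y *m y') w.
Proof.
elim: w v y v' y' => [|a w IH] v y v' y'; first by rewrite convol_nil /= mulr1.
rewrite convol_cons /= mxE mulr_suml; apply: eq_bigr => c _.
by rewrite convolZ IH.
Qed.

Lemma alt_diag (d e : 'rV[C]_N) w :
  alt (diag_mx d) (diag_mx e) w = alt (diag_mx d) (diag_mx e) w * wcounit R w.
Proof.
elim: w d e => [|a w IH] d e; first by rewrite /= /wcounit big_nil mulr1.
have -> : wcounit R (a :: w) = (a.1 == a.2)%:R * wcounit R w by exact: big_cons.
rewrite /= {1}IH !mxE; case: (a.1 == a.2); rewrite ?mulr1n ?mulr0n; ring.
Qed.

Section Twist.
Variables (m : nat) (gam : 'I_N -> 'M[C]_m.+1).

Definition gw (i : seq 'I_N) : 'M[C]_m.+1 := \prod_(c <- i) gam c.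

Lemma gw_nil : gw [::] = 1. Proof. exact: big_nil. Qed.
Lemma gw_cons c i : gw (c :: i) = gam c * gw i. Proof. exact: big_cons. Qed.

(** The functional f twisted by coefficients of the products of the generators
    gamma over the rows and over the columns. *)
Definition phi (f : seq letter -> C) s t p q (w : seq letter) : C :=
  f w * (gw (unzip1 w) s t * gw (unzip2 w) p q).

Lemma convol_phi f f' s t p q s' t' p' q' w :
  convol (phi f s t p q) (phi f' s' t' p' q') w =
  tsum (size w) (fun k => f (zip (unzip1 w) k) * f' (zip k (unzip2 w)) *
    (gw k p q * gw k s' t')) * (gw (unzip1 w) s t * gw (unzip2 w) p' q').
Proof.
rewrite -tsum_mulr /convol; apply: eq_bigr => k _; rewrite /phi.
rewrite !unzip1_zip ?unzip2_zip ?size_map ?size_tuple //; ring.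
Qed.

Hypothesis gam_orth : forall c, gam c *m (gam c)^T = 1.

Lemma gw_orth i : gw i *m (gw i)^T = 1.
Proof.
elim: i => [|c i IH]; first by rewrite gw_nil trmx1 mulmx1.
rewrite gw_cons [_ * _]/(_ *m _) trmx_mul mulmxA -[gam c *m _ *m _]mulmxA IH.
by rewrite [_ *m 1]mulmx1.
Qed.

Lemma gw_sqsum i : \sum_s \sum_t gw i s t * gw i s t = m.+1%:R.
Proof.
have := congr1 mxtrace (gw_orth i); rewrite mxtrace1 => <-.
rewrite /mxtrace; apply: eq_bigr => s _; rewrite mxE.
by apply: eq_bigr => t _; rewrite mxE.
Qed.

(** The twists of the inner indices cancel, as the Hilbert-Schmidt norm of an
    orthogonal matrix is constant. *)
Lemma phi_mul f f' s t s' t' w :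
  \sum_p \sum_q convol (phi f s t p q) (phi f' p q s' t') w =
  m.+1%:R * phi (convol f f') s t s' t' w.
Proof.
under eq_bigr do under eq_bigr do rewrite convol_phi.
under eq_bigr do rewrite -mulr_suml -tsum_sum.
rewrite -mulr_suml -tsum_sum /phi [RHS]mulrA; congr (_ * _).
transitivity (tsum (size w) (fun k =>
    f (zip (unzip1 w) k) * f' (zip k (unzip2 w)) * m.+1%:R)).
  apply: eq_tsum => k sk; rewrite -(gw_sqsum k) mulr_sumr.
  by apply: eq_bigr => p _; rewrite mulr_sumr.
by rewrite tsum_mulr mulrC.
Qed.

Lemma ann_phi_convol (I : qgrp R N) f f' : closed_qsubgroup I ->
  (forall s t p q, ann I (phi f s t p q)) ->
  (forall s t p q, ann I (phi f' s t p q)) ->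
  forall s t p q, ann I (phi (convol f f') s t p q).
Proof.
move=> hI hf hf' s t s' t'.
have h := ann_sum (index_enum _) (fun=> 1)
  (fun p => ann_sum (index_enum _) (fun=> 1)
     (fun q => ann_convol hI (hf s t p q) (hf' p q s' t'))).
apply: ann_ext (ann_scale (m.+1%:R)^-1 h) => w.
rewrite -[RHS](mulKf (_ : m.+1%:R != 0 :> C)) ?pnatr_eq0 // -phi_mul.
by congr (_ * _); apply: eq_bigr => p _; rewrite mul1r; apply: eq_bigr => q _; rewrite mul1r.
Qed.

End Twist.

End Functionals.

(** * Rational families of functionals *)

Section RationalFamilies.
Variables (R : realType) (N : nat).
Local Notation C := R[i].
Local Notation letter := ('I_N * 'I_N)%type.
Local Notation poly := (ncpoly R N).

Lemma poly_inj_eq0 (p : {poly C}) (t : nat -> C) :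
  injective t -> (forall n, p.[t n] = 0) -> p = 0.
Proof.
move=> ti h; apply/eqP; apply: contraT => p0.
have := @max_poly_roots _ p [seq t n | n <- iota 0 (size p)] p0.
rewrite size_map size_iota ltnn map_inj_uniq // iota_uniq => -> //.
by apply/allP => x /mapP[n _ ->]; apply/rootP.
Qed.

Definition ratmx (V : 'M[{poly C}]_N) (r : {poly C}) (x : C) : 'M[C]_N :=
  \matrix_(i, j) ((V i j).[x] / r.[x]).

Lemma alt_ratmx V Y r x w :
  alt (ratmx V r x) (ratmx Y r x) w = (alt V Y w).[x] / r.[x] ^+ size w.
Proof.
elim: w V Y => [|a w IH] V Y /=; first by rewrite hornerC expr0 divr1.
by rewrite IH mxE hornerM exprS invfM; ring.
Qed.

Variables (I : qgrp R N) (V Y : 'M[{poly C}]_N) (r : {poly C}) (t : nat -> C).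
Variable (psi : seq letter -> C).
Hypothesis t_inj : injective t.
Hypothesis rt : forall n, r.[t n] != 0.
Hypothesis hV : forall n,
  ann I (fun w => alt (ratmx V r (t n)) (ratmx Y r (t n)) w * psi w).

(** Clearing the denominators, the vanishing at infinitely many parameters becomes
    an identity of polynomials in the parameter, from which values at other
    parameters, derivatives and coefficients can be extracted. *)
Lemma rational_identity P : I P -> exists d, (forall w, w \in msupp P -> (size w <= d)%N) /\
  \sum_(w <- msupp P) (P@_w * psi w) *: (alt V Y w * r ^+ (d - size w)) = 0.
Proof.
move=> IP; exists (\max_(w <- msupp P) size w); set d := \max_(w <- _) _.
have hd w : w \in msupp P -> (size w <= d)%N.
  by move=> wP; apply: (@leq_bigmax_seq _ _ xpredT (fun w : word N => size w)).
split=> //; apply: (poly_inj_eq0 t_inj) => n.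
have e := hV n IP; apply: etrans (mulr0 (r.[t n] ^+ d)).
apply: etrans (congr1 ( *%R _) e); rewrite horner_sum pairingE mulr_sumr.
rewrite big_seq [RHS]big_seq; apply: eq_bigr => w wP.
rewrite alt_ratmx hornerZ hornerM horner_exp -(subnK (hd w wP)) addnK exprD.
have := rt n; move: (r.[t n]) => x x0.
have : x ^+ size w != 0 by rewrite expf_neq0.
by move: (x ^+ size w) => z z0; field.
Qed.

Lemma ann_ratmx x : r.[x] != 0 ->
  ann I (fun w => alt (ratmx V r x) (ratmx Y r x) w * psi w).
Proof.
move=> rx P /rational_identity[d [hd /(congr1 (horner^~ x))]].
move=> /=; rewrite horner_sum horner0 => e.
apply: (mulfI (_ : r.[x] ^+ d != 0)); first by rewrite expf_neq0.
rewrite mulr0; apply: etrans e; rewrite pairingE mulr_sumr.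
rewrite big_seq [RHS]big_seq; apply: eq_bigr => w wP.
rewrite alt_ratmx hornerZ hornerM horner_exp -{1}(subnK (hd w wP)) exprD.
have : r.[x] ^+ size w != 0 by rewrite expf_neq0.
by move: (r.[x] ^+ size w) => z z0; field.
Qed.

Lemma ann_rat_deriv : r.[0] = 1 -> r^`().[0] = 0 ->
  ann I (fun w => (alt V Y w)^`().[0] * psi w).
Proof.
move=> r0 r'0 P /rational_identity[d [hd /(congr1 (fun p => p^`().[0]))]].
move=> /=; rewrite linear_sum horner_sum deriv0 horner0 => e; apply: etrans e; rewrite pairingE.
apply: eq_bigr => w _.
rewrite /= derivZ hornerZ derivM hornerD !hornerM horner_exp r0 expr1n.
by rewrite deriv_exp hornerMn hornerM r'0 mul0r mul0rn; ring.
Qed.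

Lemma ann_rat_coef k : r = 'X ->
  ann I (fun w => (alt V Y w)`_(k + size w) * psi w).
Proof.
move=> rX P /rational_identity[d [hd /(congr1 (fun p : {poly C} => p`_(k + d)))]].
move=> /=; rewrite coef_sum coef0 => e; apply: etrans e; rewrite pairingE.
rewrite big_seq [RHS]big_seq; apply: eq_bigr => w wP.
rewrite coefZ rX coefMXn; have le := hd w wP.
case: ltnP => [lt|_]; first by lia.
by rewrite (_ : k + d - (d - size w) = k + size w)%N; [ring | lia].
Qed.

End RationalFamilies.

Section PlaneMatrices.
Variables (C : comNzRingType) (N : nat) (a b : 'I_N).
Hypothesis ab : a != b.

(** A 2 x 2 matrix acting on the coordinates a and b. *)
Definition plane (p q r s : C) : 'M[C]_N := \matrix_(i, j)
  if i == a then (if j == a then p else if j == b then q else 0)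
  else if i == b then (if j == a then r else if j == b then s else 0)
  else (i == j)%:R.

Lemma plane_mul p q r s p' q' r' s' :
  plane p q r s *m plane p' q' r' s' =
  plane (p * p' + q * r') (p * q' + q * s') (r * p' + s * r') (r * q' + s * s').
Proof.
have ba : b == a = false by rewrite eq_sym (negbTE ab).
apply/matrixP => i j; rewrite !mxE.
have [ia|ia] := eqVneq i a.
  rewrite (bigD1 a) //= (bigD1 b) ?ba //= big1 ?addr0 => [|k /andP[ka kb]].
    rewrite !mxE ia !eqxx ba; case: (j == a); case: (j == b); ring.
  by rewrite !mxE ia eqxx (negbTE ka) (negbTE kb) mul0r.
have [ib|ib] := eqVneq i b.
  rewrite (bigD1 a) //= (bigD1 b) ?ba //= big1 ?addr0 => [|k /andP[ka kb]].
    rewrite !mxE ib !eqxx ba; case: (j == a); case: (j == b); ring.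
  by rewrite !mxE ib eqxx ba (negbTE ka) (negbTE kb) mul0r.
rewrite (bigD1 i) //= big1 ?addr0 => [|k ki].
  by rewrite !mxE (negbTE ia) (negbTE ib) eqxx mul1r.
by rewrite !mxE (negbTE ia) (negbTE ib) eq_sym (negbTE ki) mul0r.
Qed.

Lemma plane_tr p q r s : (plane p q r s)^T = plane p r q s.
Proof.
have ba : b == a = false by rewrite eq_sym (negbTE ab).
apply/matrixP => i j; rewrite !mxE.
case ia: (i == a); case ib: (i == b); case ja: (j == a); case jb: (j == b) => //=;
  by [rewrite (eqP ia) ja | rewrite (eqP ib) jb | rewrite (eqP ja) ia
     | rewrite (eqP jb) ib | rewrite eq_sym].
Qed.

Lemma plane1 : plane 1 0 0 1 = 1%:M.
Proof.
apply/matrixP => i j; rewrite !mxE.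
case ia: (i == a); case ib: (i == b); case ja: (j == a); case jb: (j == b) => //=;
  by [rewrite (eqP ia) eq_sym ja | rewrite (eqP ib) eq_sym jb
     | rewrite (eqP ia) (eqP ja) eqxx | rewrite (eqP ib) (eqP jb) eqxx
     | move: ab; rewrite -(eqP ja) -(eqP jb) eqxx].
Qed.

End PlaneMatrices.

(** * Rotations *)

Section Rotations.
Variables (R : realType) (N : nat).
Local Notation C := R[i].
Local Notation letter := ('I_N * 'I_N)%type.
Local Notation poly := (ncpoly R N).

(** Numerator of the rational parametrization (1 - t^2, 2 t) / (1 + t^2) of the
    rotations in the plane of a and b. *)
Definition rotpoly (a b : 'I_N) : 'M[{poly C}]_N := \matrix_(i, j)
  (plane a b (1 - 'X^2) (2%:P * 'X) (- (2%:P * 'X)) (1 - 'X^2) i j *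
   (if (i == a) || (i == b) then 1 else 1 + 'X^2)).

Lemma ratmx_rotpoly a b x : 1 + x ^+ 2 != 0 :> C ->
  let c := (1 - x ^+ 2) / (1 + x ^+ 2) in let s := 2 * x / (1 + x ^+ 2) in
  ratmx (rotpoly a b) (1 + 'X^2) x = plane a b c s (- s) c.
Proof.
move=> nz c s; apply/matrixP => i j; rewrite !mxE hornerM.
have -> : (1 + 'X^2 : {poly C}).[x] = 1 + x ^+ 2 by rewrite !hornerE.
case: (i == a) => /=; [|case: (i == b) => /=].
- by case: (j == a); [|case: (j == b)]; rewrite !hornerE // mul0r.
- by case: (j == a); [|case: (j == b)]; rewrite !hornerE ?mulNr // mul0r.
case: (i == j); rewrite !hornerE; last by rewrite ?mul0r.
by rewrite ?mul1r divff.
Qed.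

Lemma alt_deriv0 (V : 'M[{poly C}]_N) (d : 'I_N -> 'I_N -> C) s w :
  (forall i j, (V i j).[0] = (i == j)%:R) ->
  (forall i j, (V i j)^`().[0] = 2 * d i j) ->
  s * (alt V V w)^`().[0] = 2 * deriv (fun=> 1) d s w.
Proof.
move=> V0 V1; elim: w s => [|a w IH] s /=.
  by rewrite derivC horner0 !mulr0.
rewrite derivM hornerD !hornerM V0 V1.
have -> : (alt V V w).[0] = wcounit R w.
  elim: w {IH} => [|x w IH]; first by rewrite hornerC /wcounit big_nil.
  by rewrite /= hornerM V0 IH [RHS]/wcounit big_cons.
rewrite mulr1; set x := (alt V V w)^`().[0]; have := IH s; rewrite -/x => e.
transitivity (2 * (s * d a.1 a.2 * wcounit R w) + (a.1 == a.2)%:R * (s * x)).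
  by ring.
by rewrite e; ring.
Qed.

Lemma deriv_rotpoly0 a b i j : a != b ->
  (rotpoly a b i j).[0] = (i == j)%:R /\
  (rotpoly a b i j)^`().[0] = 2 * dR R a b i j.
Proof.
move=> ab; rewrite !mxE /dR.
set f1 := 1 - 'X^2; set f2 := _ * 'X; set f3 := 1 + 'X^2.
have [e1 e1'] : f1.[0] = 1 /\ f1^`().[0] = 0.
  by rewrite /f1 derivB derivC derivXn !hornerE; split; ring.
have [e3 e3'] : f3.[0] = 1 /\ f3^`().[0] = 0.
  by rewrite /f3 derivD derivC derivXn !hornerE; split; ring.
have [e2 e2'] : f2.[0] = 0 /\ f2^`().[0] = 2.
  by rewrite /f2 derivM derivC derivX !hornerE; split; ring.
clearbody f1 f2 f3.
case ia: (i == a) => /=; [|case ib: (i == b) => /=]; rewrite ?mulr1.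
- rewrite (eqP ia) (negbTE ab) /= subr0.
  case ja: (j == a) => /=; [|case jb: (j == b) => /=].
  + by rewrite (eqP ja) eqxx (negbTE ab) e1 e1' mulr0.
  + by rewrite (eqP jb) (negbTE ab) e2 e2' mulr1.
  + by rewrite [a == j]eq_sym ja derivC !hornerC mulr0.
- rewrite (eqP ib) /= sub0r.
  case ja: (j == a) => /=; [|case jb: (j == b) => /=].
  + by rewrite (eqP ja) eq_sym (negbTE ab) derivN !hornerN e2 e2' oppr0 mulrN1.
  + by rewrite (eqP jb) eqxx e1 e1' oppr0 mulr0.
  + by rewrite [b == j]eq_sym jb derivC !hornerC oppr0 mulr0.
case: (i == j); first by rewrite mul1r e3 e3' subrr mulr0.
by rewrite mul0r derivC !hornerC subrr mulr0.
Qed.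

Section Twisted.
Variables (I : qgrp R N) (hI : closed_qsubgroup I).
Variables (m : nat) (gam : 'I_N -> 'M[C]_m.+1).

Definition has_rotations := forall a b, a != b -> forall c s : C,
  c^* = c -> s^* = s -> c ^+ 2 + s ^+ 2 = 1 ->
  forall p q p' q', ann I (phi gam (wval (plane a b c s (- s) c)) p q p' q').

Hypothesis hG : has_rotations.

Lemma rotpoly_family a b p q p' q' n : a != b ->
  ann I (fun w => alt (ratmx (rotpoly a b) (1 + 'X^2) n%:R)
                      (ratmx (rotpoly a b) (1 + 'X^2) n%:R) w *
    (gw gam (unzip1 w) p q * gw gam (unzip2 w) p' q')).
Proof.
move=> ab; have nz : 1 + n%:R ^+ 2 != 0 :> C.
  by rewrite gt_eqF // ltr_wpDr // exprn_ge0 // ler0n.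
rewrite ratmx_rotpoly //.
set c := _ / _; set s := _ / _.
have := hG ab (c := c) (s := s) _ _ _ p q p' q'.
apply: (fun (P Q : Prop) (h : P -> Q) f => h f) => h; last first.
  apply: ann_ext (h _ _ _) => [w||| ]; first by rewrite /phi alt_wval.
  - by rewrite /c rmorphM fmorphV !rmorphD rmorphN rmorph1 !rmorphXn !rmorph_nat.
  - by rewrite /s !(rmorphM, fmorphV, rmorphD, rmorph1, rmorphXn, rmorph_nat).
  by rewrite /c /s; field.
Qed.

Lemma rX2 n : (1 + 'X^2 : {poly C}).[n%:R] != 0.
Proof.
by rewrite !hornerE gt_eqF // ltr_wpDr // exprn_ge0 // ler0n.
Qed.

Lemma natr_inj_C : injective (fun n => n%:R : C).
Proof. by move=> m' n /eqP; rewrite eqr_nat => /eqP. Qed.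

(** The denominator 1 + t^2 has derivative zero at 0 and the numerator is tangent
    to twice the infinitesimal rotation. *)
Lemma ann_phi_rot a b p q p' q' : a != b ->
  ann I (phi gam (rot R a b) p q p' q').
Proof.
move=> ab.
have h := ann_rat_deriv natr_inj_C rX2 (fun n => rotpoly_family p q p' q' n ab) _ _.
apply: ann_ext (ann_scale (2%:R)^-1 (h _ _)) => [w||].
- rewrite /phi /rot; have := @alt_deriv0 (rotpoly a b) (dR R a b) 1 w.
  rewrite mul1r => -> //; first by rewrite -[2 * _ * _]mulrA mulKf ?pnatr_eq0.
  + by move=> i j; case: (deriv_rotpoly0 i j ab).
  by move=> i j; case: (deriv_rotpoly0 i j ab).
- by rewrite !hornerE; ring.
by rewrite derivD derivC derivXn !hornerE; ring.
Qed.

(** Rotations with complex parameters; the rational parametrization misses only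
    c = -1. *)
Lemma ann_phi_plane a b (c s : C) p q p' q' : a != b ->
  c ^+ 2 + s ^+ 2 = 1 -> c != -1 ->
  ann I (phi gam (alt (plane a b c s (- s) c) (plane a b c s (- s) c)) p q p' q').
Proof.
move=> ab cs c1; have c1' : 1 + c != 0 by rewrite addrC -[1]opprK subr_eq0.
pose x := s / (1 + c).
have e : 1 + x ^+ 2 = 2 / (1 + c).
  have es : s ^+ 2 = 1 - c ^+ 2 by rewrite -cs; ring.
  by rewrite /x expr_div_n es; field.
have nz : 1 + x ^+ 2 != 0 by rewrite e mulf_neq0 ?invr_eq0 ?pnatr_eq0.
have := ann_ratmx natr_inj_C rX2 (fun n => rotpoly_family p q p' q' n ab) (x := x).
rewrite !hornerE => /(_ nz); rewrite ratmx_rotpoly //.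
have -> : 2 * x / (1 + x ^+ 2) = s by rewrite e /x; field; rewrite ?pnatr_eq0 ?c1'.
have -> : (1 - x ^+ 2) / (1 + x ^+ 2) = c.
  have -> : 1 - x ^+ 2 = 2 - (1 + x ^+ 2) by ring.
  by rewrite e; field; rewrite ?pnatr_eq0 ?c1'.
by [].
Qed.

End Twisted.
End Rotations.

(** * Clifford generators *)

Section CliffordTwist.
Variables (R : realType) (N : nat).
Local Notation C := R[i].
Local Notation letter := ('I_N * 'I_N)%type.
Local Notation poly := (ncpoly R N).

Record clifford m (gam : 'I_N -> 'M[C]_m.+1) : Prop := {
  cl_star : forall c, star (gam c) = gam c;
  cl_tr : forall c, (gam c)^T = gam c;
  cl_sqr : forall c, gam c * gam c = 1;
  cl_anti : forall c d, c != d -> gam c * gam d = - (gam d * gam c)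
}.

Section Fixed.
Variables (I : qgrp R N) (hI : closed_qsubgroup I).
Variables (m : nat) (gam : 'I_N -> 'M[C]_m.+1) (hgam : clifford gam).

Lemma cl_orth c : gam c *m (gam c)^T = 1.
Proof. by rewrite (cl_tr hgam); exact: (cl_sqr hgam). Qed.

Lemma deriv_scale kappa (d : 'I_N -> 'I_N -> C) s t w :
  deriv kappa d (s * t) w = s * deriv kappa d t w.
Proof.
elim: w t => [|a w IH] t /=; first by rewrite mulr0.
rewrite -[s * t * kappa _]mulrA IH; ring.
Qed.

(** If the words differ at one letter only, a against b, the product of the
    gammas over the rows by the transpose of the one over the columns is the
    conjugate of gamma_a gamma_b by the prefix, that is gamma_a gamma_b with the
    sign of the twisted rotation. *)
Lemma gw_commute w a b : a != b ->
  deriv (fun=> 1) (dR R a b) 1 w *: (gw gam (unzip1 w) *m (gw gam (unzip2 w))^T) =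
  deriv (kap R a b) (dB R a b) 1 w *: (gam a *m gam b).
Proof.
move=> ab; elim: w => [|[i j] w IH] /=; first by rewrite !scale0r.
rewrite !gw_cons [gam j * _]/(_ *m _) trmx_mul (cl_tr hgam) !mul1r.
rewrite -[kap _ _ _ _]mulr1 deriv_scale.
rewrite [gam i * _]/(_ *m _) -mulmxA [_ *m (_ *m gam j)]mulmxA !scalerDl; congr (_ + _).
  have [e|/negbTE ne] := eqVneq (wcounit R w) 0; first by rewrite e !mulr0 !scale0r.
  have -> : unzip1 w = unzip2 w.
    elim: w {IH} ne => [|x w IH] //=.
    have -> : wcounit R (x :: w) = (x.1 == x.2)%:R * wcounit R w by exact: big_cons.
    by have [->|_] := eqVneq x.1 x.2; rewrite ?mul1r ?mul0r ?eqxx // => /IH ->.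
  rewrite (gw_orth cl_orth) mul1mx mulrC [_ * wcounit _ _]mulrC -!scalerA; congr (_ *: _).
  rewrite /dR /dB.
  have anti : gam b *m gam a = - (gam a *m gam b).
    by apply: (cl_anti hgam); rewrite eq_sym.
  case e1: ((i == a) && (j == b)).
    have [/eqP -> /eqP ->] := andP e1; rewrite (negbTE ab) /=.
    by rewrite subr0 addr0.
  case e2: ((i == b) && (j == a)); last by rewrite subrr addr0 !scale0r.
  have [/eqP -> /eqP ->] := andP e2.
  by rewrite anti sub0r add0r scaleN1r opprK scale1r.
have [->|_] := eqVneq i j; last by rewrite !mul0r !scale0r.
rewrite !mul1r [kap _ _ _ _ * _]mulrC -scalerA.
have := congr1 (fun M => gam j *m (M *m gam j)) IH.
rewrite -!scalemxAl -!scalemxAr => -> {IH}; congr (_ *: _).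
rewrite -![_ *m _]/(_ * _) !mulrA /kap.
have sq := cl_sqr hgam; have anti := cl_anti hgam; have ba : b != a by rewrite eq_sym.
have [->|ja] := eqVneq j a => /=.
  by rewrite sq mul1r scaleN1r (anti _ _ ba).
have [->|jb] := eqVneq j b => /=.
  by rewrite -mulrA sq mulr1 scaleN1r (anti _ _ ba).
rewrite scale1r (anti _ _ ja) !mulNr -[gam a * _ * _]mulrA (anti _ _ jb).
by rewrite mulrN mulNr opprK mulrA -[_ * gam j * _]mulrA sq mulr1.
Qed.

(** Contract the twisted functional with gamma_a gamma_b. *)
Lemma ann_twrot a b : a != b ->
  (forall p q p' q', ann I (phi gam (rot R a b) p q p' q')) ->
  ann I (twrot R a b).
Proof.
move=> ab h; pose K := gam a *m gam b.
have hK : \sum_p \sum_q K p q * K p q = m.+1%:R.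
  have := gw_sqsum cl_orth [:: a; b]; rewrite !gw_cons gw_nil mulr1; apply.
have hs := ann_sum (index_enum _) (fun=> 1) (fun p => ann_sum (index_enum _) (K p)
  (fun q => ann_sum (index_enum _) (fun=> 1) (fun t => h p t q t))).
apply: ann_ext (ann_scale (m.+1%:R)^-1 hs) => w.
rewrite -[RHS](mulKf (_ : m.+1%:R != 0 :> C)) ?pnatr_eq0 // -hK mulr_suml.
congr (_ * _); apply: eq_bigr => p _; rewrite mul1r mulr_suml; apply: eq_bigr => q _.
have := congr1 (fun M : 'M_m.+1 => M p q) (gw_commute w ab).
rewrite -/(rot R a b w) -/(twrot R a b w) [LHS]mxE [RHS]mxE -/K.
rewrite [(_ *m _^T) p q]mxE => e.
rewrite -[RHS]mulrA [K p q * twrot _ _ _ _]mulrC; congr (_ * _); apply: etrans e.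
rewrite mulr_sumr; apply: eq_bigr => t _.
by rewrite mul1r [X in _ * (_ * X)]mxE.
Qed.

(** The diagonal matrix with entries gamma is a model of H_N^+.  Convolution by its
    coefficients on both sides twists a functional, and a second twist undoes
    the first one: this is how H_N^+ exchanges O_N with its twisted version. *)
Definition gamdiag p q (w : seq letter) : C := wcounit R w * gw gam (unzip1 w) p q.

Lemma wcounit_zip i j : size i = size j -> wcounit R (zip i j) = (i == j :> seq 'I_N)%:R.
Proof.
elim: i j => [|c i IH] [|d j] //; first by rewrite /wcounit big_nil.
move=> [/IH e]; rewrite eqseq_cons -mulnb natrM -e; exact: big_cons.
Qed.

Lemma convol_gamdiag f p q p' q' w :
  convol (convol (gamdiag p q) f) (gamdiag p' q') w = phi gam f p q p' q' w.
Proof.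
have pick (V : lmodType C) n (F : seq 'I_N -> V) (x : seq 'I_N) : size x = n ->
    \sum_(t : n.-tuple 'I_N) ((t : seq 'I_N) == x)%:R *: F t = F x.
  by move=> sx; rewrite sum_word sx eqxx.
have [i [j [-> sij]]] : exists i j, w = zip i j /\ size i = size j.
  by exists (unzip1 w), (unzip2 w); rewrite zip_unzip !size_map.
rewrite convol_tsum // /phi unzip1_zip ?unzip2_zip ?sij //.
transitivity (tsum (size j) (fun k => (k == j)%:R *
    (f (zip i k) * (gw gam i p q * gw gam k p' q')))); last first.
  exact: (pick C^o _ (fun k => f (zip i k) * (gw gam i p q * gw gam k p' q')) j).
apply: eq_tsum => k sk; rewrite convol_tsum ?sk // /gamdiag.
rewrite wcounit_zip ?sk // unzip1_zip ?sk //.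
have -> : tsum (size j) (fun l => wcounit R (zip i l) * gw gam (unzip1 (zip i l)) p q *
    f (zip l k)) = tsum (size j) (fun l => (l == i)%:R * (gw gam i p q * f (zip l k))).
  apply: eq_tsum => l sl; rewrite wcounit_zip ?sl // unzip1_zip ?sl ?sij //.
  by rewrite eq_sym; ring.
rewrite [tsum _ _](_ : _ = gw gam i p q * f (zip i k)); last first.
  exact: (pick C^o _ (fun l => gw gam i p q * f (zip l k)) i).
ring.
Qed.

Section WithDiagonal.
Hypothesis hH : forall p q, ann I (gamdiag p q).

Lemma ann_phi_of_gamdiag f : ann I f ->
  forall p q p' q', ann I (phi gam f p q p' q').
Proof.
move=> hf p q p' q'.
exact: ann_ext (convol_gamdiag f p q p' q') (ann_convol hI (ann_convol hI (hH p q) hf) (hH p' q')).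
Qed.

Lemma ann_of_phi f : (forall p q p' q', ann I (phi gam f p q p' q')) -> ann I f.
Proof.
move=> hf.
have h := ann_sum (index_enum _) (fun=> 1) (fun p => ann_sum (index_enum _) (fun=> 1)
  (fun q => ann_sum (index_enum _) (fun=> 1) (fun p' => ann_sum (index_enum _) (fun=> 1)
  (fun q' => ann_phi_of_gamdiag (hf p q p' q') p q p' q')))).
apply: ann_ext (ann_scale (m.+1%:R * m.+1%:R)^-1 h) => w.
rewrite -[RHS](mulKf (_ : m.+1%:R * m.+1%:R != 0 :> C)) ?mulf_neq0 ?pnatr_eq0 //.
congr (_ * _); rewrite -{1}(gw_sqsum cl_orth (unzip1 w)) -(gw_sqsum cl_orth (unzip2 w)).
rewrite -mulrA mulr_suml; apply: eq_bigr => p _; rewrite mul1r mulr_suml.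
apply: eq_bigr => q _; rewrite mul1r mulr_suml mulr_sumr; apply: eq_bigr => p' _.
rewrite mul1r mulr_suml mulr_sumr; apply: eq_bigr => q' _.
rewrite mul1r /phi; ring.
Qed.

End WithDiagonal.
End Fixed.

(** One generator is added at a time: the former ones are tensored with diag(1, -1)
    and the new one is the permutation of the second factor. *)
Lemma clifford_exists : exists m (gam : 'I_N -> 'M[C]_m.+1), clifford gam.
Proof.
suff [m [g [h1 h2 h3 h4]]] : exists m (g : nat -> 'M[C]_m.+1),
    [/\ forall c, star (g c) = g c, forall c, (g c)^T = g c,
      forall c, (c < N)%N -> g c * g c = 1 &
      forall c d, (c < N)%N -> (d < N)%N -> c != d -> g c * g d = - (g d * g c)].
  by exists m, (fun c => g c); split=> [c|c|c|c d cd];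
    [exact: h1 | exact: h2 | exact: h3 | exact: h4].
elim: (N) => [|n [m [g [h1 h2 h3 h4]]]].
  by exists 0%N, (fun=> 1); split=> // c; rewrite ?trmx1 ?star1.
pose sx : 'M[C]_2 := \matrix_(i, j) (i != j)%:R.
pose sz : 'M[C]_2 := \matrix_(i, j) (if i == j then (-1) ^+ i else 0).
pose gg c : 'M[C]_((1 + m * 2).+1) := if (c < n)%N then tens (g c) sz else tens 1 sx.
have trt (A : 'M[C]_m.+1) (B : 'M[C]_2) : (tens A B)^T = tens A^T B^T 
  by apply: tens_eqP => *; rewrite [LHS]mxE !tensE !mxE.
have sx2 : sx * sx = 1.
  by apply/matrixP => -[[|[|//]] ?] -[[|[|//]] ?]; rewrite !mxE !big_ord_recl big_ord0 !mxE /=; ring.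
have sz2 : sz * sz = 1.
  by apply/matrixP => -[[|[|//]] ?] -[[|[|//]] ?]; rewrite !mxE !big_ord_recl big_ord0 !mxE /=; ring.
have sxz : sx * sz = - (sz * sx).
  by apply/matrixP => -[[|[|//]] ?] -[[|[|//]] ?]; rewrite !mxE !big_ord_recl !big_ord0 !mxE /=; ring.
have tN (A : 'M[C]_m.+1) (B : 'M[C]_2) : tens A (- B) = - tens A B.
  by apply: tens_eqP => *; rewrite [RHS]mxE !tensE mxE mulrN.
have tNl (A : 'M[C]_m.+1) (B : 'M[C]_2) : tens (- A) B = - tens A B.
  by apply: tens_eqP => *; rewrite [RHS]mxE !tensE mxE mulNr.
exists (1 + m * 2)%N, gg; rewrite /gg; split.
- move=> c; case: ifP => _; rewrite star_tens ?h1 ?star1; congr tens.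
    by apply/matrixP => i j; rewrite starE !mxE eq_sym; case: eqP => [->|]; rewrite ?rmorph0 // rmorphXn rmorphN rmorph1.
  by apply/matrixP => i j; rewrite starE !mxE eq_sym rmorph_nat.
- move=> c; case: ifP => _; rewrite trt ?h2 ?trmx1; congr tens.
    by apply/matrixP => i j; rewrite !mxE eq_sym; case: eqP => [->|].
  by apply/matrixP => i j; rewrite !mxE eq_sym.
- move=> c cn; case: ifP => c1; rewrite tensM ?sz2 ?sx2 ?mulr1 ?h3 //; exact: tens11.
move=> c d cn dn cd; case: ltnP => c1; case: ltnP => d1.
- by rewrite !tensM h4 // tNl.
- by rewrite !tensM mulr1 mul1r sxz tN opprK.
- by rewrite !tensM mulr1 mul1r sxz tN.
by lia.
Qed.

End CliffordTwist.

(** * Gaussian elimination *)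

Section LinearGroup.
Variables (C : fieldType) (N : nat).
Variables (S : 'M[C]_N -> Prop).

Definition dilation (l : 'I_N) (x : C) : 'M[C]_N :=
  diag_mx (\row_c if c == l then x else 1).

Hypothesis S1 : S 1%:M.
Hypothesis SM : forall v w, S v -> S w -> S (v *m w).
Hypothesis Sdil : forall l x, x != 0 -> S (dilation l x).
Hypothesis Strans : forall (a b : 'I_N) t, a != b -> S (1%:M + t *: delta_mx a b).

Lemma delta_mulE (a b : 'I_N) (M : 'M[C]_N) i j :
  (delta_mx a b *m M) i j = (i == a)%:R * M b j.
Proof.
rewrite mxE (bigD1 b) //= big1 ?addr0 => [|k kb]; rewrite mxE ?eqxx ?andbT //.
by rewrite (negbTE kb) andbF mul0r.
Qed.

Lemma mul_deltaE (a b : 'I_N) (M : 'M[C]_N) i j :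
  (M *m delta_mx a b) i j = M i a * (j == b)%:R.
Proof.
rewrite mxE (bigD1 a) //= big1 ?addr0 => [|k ka]; rewrite mxE ?eqxx //.
by rewrite (negbTE ka) mulr0.
Qed.

Lemma S_colop s k (c : 'I_N -> C) :
  S (1%:M + \sum_(i <- s | i != k) c i *: delta_mx i k).
Proof.
elim: s => [|i s IH]; first by rewrite big_nil addr0.
rewrite big_cons; case: ifP => // ik.
rewrite [X in S X](_ : _ = (1%:M + c i *: delta_mx i k) *m
    (1%:M + \sum_(i <- s | i != k) c i *: delta_mx i k)).
  by apply: SM => //; exact: Strans.
rewrite mulmxDl mul1mx mulmxDr mulmx1 mulmx_sumr [X in _ + (_ + X)]big1 ?addr0.
  by rewrite -addrA; congr (_ + _); rewrite addrC.
move=> j jk; rewrite -scalemxAl -scalemxAr mul_delta_mx_cond eq_sym (negbTE jk).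
by rewrite mulr0n !scaler0.
Qed.

Lemma S_rowop s k (r : 'I_N -> C) :
  S (1%:M + \sum_(j <- s | j != k) r j *: delta_mx k j).
Proof.
elim: s => [|i s IH]; first by rewrite big_nil addr0.
rewrite big_cons; case: ifP => // ik.
rewrite [X in S X](_ : _ = (1%:M + \sum_(j <- s | j != k) r j *: delta_mx k j) *m
    (1%:M + r i *: delta_mx k i)).
  by apply: SM => //; apply: Strans; rewrite eq_sym.
rewrite mulmxDr mulmx1 mulmxDl mul1mx mulmx_suml [X in _ + (_ + X)]big1 ?addr0.
  by rewrite -addrA; congr (_ + _); rewrite addrC.
move=> j jk; rewrite -scalemxAl -scalemxAr mul_delta_mx_cond (negbTE jk).
by rewrite mulr0n !scaler0.
Qed.

Lemma or_ltn (i j k : nat) : i != k -> j != k ->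
  (i <= k)%N || (j <= k)%N -> (i < k)%N || (j < k)%N.
Proof. lia. Qed.

(** Gaussian elimination.  Invertible matrices that agree with the identity on the first k rows
    and columns are treated by decreasing induction on k. *)
Lemma S_unitmx v : v \in unitmx -> S v.
Proof.
pose good k (v : 'M[C]_N) := forall i j : 'I_N, (i < k)%N || (j < k)%N ->
  v i j = (i == j)%:R.
suff gen d k (w : 'M[C]_N) : (N - k = d)%N -> good k w -> w \in unitmx -> S w.
  by apply: (gen N 0%N); rewrite ?subn0 // => i j; rewrite ltn0.
elim: d k w => [|d IH] k {}v dk gv uv.
  have -> : v = 1%:M.
    apply/matrixP => i j; rewrite mxE gv //; apply/orP; left.
    by have := ltn_ord i; lia.
  exact: S1.
have kN : (k < N)%N by lia.
pose l := Ordinal kN.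
have pivot (w : 'M[C]_N) : good k w -> w \in unitmx -> w l l != 0 -> S w.
  move=> gw uw; set p := w l l => p0.
  (* The Schur complement of the pivot. *)
  pose W : 'M[C]_N := \matrix_(i, j) if i == l then (j == l)%:R else
    if j == l then 0 else w i j - w i l * w l j / p.
  have e : w = (1%:M + \sum_(i | i != l) (w i l / p) *: delta_mx i l) *m
      (dilation l p *m (W *m (1%:M + \sum_(j | j != l) (w l j / p) *: delta_mx l j))).
    have eU i j : (W *m (1%:M + \sum_(j | j != l) (w l j / p) *: delta_mx l j)) i j =
        W i j + (if j != l then W i l * (w l j / p) else 0).
      rewrite mulmxDr mulmx1 mxE mulmx_sumr summxE; congr (_ + _).
      have E q : (W *m (w l q / p *: delta_mx l q)) i j = W i l * (w l j / p) * (q == j)%:R.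
        rewrite -scalemxAr mxE mul_deltaE [j == q]eq_sym.
        by have [->|_] := eqVneq q j; rewrite ?mulr1 ?mulr0 ?mulr0 // mulrC.
      under eq_bigr do rewrite E.
      rewrite big_mkcond (bigD1 j) //= big1 ?addr0 ?eqxx ?mulr1 // => q qj.
      by rewrite (negbTE qj) mulr0; case: ifP.
    have eD i j : (dilation l p *m (W *m (1%:M + \sum_(j | j != l) (w l j / p) *: delta_mx l j))) i j =
        (if i == l then p else 1) * (W i j + (if j != l then W i l * (w l j / p) else 0)).
      by rewrite mul_diag_mx [LHS]mxE eU mxE.
    apply/matrixP => i j; rewrite mulmxDl mul1mx mxE eD mulmx_suml summxE.
    have E q : ((w q l / p *: delta_mx q l) *m (dilation l p *m
        (W *m (1%:M + \sum_(j | j != l) (w l j / p) *: delta_mx l j)))) i j =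
        (w i l / p) * (i == q)%:R *
        (p * (W l j + (if j != l then W l l * (w l j / p) else 0))).
      rewrite -scalemxAl mxE delta_mulE eD eqxx.
      by have [->|_] := eqVneq i q; rewrite ?mulr1 ?mul1r // mul0r !mulr0 mul0r.
    under eq_bigr do rewrite E.
    rewrite -mulr_suml big_mkcond (bigD1 i) //= big1 ?addr0 => [|q qi]; last first.
      by rewrite [i == q]eq_sym (negbTE qi) mulr0; case: ifP.
    rewrite eqxx !mxE !eqxx /=.
    have [->|il] := eqVneq i l; have [->|jl] := eqVneq j l => /=.
    - by rewrite mul0r !addr0 mulr1.
    - by rewrite mul0r addr0 add0r mul1r mulrC divfK.
    - by rewrite !addr0 mulr0 add0r !mulr1 divfK.
    - by rewrite mul0r addr0; field.
  rewrite e; apply: SM; first exact: S_colop.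
  apply: SM; first exact: Sdil.
  apply: SM; last exact: S_rowop.
  have uW : W \in unitmx by move: uw; rewrite {1}e !unitmx_mul => /and4P[].
  apply: (IH k.+1) uW; first by lia.
  move=> i j; rewrite !ltnS => ij; rewrite mxE.
  have [->|il] := eqVneq i l; first by rewrite eq_sym.
  have [->|jl] := eqVneq j l; first by rewrite (negbTE il).
  have ij' := or_ltn (il : (i : nat) != k) (jl : (j : nat) != k) ij.
  rewrite gw // (_ : w i l * w l j = 0) ?mul0r ?subr0 //.
  case/orP: ij' => h.
    by rewrite (gw i l) ?h // (negbTE il) mul0r.
  by rewrite (gw l j) ?h ?orbT // eq_sym (negbTE jl) mulr0.
have [v0|] := eqVneq (v l l) 0; last exact: pivot.
have [i vi] : exists i, v i l != 0.
  apply: contrapT => hn; have : v *m (delta_mx l l : 'M_N) = 0.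
    apply/matrixP => i j; rewrite mul_deltaE mxE.
    have [->|nz] := eqVneq (v i l) 0; first by rewrite mul0r.
    by case: hn; exists i.
  move=> e; have := mulKmx uv (delta_mx l l : 'M_N); rewrite e mulmx0.
  by move/matrixP/(_ l l)/eqP; rewrite !mxE eqxx eq_sym oner_eq0.
have li : l != i by apply: contraNneq vi => <-; rewrite v0.
have ki : (k <= i)%N.
  rewrite leqNgt; apply/negP => ik; move: vi; rewrite gv ?ik //.
  by rewrite [i == l]eq_sym (negbTE li) eqxx.
have inv : (1%:M + (-1) *: delta_mx l i) *m (1%:M + 1 *: delta_mx l i) = 1%:M :> 'M[C]_N.
  rewrite mulmxDl !mul1mx mulmxDr mulmx1 -scalemxAl -scalemxAr mul_delta_mx_cond.
  by rewrite [i == l]eq_sym (negbTE li) mulr0n !scaler0 addr0 scale1r scaleN1r addrK.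
have -> : v = (1%:M + (-1) *: delta_mx l i) *m ((1%:M + 1 *: delta_mx l i) *m v).
  by rewrite mulmxA inv mul1mx.
apply: SM; first exact: Strans.
have eT a b : ((1%:M + 1 *: delta_mx l i) *m v) a b = v a b + (a == l)%:R * v i b.
  by rewrite mulmxDl mul1mx scale1r mxE delta_mulE.
apply: pivot.
- move=> a b ab; rewrite eT; have [al|_] := eqVneq a l; last by rewrite mul0r addr0 gv.
  have bk : (b < k)%N by move: ab; rewrite al /= ltnn.
  rewrite gv ?bk ?orbT // [v i b]gv ?bk ?orbT // (_ : (i == b) = false) ?mulr0 ?addr0 //.
  by apply/eqP => e; move: bk; rewrite -e; lia.
- by rewrite unitmx_mul uv andbT; have := mulmx1_unit inv; case.
- by rewrite eT v0 eqxx mul1r add0r.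
Qed.

End LinearGroup.

(** * Diagonal unitaries *)

Section Diagonal.
Variables (R : realType) (N : nat).
Local Notation C := R[i].
Local Notation letter := ('I_N * 'I_N)%type.
Local Notation poly := (ncpoly R N).

(** The Cayley transform of the integers, an injective sequence of complex numbers
    of modulus one. *)
Definition unitc (n : nat) : C := (n%:R + 'i) / (n%:R - 'i).

Lemma natB_i_neq0 (n : nat) : n%:R - 'i != 0 :> C.
Proof.
rewrite subr_eq0; apply/eqP => e; have := sqrCi C; rewrite -e => h.
have : (0 : C) <= n%:R ^+ 2 by rewrite exprn_ge0 // ler0n.
by rewrite h oppr_ge0 lt_geF // ltr01.
Qed.

Lemma conj_natB_i (n : nat) : (n%:R - 'i : C)^* = n%:R + 'i.
Proof. by rewrite rmorphB /= rmorph_nat conjCi opprK. Qed.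

Lemma natD_i_neq0 (n : nat) : n%:R + 'i != 0 :> C.
Proof. by rewrite -conj_natB_i fmorph_eq0 natB_i_neq0. Qed.

Lemma unitc_neq0 n : unitc n != 0.
Proof. by rewrite mulf_neq0 ?invr_eq0 ?natB_i_neq0 ?natD_i_neq0. Qed.

Lemma unitc_conj n : (unitc n)^* = (unitc n)^-1.
Proof.
rewrite /unitc rmorphM fmorphV /= conj_natB_i -[in LHS](conj_natB_i n) conjCK.
by rewrite invfM invrK mulrC conj_natB_i.
Qed.

Lemma unitc_inj : injective unitc.
Proof.
move=> m n e; have : (m%:R + 'i) * (n%:R - 'i) = (n%:R + 'i) * (m%:R - 'i) :> C.
  have hm := natB_i_neq0 m; have hn := natB_i_neq0 n.
  rewrite -[m%:R + 'i](divfK hm) -/(unitc m) e /unitc; field.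
  by rewrite hn.
move=> h; have : 2 * 'i * (n%:R - m%:R) = 0 :> C.
  transitivity ((m%:R + 'i) * (n%:R - 'i) - (n%:R + 'i) * (m%:R - 'i) : C); first by ring.
  by rewrite h subrr.
move/eqP; rewrite !mulf_eq0 pnatr_eq0 (negbTE (neq0Ci _)) subr_eq0 eqr_nat.
by move/eqP.
Qed.

Variables (I : qgrp R N).

(** The functionals of the antidiagonal models with unitary diagonal blocks. *)
Definition unit_diag := forall d : 'rV[C]_N, (forall c, d 0 c * (d 0 c)^* = 1) ->
  ann I (alt (diag_mx d) (diag_mx (\row_c (d 0 c)^*))).

Hypothesis hD : unit_diag.

(** The diagonal matrix with entries z^(p_c - 1) is powmx p / z; exponents between
    0 and 2 keep the numerators polynomial, for the matrix and its conjugate. *)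
Definition powmx (p : 'I_N -> nat) : 'M[{poly C}]_N := diag_mx (\row_c 'X^(p c)).

Lemma ratmx_powmx p x : ratmx (powmx p) 'X x = diag_mx (\row_c (x ^+ p c / x)).
Proof.
apply/matrixP => i j; rewrite !mxE hornerX hornerMn hornerXn.
by case: (i == j); rewrite ?mulr1n ?mulr0n ?mul0r.
Qed.

Lemma powmx_family p n : (forall c, (p c <= 2)%N) ->
  ann I (fun w => alt (ratmx (powmx p) 'X (unitc n))
    (ratmx (powmx (fun c => 2 - p c)%N) 'X (unitc n)) w * 1).
Proof.
move=> p2; rewrite !ratmx_powmx; have z0 := unitc_neq0 n.
have zc := unitc_conj n; move: (unitc n) z0 zc => z z0 zc.
pose d : 'rV[C]_N := \row_c (z ^+ p c / z).
have dc c : (d 0 c)^* = z ^+ (2 - p c) / z.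
  rewrite mxE rmorphM fmorphV rmorphXn /= zc; have := p2 c.
  by case: (p c) => [|[|[|//]]] _ /=; rewrite ?expr0 ?expr1; field.
have -> : \row_c (z ^+ (2 - p c) / z) = \row_c (d 0 c)^*.
  by apply/rowP => c; rewrite [LHS]mxE -dc [RHS]mxE.
rewrite -/d; apply: ann_ext (hD (d := d) _) => [w|c]; first by rewrite mulr1.
rewrite dc mxE; have := p2 c.
by case: (p c) => [|[|[|//]]] _ /=; rewrite ?expr0 ?expr1; field.
Qed.

Lemma rX_unit n : ('X : {poly C}).[unitc n] != 0.
Proof. by rewrite hornerX unitc_neq0. Qed.

Lemma ann_dilation l x : x != 0 ->
  ann I (alt (dilation l x) (dilation l x^-1)).
Proof.
move=> x0; pose p c : nat := if c == l then 2 else 1.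
have p2 c : (p c <= 2)%N by rewrite /p; case: ifP.
have := ann_ratmx unitc_inj rX_unit (fun n => powmx_family n p2) (x := x).
rewrite hornerX => /(_ x0); apply: ann_ext => w; rewrite mulr1 !ratmx_powmx.
congr (alt (diag_mx _) (diag_mx _) w); apply/rowP => c; rewrite !mxE /p.
  by case: ifP => _; field.
by case: ifP => _; rewrite ?expr0 ?mul1r // expr1 divff.
Qed.

Variables (l0 l1 : 'I_N).
Hypothesis l01 : l0 != l1.

(** z at l0, its inverse at l1 and 1 elsewhere, up to the common denominator; b
    exchanges the two. *)
Definition hpow (b : bool) (c : 'I_N) : nat :=
  if c == l0 then if b then 0 else 2 else if c == l1 then if b then 2 else 0 else 1.

Lemma coef_mul_top (n : nat) (V Q : {poly C}) : (size V <= 3)%N -> (size Q <= n.+1)%N ->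
  (V * Q)`_(2 + n) = V`_2 * Q`_n.
Proof.
move=> sV sQ; rewrite coefM !big_ord_recl /= big1 ?addr0 => [|k _]; last first.
  by rewrite nth_default ?mul0r //; apply: leq_trans sV _.
rewrite /bump /= !add1n add2n subSS subn0 subSS subSS subn0.
by rewrite [Q`_n.+2]nth_default 1?leqW // [Q`_n.+1]nth_default // !mulr0 !add0r subn0.
Qed.

Lemma coef_alt_hpow b w :
  (size (alt (powmx (hpow b)) (powmx (hpow (~~ b))) w) <= (2 * size w).+1)%N /\
  (alt (powmx (hpow b)) (powmx (hpow (~~ b))) w)`_(2 * size w) =
    (w == zip (altword l0 l1 b (size w)) (altword l0 l1 b (size w)))%:R.
Proof.
elim: w b => [|[i j] w IH] b; first by rewrite /= size_poly1 coefC eqxx.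
rewrite [alt _ _ _]/=; have [sw cw] := IH (~~ b); rewrite negbK in sw cw.
move: (alt _ _ w) sw cw => Q sw cw.
have sV : (size (powmx (hpow b) i j) <= 3)%N.
  rewrite !mxE; case: (i == j); rewrite ?mulr0n ?size_poly0 // mulr1n size_polyXn.
  by rewrite /hpow; do 2 case: ifP => _; case: (b).
have cV : (powmx (hpow b) i j)`_2 = ((i, j) == (alternate l0 l1 b, alternate l0 l1 b))%:R.
  rewrite !mxE coefMn coefXn xpair_eqE /alternate /hpow; case: (i =P j) => [<-|ij].
    have [->|i0] := eqVneq i l0; first by case: (b); rewrite ?eqxx // (negbTE l01).
    by have [->|i1] := eqVneq i l1; case: (b); rewrite /= ?(negbTE i0) ?(negbTE i1) ?eqxx //
      eq_sym (negbTE l01).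
  rewrite mulr0n; case: eqP => //= ib; case: eqP => // jb.
  by case: ij; rewrite ib jb.
split.
  apply: leq_trans (size_polyMleq _ _) _; rewrite -subn1 leq_subLR.
  by apply: leq_trans (leq_add sV sw) _; rewrite /= mulnS; lia.
rewrite -[size (_ :: w)]/((size w).+1) mulnS (coef_mul_top sV sw) cV cw !altwS -natrM mulnb /=.
have -> : altword l0 l1 b.+1 (size w) = altword l0 l1 (~~ b) (size w).
  case: (b) => //; apply: eq_map => p; rewrite /alternate !addnS addn0.
  by rewrite /= negbK.
by rewrite eqseq_cons.
Qed.

(** For z at l0 and 1/z at l1, the alternating product over a diagonal word is a
    power of z, of exponent at most the length, with equality only for the
    alternating word; the functional is the coefficient of z^k. *)
Lemma ann_alternating k : exists chi, [/\ ann I chi,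
  (forall w, (size w < k)%N -> chi w = 0) &
  forall i j, size i = k -> size j = k ->
    chi (zip i j) = ((i == altword l0 l1 0 k) && (j == altword l0 l1 0 k))%:R].
Proof.
have p2 c : (hpow false c <= 2)%N.
  by rewrite /hpow; case: (c == l0) => //; case: (c == l1).
have e : powmx (fun c => 2 - hpow false c)%N = powmx (hpow true).
  congr diag_mx; apply/rowP => c; rewrite !mxE /hpow.
  by case: (c == l0) => //; case: (c == l1).
have h := ann_rat_coef unitc_inj rX_unit (fun n => powmx_family n p2) k erefl.
eexists; split; first exact: h.
- move=> w sw /=; rewrite e nth_default ?mul0r //.
  by apply: leq_trans (coef_alt_hpow false w).1 _; lia.
move=> i j si sj /=; have := (coef_alt_hpow false (zip i j)).2.
rewrite size_zip si sj minnn e mulr1 mul2n -addnn => ->; congr (nat_of_bool _)%:R.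
apply/eqP/andP => [ez|[/eqP -> /eqP ->]] //.
have := congr1 (fun w => (unzip1 w, unzip2 w)) ez.
by rewrite /= !unzip1_zip ?unzip2_zip ?size_altw ?si ?sj // => -[-> ->].
Qed.

End Diagonal.

(** * Functionals of the linear group *)

Section LinearGroupFunctionals.
Variables (R : realType) (N : nat).
Local Notation C := R[i].
Local Notation letter := ('I_N * 'I_N)%type.
Local Notation poly := (ncpoly R N).
Variables (I : qgrp R N) (hI : closed_qsubgroup I).
Variables (m : nat) (gam : 'I_N -> 'M[C]_m.+1).
Hypothesis gam_orth : forall c, gam c *m (gam c)^T = 1.
Hypothesis hD : unit_diag I.
Hypothesis hG : has_rotations I gam.
Hypothesis h1 : forall p q p' q', ann I (phi gam (@wcounit R N) p q p' q').

(** The matrix y is the inverse transpose of v; it is quantified to avoid inverting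
    products. *)
Definition reached (v : 'M[C]_N) := exists2 y : 'M[C]_N, v *m y^T = 1%:M &
  forall p q p' q', ann I (phi gam (alt v y) p q p' q').

Lemma alt_one (w : seq letter) : alt 1%:M 1%:M w = wcounit R w.
Proof.
elim: w => [|a w IH]; first by rewrite /wcounit big_nil.
by rewrite /= IH mxE [RHS]/wcounit big_cons.
Qed.

Lemma reached1 : reached 1%:M.
Proof.
exists 1%:M; first by rewrite trmx1 mulmx1.
by move=> p q p' q'; apply: ann_ext (h1 p q p' q') => w; rewrite /phi alt_one.
Qed.

Lemma reachedM v w : reached v -> reached w -> reached (v *m w).
Proof.
move=> [y vy hv] [z wz hw]; exists (y *m z).
  by rewrite trmx_mul mulmxA -[v *m w *m _]mulmxA wz mulmx1.
move=> p q p' q'; apply: ann_ext (ann_phi_convol gam_orth hI hv hw p q p' q') => x.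
by rewrite /phi convol_alt.
Qed.

Lemma reached_dilation l x : x != 0 -> reached (dilation l x).
Proof.
move=> x0; exists (dilation l x^-1).
  rewrite /dilation tr_diag_mx mulmx_diag; apply/matrixP => i j; rewrite !mxE.
  by case: ifP => _; rewrite ?mulr1 // mulfV.
move=> p q p' q'.
apply: ann_ext (ann_convol hI (ann_dilation hD l x0) (h1 p q p' q')) => w.
set f := alt _ _.
have [i [j [-> sij]]] : exists i j, w = zip i j /\ size i = size j.
  by exists (unzip1 w), (unzip2 w); rewrite zip_unzip !size_map.
rewrite convol_tsum // /phi unzip1_zip ?unzip2_zip ?sij //.
transitivity (tsum (size j) (fun k => (k == j)%:R *
    (f (zip i k) * (gw gam k p q * gw gam j p' q')))).
  apply: eq_tsum => k sk; rewrite wcounit_zip // unzip1_zip ?sk // unzip2_zip ?sk //.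
  ring.
transitivity (f (zip i j) * (gw gam j p q * gw gam j p' q')).
  rewrite -[LHS]/(\sum_(t : (size j).-tuple 'I_N) ((t : seq 'I_N) == j)%:R *:
    (f (zip i t) * (gw gam t p q * gw gam j p' q') : C^o)).
  by rewrite (sum_word _ (fun k => (f (zip i k) * (gw gam k p q * gw gam j p' q') : C^o))) eqxx.
rewrite /f /dilation alt_diag wcounit_zip //.
by have [->|_] := eqVneq i j; rewrite ?mulr0 ?mul0r.
Qed.

Lemma reached_rotation a b (c s : C) : a != b ->
  c ^+ 2 + s ^+ 2 = 1 -> c != -1 -> reached (plane a b c s (- s) c).
Proof.
move=> ab cs c1; exists (plane a b c s (- s) c).
  rewrite plane_tr // plane_mul // -(plane1 _ ab).
  by congr plane; rewrite -?cs; ring.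
by move=> p q p' q'; exact: ann_phi_plane.
Qed.

Lemma plane_dilation (a b : 'I_N) (x : C) : a != b -> plane a b x 0 0 1 = dilation a x.
Proof.
move=> ab; apply/matrixP => i j; rewrite !mxE.
case ia: (i == a); case ib: (i == b); case ja: (j == a); case jb: (j == b) => //=;
  rewrite ?mulr1n ?mulr0n //;
  by [rewrite (eqP ia) eq_sym ja | rewrite (eqP ib) eq_sym jb
     | rewrite (eqP ia) (eqP ja) eqxx | rewrite (eqP ib) (eqP jb) eqxx
     | move: ab; rewrite -(eqP ja) -(eqP jb) eqxx | move: ab; rewrite -(eqP ia) -(eqP ib) eqxx].
Qed.

Lemma plane_dilation' (a b : 'I_N) (x : C) : a != b -> plane a b 1 0 0 x = dilation b x.
Proof.
move=> ab; apply/matrixP => i j; rewrite !mxE.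
case ia: (i == a); case ib: (i == b); case ja: (j == a); case jb: (j == b) => //=;
  rewrite ?mulr1n ?mulr0n //;
  by [rewrite (eqP ia) eq_sym ja | rewrite (eqP ib) eq_sym jb
     | rewrite (eqP ia) (eqP ja) eqxx | rewrite (eqP ib) (eqP jb) eqxx
     | move: ab; rewrite -(eqP ja) -(eqP jb) eqxx | move: ab; rewrite -(eqP ia) -(eqP ib) eqxx].
Qed.

Lemma plane_transvection (a b : 'I_N) (t : C) : a != b ->
  plane a b 1 t 0 1 = 1%:M + t *: delta_mx a b.
Proof.
move=> ab; apply/matrixP => i j; rewrite !mxE.
case ia: (i == a); case ib: (i == b); case ja: (j == a); case jb: (j == b) => //=;
  rewrite ?mulr1n ?mulr0n ?mulr1 ?mulr0 ?addr0 //;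
  by [rewrite (eqP ia) eq_sym ja | rewrite (eqP ib) eq_sym jb
     | rewrite (eqP ia) eq_sym ja add0r
     | rewrite (eqP ia) (eqP ja) eqxx | rewrite (eqP ib) (eqP jb) eqxx
     | move: ab; rewrite -(eqP ja) -(eqP jb) eqxx | move: ab; rewrite -(eqP ia) -(eqP ib) eqxx].
Qed.

(** In the plane of a and b, for m = 2 and r^2 = 1 + m^2, the product of the complex
    rotation of cosine m/r and sine -1/r, of diag(m, 1/m) and of the rotation of
    cosine 1/r and sine m/r is the transvection of parameter m - 1/m = 3/2.  The
    other parameters are obtained by conjugation with a dilation. *)
Lemma reached_transvection (a b : 'I_N) (t : C) : a != b ->
  reached (1%:M + t *: delta_mx a b).
Proof.
move=> ab; have [->|t0] := eqVneq t 0; first by rewrite scale0r addr0; exact: reached1.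
pose r : C := sqrtC 5.
have r2 : r ^+ 2 = 5 by exact: sqrtCK.
have r0 : r != 0 by rewrite sqrtC_eq0 pnatr_eq0.
have two0 : 2 != 0 :> C by rewrite pnatr_eq0.
have rot c s : c ^+ 2 + s ^+ 2 = 5 -> s != 0 ->
    reached (plane a b (c / r) (s / r) (- (s / r)) (c / r)).
  move=> cs s0; have e : (c / r) ^+ 2 + (s / r) ^+ 2 = 1.
    by rewrite !expr_div_n -mulrDl cs r2 divff // pnatr_eq0.
  apply: reached_rotation => //; apply: contra_neq s0 => cr.
  move: e; rewrite cr sqrrN expr1n => /(canRL (addKr _)); rewrite addNr => /eqP.
  by rewrite sqrf_eq0 mulf_eq0 invr_eq0 (negbTE r0) orbF => /eqP.
have e : 1%:M + t *: delta_mx a b =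
    dilation a (t / (3 / 2)) *m (plane a b (2 / r) (- 1 / r) (- (- 1 / r)) (2 / r) *m
     (dilation a 2 *m (dilation b 2^-1 *m (plane a b (1 / r) (2 / r) (- (2 / r)) (1 / r) *m
       dilation a (t / (3 / 2))^-1)))).
  rewrite -plane_transvection // -!(plane_dilation _ ab) -(plane_dilation' _ ab).
  rewrite !plane_mul //.
  have r2' : r * r = 5 by rewrite -expr2.
  by congr plane; field: r2'; rewrite ?t0 ?r0.
rewrite e; apply: reachedM; first by apply: reached_dilation; rewrite !mulf_neq0 ?invr_eq0 ?mulf_neq0 ?invr_eq0 ?pnatr_eq0.
apply: reachedM; first by apply: rot; rewrite ?oppr_eq0 ?oner_eq0 //; ring.
apply: reachedM; first exact: reached_dilation.
apply: reachedM; first by apply: reached_dilation; rewrite invr_eq0.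
apply: reachedM; first by apply: rot => //; ring.
by apply: reached_dilation; rewrite invr_eq0 !mulf_neq0 ?invr_eq0 ?mulf_neq0 ?invr_eq0 ?pnatr_eq0.
Qed.

Theorem ann_GL (v : 'M[C]_N) p q p' q' : v \in unitmx ->
  ann I (phi gam (alt v (invmx v)^T) p q p' q').
Proof.
move=> uv; have [y vy h] : reached v.
  apply: S_unitmx uv; [exact: reached1 | exact: reachedM | |].
    exact: reached_dilation.
  by move=> a b t; exact: reached_transvection.
have -> : (invmx v)^T = y; last exact: h.
by apply: trmx_inj; rewrite trmxK -[LHS]mulmx1 -vy mulKmx.
Qed.

End LinearGroupFunctionals.

(** * Polynomial identities *)

Section PolynomialIdentities.
Import mpoly.
Variables (C : numDomainType).

Lemma digits_inj B n (f g : nat -> nat) :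
  (forall i, (f i < B)%N) -> (forall i, (g i < B)%N) ->
  (\sum_(i < n) f i * B ^ i)%N = (\sum_(i < n) g i * B ^ i)%N ->
  forall i, (i < n)%N -> f i = g i.
Proof.
move=> hf hg; elim: n f g hf hg => // n IH f g hf hg.
have B0 : (0 < B)%N by apply: leq_ltn_trans (hf 0%N).
have rec (k : nat -> nat) : (\sum_(i < n.+1) k i * B ^ i)%N =
    ((\sum_(i < n) k i.+1 * B ^ i) * B + k 0)%N.
  rewrite big_ord_recl expn0 muln1 addnC; congr (_ + _)%N.
  by rewrite big_distrl /=; apply: eq_bigr => i _; rewrite /bump /= add1n expnSr mulnA.
rewrite !rec => e.
have e0 : f 0%N = g 0%N.
  by have := congr1 (modn^~ B) e; rewrite !modnMDl !modn_small.
have e1 : (\sum_(i < n) f i.+1 * B ^ i = \sum_(i < n) g i.+1 * B ^ i)%N.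
  by move/eqP: e; rewrite e0 eqn_add2r eqn_pmul2r // => /eqP.
case=> // i; rewrite ltnS.
by apply: (IH (fun i => f i.+1) (fun i => g i.+1)) e1 i => j; [exact: hf | exact: hg].
Qed.

(** Substitute x_i = t^(B^i) with B larger than all the exponents: distinct monomials
    keep distinct degrees. *)
Lemma mpoly_eq0 n (p : mpoly n C) : (forall v, p.@[v] = 0) -> p = 0.
Proof.
move=> h; pose B := (\max_(m <- msupp p) \max_(i < n) m i).+1.
have mB m i : m \in msupp p -> (m i < B)%N.
  move=> mp; rewrite ltnS; apply: (@leq_trans (\max_(j < n) m j)).
    exact: (leq_bigmax i).
  exact: (@leq_bigmax_seq _ _ xpredT (fun k : (multinom n) => \max_(j < n) k j)%N).
pose e (m : (multinom n)) := (\sum_(i < n) m i * B ^ i)%N.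
have e_inj m m' : m \in msupp p -> m' \in msupp p -> e m = e m' -> m = m'.
  move=> mp mp' em; apply/mnmP => i.
  pose f (m : (multinom n)) (i : nat) := oapp (fun i : 'I_n => m i) 0%N (insub i).
  have fE (k : (multinom n)) (j : 'I_n) : f k j = k j by rewrite /f valK.
  have fB k j : k \in msupp p -> (f k j < B)%N.
    by move=> kp; rewrite /f; case: insubP => //= u _ _; exact: mB.
  rewrite -!fE; apply: (@digits_inj B n (f m) (f m')) => //; try by move=> j; exact: fB.
  transitivity (e m); first by apply: eq_bigr => j _; rewrite fE.
  by rewrite em; apply: eq_bigr => j _; rewrite fE.
pose q : {poly C} := \sum_(m <- msupp p) p@_m *: 'X^(e m).
have q0 : q = 0.
  have nat_inj : injective (fun k : nat => k%:R : C) by move=> a b /eqP; rewrite eqr_nat => /eqP.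
  apply/eqP; apply: contraT => qn0.
  have := @max_poly_roots _ q [seq k%:R | k <- iota 0 (size q)] qn0.
  rewrite size_map size_iota ltnn map_inj_uniq // iota_uniq => -> //.
  apply/allP => x /mapP[k _ ->]; apply/rootP.
  rewrite -(h (fun i => k%:R ^+ (B ^ i))) mevalE horner_sum; apply: eq_bigr => m _.
  rewrite hornerZ hornerXn /e; congr (_ * _); rewrite expr_sum; apply: eq_bigr => i _.
  by rewrite -exprM mulnC.
apply/mpolyP => m; rewrite mcoeff0; have [mp|/memN_msupp_eq0 //] := boolP (m \in msupp p).
have := congr1 (fun r : {poly C} => r`_(e m)) q0.
rewrite coef_sum coef0 (bigD1_seq m) //= ?msupp_uniq // big1_seq ?addr0.
  by rewrite coefZ coefXn eqxx mulr1.
move=> m' /andP[mm' m'p]; rewrite coefZ coefXn; case: eqP => [ee|_]; last by rewrite mulr0.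
by rewrite (e_inj _ _ mp m'p ee) eqxx in mm'.
Qed.

End PolynomialIdentities.

Section CommutativeTransfer.
Import mpoly.
Variables (R : realType) (N : nat).
Local Notation C := R[i].
Local Notation letter := ('I_N * 'I_N)%type.
Local Notation family := (seq (C * seq letter)).

Lemma alt_morph (S T : nzRingType) (h : {rmorphism S -> T}) (v y : 'M[S]_N) w :
  h (alt v y w) = alt (map_mx h v) (map_mx h y) w.
Proof.
elim: w v y => [|a w IH] v y /=; first exact: rmorph1.
by rewrite rmorphM IH mxE.
Qed.

Lemma alt_scale (S : comNzRingType) (v y : 'M[S]_N) (a b : S) w : ~~ odd (size w) ->
  alt (a *: v) (b *: y) w = (a * b) ^+ (size w)./2 * alt v y w.
Proof.
have [n] := ubnP (size w); elim: n w => // n IH [|x [|x' w]] //=.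
  by move=> _ _; rewrite expr0 mul1r.
rewrite ltnS negbK => sw ew; rewrite IH ?(ltnW sw) // !mxE exprS; ring.
Qed.

(** For v invertible, det(v)^(d+1) times the value of the family at (v, v^-T); with
    the adjugate instead of the inverse it is a polynomial in v, defined over
    every commutative ring. *)
Definition altdet (S : comNzRingType) (j : C -> S) d (v : 'M[S]_N) (P : family) : S :=
  \det v * \sum_(cw <- P) j cw.1 *
    (\det v ^+ (d - (size cw.2)./2) * alt v (\adj v)^T cw.2).

Lemma altdet_morph (S T : comNzRingType) (h : {rmorphism S -> T}) j d v P :
  h (altdet j d v P) = altdet (h \o j) d (map_mx h v) P.
Proof.
rewrite /altdet rmorphM det_map_mx; congr (_ * _); rewrite [LHS]rmorph_sum.
apply: eq_bigr => cw _; rewrite !rmorphM rmorphXn alt_morph.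
by rewrite -map_trmx map_mx_adj.
Qed.

Variables (P : family) (d : nat).
Hypothesis Peven : forall cw, cw \in P -> ~~ odd (size cw.2).
Hypothesis Psize : forall cw, cw \in P -> ((size cw.2)./2 <= d)%N.
Hypothesis PGL : forall v : 'M[C]_N, v \in unitmx ->
  \sum_(cw <- P) cw.1 * alt v (invmx v)^T cw.2 = 0.

Lemma altdet_C (v : 'M[C]_N) : altdet id d v P = 0.
Proof.
rewrite /altdet; have [->|D0] := eqVneq (\det v) 0; first by rewrite mul0r.
have uv : v \in unitmx by rewrite unitmxE unitfE.
have e := congr1 ( *%R (\det v * \det v ^+ d)) (PGL uv); rewrite mulr0 in e.
apply: etrans e; rewrite -mulrA; congr (_ * _); rewrite mulr_sumr big_seq [RHS]big_seq; apply: eq_bigr => cw cwP.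
rewrite [RHS]mulrCA; congr (_ * _).
have -> : (\adj v)^T = \det v *: (invmx v)^T.
  by rewrite /invmx uv linearZ /= scalerA divff // scale1r.
rewrite -[v in alt v _ _]scale1r alt_scale ?Peven // mul1r mulrA -exprD subnK //.
exact: Psize.
Qed.

(** It vanishes at the generic matrix, hence at all matrices. *)
Lemma altdet_any (S : comNzRingType) (j : {rmorphism C -> S}) (x : 'M[S]_N) :
  altdet j d x P = 0.
Proof.
pose n := (N * N)%N.
pose X : 'M[mpoly n C]_N := \matrix_(a, b) mpolyX C (mnm1 (mxvec_index a b)).
have X0 : altdet (@mpolyC n C) d X P = 0.
  apply: mpoly_eq0 => v; rewrite altdet_morph -[RHS](altdet_C (map_mx (meval v) X)).
  by rewrite /altdet; congr (_ * _); apply: eq_bigr => cw _; rewrite /= mevalC.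
pose h (k : 'I_n) : S := mxvec x 0 k.
have := congr1 (mmap j h) X0; rewrite altdet_morph rmorph0.
have -> : map_mx (mmap j h) X = x.
  by apply/matrixP => a b; rewrite !mxE mmapX mmap1U /h mxvecE.
move=> e; apply: etrans e; rewrite /altdet; congr (_ * _); apply: eq_bigr => cw _.
by rewrite /= mmapC.
Qed.

(** If x y^T = e then det(x) y = e adj(x)^T, which turns the polynomial identity into
    one for (x, y) multiplied by a power of det(x); the power of det(x) is
    removed by det(x) det(y) = e^N. *)
Lemma commutative_transfer (S : comNzRingType) (j : {rmorphism C -> S}) (x y : 'M[S]_N) e :
  x *m y^T = e%:M ->
  e ^+ (N * d.+1) * (\sum_(cw <- P) j cw.1 * (e ^+ (d - (size cw.2)./2) * alt x y cw.2)) = 0.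
Proof.
move=> xy; have adj : \det x *: y = e *: (\adj x)^T.
  apply: trmx_inj; rewrite !linearZ /= trmxK -[RHS]mul_mx_scalar -xy mulmxA mul_adj_mx.
  by rewrite mul_scalar_mx.
have dxy : \det x * \det y = e ^+ N by rewrite -(det_tr y) -det_mulmx xy det_scalar.
have key : \det x ^+ d.+1 * (\sum_(cw <- P) j cw.1 *
    (e ^+ (d - (size cw.2)./2) * alt x y cw.2)) = 0.
  have e0 := congr1 ( *%R (e ^+ d)) (altdet_any j x); rewrite mulr0 in e0.
  apply: etrans e0; rewrite /altdet exprSr -mulrA.
  rewrite [LHS]mulrCA [RHS]mulrCA; congr (_ * _); rewrite !mulr_sumr.
  rewrite big_seq [RHS]big_seq; apply: eq_bigr => cw cwP.
  rewrite [LHS]mulrCA [RHS]mulrCA; congr (_ * _).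
  have sw := Psize cwP; set k := (size cw.2)./2 in sw *.
  have E := alt_scale x y 1 (\det x) (Peven cwP).
  have E' := alt_scale x (\adj x)^T 1 e (Peven cwP).
  rewrite scale1r mul1r -/k in E; rewrite scale1r mul1r -/k in E'.
  rewrite -(subnK sw) addnK !exprD.
  transitivity (\det x ^+ (d - k) * e ^+ (d - k) * (\det x ^+ k * alt x y cw.2)); first by ring.
  by rewrite -E adj E'; ring.
by rewrite exprM -dxy exprMn mulrAC key mul0r.
Qed.

End CommutativeTransfer.

(** * Half-commuting matrices *)

Section Bicommutant.
Variables (A : nzRingType) (G : A -> Prop).
Hypothesis Gcomm : forall a b, G a -> G b -> a * b = b * a.

Definition commutant (a : A) : Prop := forall g, G g -> a * g = g * a.

Definition bicommutant : pred A :=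
  [pred a | `[< forall b, commutant b -> a * b = b * a >]].

Lemma bicommutantP a :
  reflect (forall b, commutant b -> a * b = b * a) (a \in bicommutant).
Proof. exact: asboolP. Qed.

Lemma bicommutant_closed : subring_closed bicommutant.
Proof.
split=> [|a b /bicommutantP ha /bicommutantP hb|a b /bicommutantP ha /bicommutantP hb].
- by apply/bicommutantP => b _; rewrite mul1r mulr1.
- by apply/bicommutantP => c hc; rewrite mulrBl mulrBr ha ?hb.
by apply/bicommutantP => c hc; rewrite -mulrA hb // mulrA ha // mulrA.
Qed.

HB.instance Definition _ := GRing.isSubringClosed.Build A bicommutant
  bicommutant_closed.

Lemma bicommutant_gen a : G a -> a \in bicommutant.
Proof. by move=> ga; apply/bicommutantP => b hb; rewrite hb. Qed.

Lemma bicommutant_central a : (forall b, a * b = b * a) -> a \in bicommutant.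
Proof. by move=> h; apply/bicommutantP => b _. Qed.

(** The elements commuting with everything that commutes with G form a
    commutative ring containing G. *)
Record bicomm : predArgType := Bicomm { bicomm_val :> A; _ : bicomm_val \in bicommutant }.

HB.instance Definition _ := [isSub for bicomm_val].
HB.instance Definition _ := [Choice of bicomm by <:].
HB.instance Definition _ := [SubChoice_isSubNzRing of bicomm by <:].

Lemma bicomm_mulC : commutative (@GRing.mul bicomm).
Proof.
move=> [a ha] [b hb]; apply: val_inj; rewrite !rmorphM /=.
apply: (bicommutantP _ ha) => g Gg; apply: (bicommutantP _ hb) => g' Gg'.
exact: Gcomm.
Qed.
End Bicommutant.

Section CommutativeBicommutant.
Variables (A : nzRingType) (G : A -> Prop).

Definition commuting := forall a b, G a -> G b -> a * b = b * a.

(** The same ring, with the hypothesis in the type, so that commutativity is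
    inferred. *)
Definition cbicomm (h : commuting) : Type := bicomm G.

Variable h : commuting.
HB.instance Definition _ := GRing.NzRing.on (cbicomm h).
HB.instance Definition _ := GRing.PzSemiRing_hasCommutativeMul.Build (cbicomm h)
  (bicomm_mulC h).

Definition cval (a : cbicomm h) : A := bicomm_val a.
Lemma cval_inj : injective cval. Proof. exact: val_inj. Qed.
Lemma cval_is_zmod_morphism : zmod_morphism cval.
Proof. by move=> a b; exact: (rmorphB (val : bicomm G -> A)). Qed.
Lemma cval_is_monoid_morphism : monoid_morphism cval.
Proof.
by split; [exact: (rmorph1 (val : bicomm G -> A)) | exact: (rmorphM (val : bicomm G -> A))].
Qed.
HB.instance Definition _ :=
  GRing.isZmodMorphism.Build (cbicomm h) A cval cval_is_zmod_morphism.
HB.instance Definition _ :=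
  GRing.isMonoidMorphism.Build (cbicomm h) A cval cval_is_monoid_morphism.

Variables (C : nzRingType) (j : {rmorphism C -> A}).
Hypothesis jC : forall c a, j c * a = a * j c.

Definition scalar_in (c : C) : cbicomm h := Bicomm (bicommutant_central G (jC c)).

Lemma scalar_in_zmod_morphism : zmod_morphism scalar_in.
Proof. by move=> a b; apply: cval_inj; rewrite rmorphB /=; exact: rmorphB. Qed.
Lemma scalar_in_monoid_morphism : monoid_morphism scalar_in.
Proof.
split; first by apply: cval_inj; rewrite rmorph1; exact: rmorph1.
by move=> a b; apply: cval_inj; rewrite rmorphM /=; exact: rmorphM.
Qed.
HB.instance Definition _ :=
  GRing.isZmodMorphism.Build C (cbicomm h) scalar_in scalar_in_zmod_morphism.
HB.instance Definition _ :=
  GRing.isMonoidMorphism.Build C (cbicomm h) scalar_in scalar_in_monoid_morphism.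

End CommutativeBicommutant.
Arguments cval : simpl never.

Section Nilpotency.
Variable A : nzRingType.

(** Partitions of unity detect zero: used with the squares of the entries of a row,
    whose sum is 1. *)
Lemma sum_nilpotent (I : eqType) (r : seq I) (e : I -> A) (z : A) (M : I -> nat) :
  (forall i k, e i * e k = e k * e i) -> (forall i, e i ^+ M i * z = 0) ->
  exists n, (\sum_(i <- r) e i) ^+ n * z = 0.
Proof.
move=> ce hM; elim: r => [|i r [n IH]].
  by exists 1%N; rewrite big_nil expr1 mul0r.
exists (M i + n)%N; rewrite big_cons.
have cS : GRing.comm (e i) (\sum_(k <- r) e k).
  by rewrite /GRing.comm mulr_sumr mulr_suml; apply: eq_bigr => k _.
rewrite exprDn_comm // mulr_suml big1 // => k _; rewrite mulrnAl.
have [nk|kn] := leqP n k.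
  by rewrite -(subnK nk) exprD -!mulrA IH !mulr0 mul0rn.
have -> : (M i + n - k = (n - k) + M i)%N by lia.
rewrite [e i ^+ _ * _](commrX _ (commr_sym (commrX _ (commr_sym cS)))).
by rewrite exprD -!mulrA hM !mulr0 mul0rn.
Qed.

End Nilpotency.

Section HalfCommutation.
Variables (R : realType) (N : nat).
Local Notation C := R[i].
Local Notation letter := ('I_N * 'I_N)%type.
Local Notation family := (seq (C * seq letter)).
Variables (A : nzRingType) (u : 'M[A]_N) (j : {rmorphism C -> A}).
Hypothesis jC : forall c a, j c * a = a * j c.
Hypothesis half : forall i1 j1 i2 j2 i3 j3,
  u i1 j1 * u i2 j2 * u i3 j3 = u i3 j3 * u i2 j2 * u i1 j1.
Hypothesis orth : forall i k,
  \sum_l u i l * u k l = (i == k)%:R /\ \sum_l u l i * u l k = (i == k)%:R.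

Definition vanishes_on_GL (P : family) := forall v : 'M[C]_N, v \in unitmx ->
  \sum_(cw <- P) cw.1 * alt v (invmx v)^T cw.2 = 0.

Section Entry.
Variables (r l : 'I_N).
Local Notation z := (u r l).

Lemma sqr_central i k : z * z * u i k = u i k * (z * z).
Proof. by rewrite half mulrA. Qed.

Definition products (a : A) : Prop :=
  (exists i k, a = u i k * z) \/ (exists i k, a = z * u i k) \/ a = z * z.

(** Consequences of a b c = c b a: pairs of entries with z inside or outside can be
    exchanged. *)
Lemma products_commute : commuting products.
Proof.
have h1 i k i' k' : u i k * z * (u i' k' * z) = u i' k' * z * (u i k * z).
  by rewrite !mulrA half.
have h2 i k i' k' : z * u i k * (z * u i' k') = z * u i' k' * (z * u i k).
  by rewrite -!mulrA; congr (_ * _); rewrite !mulrA half.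
have h3 i k i' k' : u i k * z * (z * u i' k') = z * u i' k' * (u i k * z).
  rewrite mulrA -[u i k * z * z]mulrA -sqr_central -!mulrA; congr (_ * _).
  by rewrite !mulrA half.
have e1 i k : z * z * (u i k * z) = u i k * z * (z * z).
  by rewrite mulrA sqr_central !mulrA.
have e2 i k : z * z * (z * u i k) = z * u i k * (z * z).
  by rewrite mulrA -[z * u i k * _]mulrA -sqr_central !mulrA.
by move=> a b [[i [k ->]]|[[i [k ->]]|->]] [[i' [k' ->]]|[[i' [k' ->]]|->]].
Qed.

Local Notation B := (cbicomm products_commute).
Definition lprod : 'M[B]_N := \matrix_(i, k)
  (Bicomm (bicommutant_gen (or_introl (ex_intro _ i (ex_intro _ k erefl))
    : products (u i k * z))) : B).
Definition rprod : 'M[B]_N := \matrix_(i, k)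
  (Bicomm (bicommutant_gen (or_intror (or_introl (ex_intro _ i (ex_intro _ k erefl)))
    : products (z * u i k))) : B).
Definition sprod : B := Bicomm (bicommutant_gen (or_intror (or_intror erefl)
    : products (z * z))).

Lemma lprod_rprod : lprod *m rprod^T = sprod%:M.
Proof.
apply/matrixP => i k; apply: cval_inj; rewrite !mxE rmorph_sum rmorphMn /=.
transitivity (z * z * \sum_c u i c * u k c).
  rewrite mulr_sumr; apply: eq_bigr => c _; rewrite !mxE rmorphM /cval /=.
  by rewrite [LHS]mulrA -[u i c * z * z]mulrA -sqr_central [RHS]mulrA.
by rewrite (orth i k).1 mulr_natr.
Qed.

Lemma alt_products w : ~~ odd (size w) ->
  alt (map_mx (@cval _ _ products_commute) lprod) (map_mx (@cval _ _ products_commute) rprod) w =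
  (z * z) ^+ (size w)./2 * wval u w.
Proof.
have [n] := ubnP (size w); elim: n w => // n IH [|a [|b w]] //=.
  by move=> _ _; rewrite wval_nil expr0 mulr1.
rewrite ltnS negbK => sw ew; rewrite (IH w) ?(ltnW sw) // !wval_cons !mxE /cval /=.
have cw (m : nat) i k : u i k * (z * z) ^+ m = (z * z) ^+ m * u i k.
  by apply: commrX; rewrite /GRing.comm sqr_central.
rewrite exprS !mulrA -[u a.1 a.2 * z * z]mulrA -sqr_central.
by rewrite -[_ * u b.1 b.2 * _]mulrA cw mulrA -[_ * u a.1 a.2 * _]mulrA cw !mulrA.
Qed.

(** For even words, z^2 to the half length times the word is the alternating product
    of the commuting elements u_ij z and z u_ij. *)
Lemma entry_kills (P : family) : (forall cw, cw \in P -> ~~ odd (size cw.2)) ->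
  vanishes_on_GL P ->
  exists M, (z * z) ^+ M * (\sum_(cw <- P) j cw.1 * wval u cw.2) = 0.
Proof.
move=> Peven PGL; pose d := \max_(cw <- P) (size cw.2)./2.
have Psize cw : cw \in P -> ((size cw.2)./2 <= d)%N.
  by move=> cwP; apply: (@leq_bigmax_seq _ _ xpredT (fun cw : C * seq letter => (size cw.2)./2)).
exists (N * d.+1 + d)%N.
have := commutative_transfer Peven Psize PGL (scalar_in products_commute jC) lprod_rprod.
move/(congr1 (@cval _ _ products_commute)); rewrite rmorph0 rmorphM rmorphXn rmorph_sum.
rewrite /= [cval sprod]/(z * z) => e; apply: etrans e; rewrite exprD -mulrA; congr (_ * _).
rewrite mulr_sumr big_seq [RHS]big_seq; apply: eq_bigr => cw cwP.
rewrite !rmorphM rmorphXn /= alt_morph alt_products ?Peven //.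
rewrite [cval sprod]/(z * z) [cval (scalar_in _ _ _)]/(j cw.1) mulrA -jC -mulrA.
by congr (_ * _); rewrite [RHS]mulrA -exprD subnK ?Psize.
Qed.

End Entry.

Lemma half_even (P : family) : (0 < N)%N ->
  (forall cw, cw \in P -> ~~ odd (size cw.2)) -> vanishes_on_GL P ->
  \sum_(cw <- P) j cw.1 * wval u cw.2 = 0.
Proof.
move=> N0 Peven PGL; set S := \sum_(_ <- _) _; pose r := Ordinal N0.
have hM l := entry_kills r l Peven PGL.
have [M hMM] := choice hM.
have [||n] := @sum_nilpotent A _ (index_enum 'I_N) (fun l => u r l * u r l) S M.
- by move=> l k; rewrite mulrA sqr_central -mulrA sqr_central mulrA.
- exact: hMM.
by rewrite (orth r r).1 eqxx expr1n mul1r.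
Qed.

(** The substitution v -> 2 v separates the even and the odd words; odd words are
    made even by multiplication by a letter, which is harmless as the squares of
    a row of letters have sum 1. *)
Theorem half_commuting_transfer (P : family) : (0 < N)%N -> vanishes_on_GL P ->
  \sum_(cw <- P) j cw.1 * wval u cw.2 = 0.
Proof.
move=> N0 PGL.
pose ev := [seq cw <- P | ~~ odd (size cw.2)].
pose od := [seq cw <- P | odd (size cw.2)].
have split_sum (V : zmodType) (F : C * seq letter -> V) :
    \sum_(cw <- P) F cw = \sum_(cw <- ev) F cw + \sum_(cw <- od) F cw.
  by rewrite !big_filter (bigID (fun cw => ~~ odd (size cw.2))) /=; congr (_ + _);
    apply: eq_bigl => cw; rewrite negbK.
have hom (v y : 'M[C]_N) (w : seq letter) :
    alt (2 *: v) (2^-1 *: y) w = (if odd (size w) then 2 else 1) * alt v y w.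
  have two : 2 * 2^-1 = 1 :> C by rewrite divff // pnatr_eq0.
  case: ifP => [|/negbT ow]; last by rewrite alt_scale // two expr1n.
  case: w => [|a w] //= ow; rewrite mxE alt_scale // mulrC [2^-1 * 2]mulrC two expr1n mul1r.
  by rewrite mulrC mulrA.
have [GLev GLod] : vanishes_on_GL ev /\ vanishes_on_GL od.
  suff h v : v \in unitmx -> \sum_(cw <- ev) cw.1 * alt v (invmx v)^T cw.2 = 0 /\
      \sum_(cw <- od) cw.1 * alt v (invmx v)^T cw.2 = 0.
    by split=> v /h[].
  move=> uv; have e1 := PGL v uv; rewrite split_sum in e1.
  have u2 : 2 *: v \in unitmx by rewrite unitmxZ // unitfE pnatr_eq0.
  have := PGL _ u2; rewrite split_sum invmxZ // linearZ /=.
  have -> : \sum_(cw <- ev) cw.1 * alt (2 *: v) (2^-1 *: (invmx v)^T) cw.2 =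
      \sum_(cw <- ev) cw.1 * alt v (invmx v)^T cw.2.
    rewrite !big_filter; apply: eq_bigr => cw /negbTE ow; rewrite hom ow mul1r //.
  have -> : \sum_(cw <- od) cw.1 * alt (2 *: v) (2^-1 *: (invmx v)^T) cw.2 =
      2 * \sum_(cw <- od) cw.1 * alt v (invmx v)^T cw.2.
    by rewrite !big_filter mulr_sumr; apply: eq_bigr => cw ow; rewrite hom ow mulrCA.
  move: (\sum_(cw <- ev) _) (\sum_(cw <- od) _) e1 => a b e1 e2.
  have b0 : b = 0 by transitivity (a + 2 * b - (a + b)); [ring | rewrite e1 e2 subrr].
  by move: e1; rewrite b0 addr0.
rewrite split_sum half_even ?add0r => // [|cw]; last first.
  by rewrite mem_filter => /andP[].
set S := \sum_(_ <- _) _.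
have hS i k : S * u i k = 0.
  pose Q := [seq (cw.1, cw.2 ++ [:: (i, k)]) | cw <- od].
  have := half_even (P := Q) N0 _ _; rewrite big_map => h.
  rewrite -[RHS]h.
  - rewrite mulr_suml; apply: eq_bigr => cw _.
    by rewrite -mulrA wval_cat wval_cons wval_nil mulr1.
  - move=> cw /mapP[cw' + ->] /=; rewrite mem_filter => /andP[ow _].
    by rewrite size_cat addn1 /= negbK.
  move=> v uv; rewrite big_map.
  have E (w : seq letter) (y : 'M[C]_N) : odd (size w) ->
      alt v y (w ++ [:: (i, k)]) = alt v y w * y i k.
    have gen (w' : seq letter) (v' y' : 'M[C]_N) : alt v' y' (w' ++ [:: (i, k)]) =
        alt v' y' w' * (if odd (size w') then y' i k else v' i k).
      elim: w' v' y' => [|a w' IH] v' y' /=; first by rewrite mul1r mulr1.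
      by rewrite IH mulrA if_neg.
    by move=> ow; rewrite gen ow.
  transitivity (\sum_(cw <- od) cw.1 * alt v (invmx v)^T cw.2 * (invmx v)^T i k).
    rewrite !big_filter; apply: eq_bigr => cw ow /=.
    by rewrite E // mulrA.
  by rewrite -mulr_suml GLod // mul0r.
have e1 : \sum_l u (Ordinal N0) l * u (Ordinal N0) l = 1.
  by rewrite (orth _ _).1 eqxx.
rewrite -[S]mulr1 -e1.
by rewrite mulr_sumr big1 // => l _; rewrite mulrA hS mul0r.
Qed.

End HalfCommutation.

Section HalfCriteria.
Variables (R : realType) (N : nat).
Local Notation C := R[i].
Local Notation letter := ('I_N * 'I_N)%type.
Local Notation poly := (ncpoly R N).

Section MatrixAmplification.
Variables (A : algType C) (n : nat).
Implicit Types (T : 'M[C]_n.+1) (a : A).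

(** The element T (x) a, for T a complex matrix. *)
Definition mxs T a : 'M[A]_n.+1 := \matrix_(s, t) (T s t *: a).

Lemma mxsM T T' a a' : mxs T a * mxs T' a' = mxs (T * T') (a * a').
Proof.
apply/matrixP => s t; rewrite !mxE scaler_suml; apply: eq_bigr => k _.
by rewrite !mxE -scalerAl -scalerAr scalerA.
Qed.

Lemma mxs1 : mxs 1 1 = 1.
Proof. by apply/matrixP => s t; rewrite !mxE; case: eqP; rewrite ?scale1r ?scale0r. Qed.

Lemma mxsZ (c : C) T a : mxs (c *: T) a = mxs T (c *: a).
Proof. by apply/matrixP => s t; rewrite !mxE scalerA mulrC. Qed.

Lemma mxs_sum T (I : Type) (r : seq I) (F : I -> A) :
  mxs T (\sum_(i <- r) F i) = \sum_(i <- r) mxs T (F i).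
Proof.
apply/matrixP => s t; rewrite summxE mxE scaler_sumr; apply: eq_bigr => i _.
by rewrite mxE.
Qed.

Lemma mxs0 T : mxs T 0 = 0.
Proof. by apply/matrixP => s t; rewrite !mxE scaler0. Qed.

Definition scalar_emb (c : C) : 'M[A]_n.+1 := (c%:A)%:M.

Lemma scalar_emb_zmod : zmod_morphism scalar_emb.
Proof. by move=> c d; rewrite /scalar_emb scalerBl rmorphB. Qed.
Lemma scalar_emb_monoid : monoid_morphism scalar_emb.
Proof.
split; first by rewrite /scalar_emb scale1r.
move=> c d; rewrite /scalar_emb -[RHS]/(_ *m _) -scalar_mxM -scalerAl mul1r.
by rewrite scalerA.
Qed.
HB.instance Definition _ :=
  GRing.isZmodMorphism.Build C 'M[A]_n.+1 scalar_emb scalar_emb_zmod.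
HB.instance Definition _ :=
  GRing.isMonoidMorphism.Build C 'M[A]_n.+1 scalar_emb scalar_emb_monoid.

Lemma scalar_emb_mulE c (M : 'M[A]_n.+1) s t : (scalar_emb c * M) s t = c *: M s t.
Proof. by rewrite -[_ * M]/(_ *m M) mul_scalar_mx mxE -scalerAl mul1r. Qed.

Lemma scalar_emb_central c (M : 'M[A]_n.+1) : scalar_emb c * M = M * scalar_emb c.
Proof.
apply/matrixP => s t; rewrite scalar_emb_mulE mxE (bigD1 t) //= big1 ?addr0.
  by rewrite mxE eqxx mulr1n -scalerAr mulr1.
by move=> k kt; rewrite mxE (negbTE kt) mulr0n mulr0.
Qed.

End MatrixAmplification.

Variables (I : qgrp R N) (hI : closed_qsubgroup I).
Hypothesis N0 : (0 < N)%N.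
Hypothesis hD : unit_diag I.
Variables (m : nat) (gam : 'I_N -> 'M[C]_m.+1).
Hypothesis gam_tr : forall c, (gam c)^T = gam c.
Hypothesis gam_sqr : forall c, gam c * gam c = 1.
Hypothesis hG : has_rotations I gam.
Hypothesis h1 : forall p q p' q', ann I (phi gam (@wcounit R N) p q p' q').
Variables (A : algType C) (u : 'M[A]_N) (sg : 'I_N -> 'I_N -> 'I_N -> C).
Hypothesis gam_rev : forall a b c, gam c * gam b * gam a = sg a b c *: (gam a * gam b * gam c).
Hypothesis half : forall i1 j1 i2 j2 i3 j3,
  u i1 j1 * u i2 j2 * u i3 j3 =
  (sg i1 i2 i3 * sg j1 j2 j3) *: (u i3 j3 * u i2 j2 * u i1 j1).
Hypothesis orth : forall i k,
  \sum_l u i l * u k l = (i == k)%:R /\ \sum_l u l i * u l k = (i == k)%:R.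

(** The entries gamma_i (x) gamma_j (x) u_ij half-commute: the signs of the
    Clifford generators cancel those of u. *)
Definition amplified : 'M['M[A]_((m + m * m.+1).+1)]_N :=
  \matrix_(i, j) mxs (tens (gam i) (gam j)) (u i j).

Lemma wval_amplified w :
  wval amplified w = mxs (tens (gw gam (unzip1 w)) (gw gam (unzip2 w))) (wval u w).
Proof.
elim: w => [|a w IH]; first by rewrite !wval_nil !gw_nil tens11 mxs1.
by rewrite !wval_cons IH mxE mxsM tensM /= !gw_cons.
Qed.

Lemma amplified_half i1 j1 i2 j2 i3 j3 :
  amplified i1 j1 * amplified i2 j2 * amplified i3 j3 =
  amplified i3 j3 * amplified i2 j2 * amplified i1 j1.
Proof.
rewrite !mxE !mxsM !tensM half (gam_rev i1) (gam_rev j1) tensZ mxsZ.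
by congr mxs.
Qed.

Lemma amplified_orth i k :
  \sum_l amplified i l * amplified k l = (i == k)%:R /\
  \sum_l amplified l i * amplified l k = (i == k)%:R.
Proof.
have [o1 o2] := orth i k; split.
  transitivity (mxs (tens (gam i * gam k) (1 : 'M[C]_m.+1)) (\sum_l u i l * u k l)).
    by rewrite mxs_sum; apply: eq_bigr => l _; rewrite !mxE mxsM tensM gam_sqr.
  rewrite o1; have [->|_] := eqVneq i k; last exact: mxs0.
  by rewrite gam_sqr tens11 mxs1.
transitivity (mxs (tens (1 : 'M[C]_m.+1) (gam i * gam k)) (\sum_l u l i * u l k)).
  by rewrite mxs_sum; apply: eq_bigr => l _; rewrite !mxE mxsM tensM gam_sqr.
rewrite o2; have [->|_] := eqVneq i k; last exact: mxs0.
by rewrite gam_sqr tens11 mxs1.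
Qed.

(** The identity transferred to the amplified matrix is contracted with the
    coefficients of the gammas. *)
Theorem half_criterion P : I P -> eval u P = 0.
Proof.
move=> IP.
have gam_orth c : gam c *m (gam c)^T = 1 by rewrite gam_tr; exact: gam_sqr.
pose c1 s t p q (w : word N) := P@_w * (gw gam (unzip1 w) s t * gw gam (unzip2 w) p q).
have key s t p q :
    \sum_(w <- msupp P) (c1 s t p q w * (gw gam (unzip1 w) s t * gw gam (unzip2 w) p q))
      *: wval u w = 0.
  pose fam := [seq (c1 s t p q w, w : seq letter) | w : word N <- enum_fset (msupp P)].
  have van : vanishes_on_GL fam.
    move=> v uv; rewrite big_map.
    have := ann_GL hI gam_orth hD hG h1 s t p q uv IP; rewrite pairingE => e.
    by apply: etrans e; apply: eq_bigr => w _; rewrite /c1 /phi /=; ring.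
  have := half_commuting_transfer (@scalar_emb_central A _) amplified_half amplified_orth N0 van.
  rewrite big_map => /matrixP/(_ (tix s p) (tix t q)); rewrite summxE mxE => e.
  apply: etrans e; apply: eq_bigr => w _; rewrite scalar_emb_mulE wval_amplified.
  by rewrite mxE tensE scalerA.
have mz : (m.+1%:R * m.+1%:R : C) != 0 by rewrite mulf_neq0 ?pnatr_eq0.
rewrite -[LHS](scalerK mz) evalE.
rewrite [X in _ *: X](_ : _ = 0) ?scaler0 //.
transitivity (\sum_s \sum_t \sum_p \sum_q \sum_(w <- msupp P) (c1 s t p q w *
   (gw gam (unzip1 w) s t * gw gam (unzip2 w) p q)) *: wval u w); last first.
  by apply: big1 => s _; apply: big1 => t _; apply: big1 => p _; apply: big1 => q _.
under eq_bigr do under eq_bigr do under eq_bigr do rewrite exchange_big /=.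
under eq_bigr do under eq_bigr do rewrite exchange_big /=.
under eq_bigr do rewrite exchange_big /=.
rewrite exchange_big /= scaler_sumr; apply: eq_bigr => w _; rewrite scalerA.
rewrite -{1}(gw_sqsum gam_orth (unzip1 w)) -(gw_sqsum gam_orth (unzip2 w)).
rewrite mulrAC !mulr_suml scaler_suml; apply: eq_bigr => s _.
rewrite !mulr_suml scaler_suml; apply: eq_bigr => t _.
rewrite mulr_sumr scaler_suml; apply: eq_bigr => p _.
rewrite mulr_sumr scaler_suml; apply: eq_bigr => q _.
by congr (_ *: _); rewrite /c1; ring.
Qed.

End HalfCriteria.

(** * Models of the relations *)

Section Models.
Variables (R : realType) (N : nat).
Local Notation C := R[i].
Local Notation letter := ('I_N * 'I_N)%type.
Local Notation poly := (ncpoly R N).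

(** The common form of the relations of O_N^* (trivial signs) and of its twisted
    version (signs sgn3). *)
Definition rel_half (sg : 'I_N -> 'I_N -> 'I_N -> C) : relations R N :=
  fun A u => forall i1 j1 i2 j2 i3 j3,
    u i1 j1 * u i2 j2 * u i3 j3 =
      (sg i1 i2 i3 * sg j1 j2 j3) *: (u i3 j3 * u i2 j2 * u i1 j1).

Lemma rel_Ostar_half (A : cstarAlgType R) (u : 'M[A]_N) :
  rel_Ostar u <-> rel_half (fun _ _ _ => 1) u.
Proof. by split=> h i1 j1 i2 j2 i3 j3; rewrite h ?mulr1 ?scale1r. Qed.

Lemma sgn3_sqr (i j k : 'I_N) : sgn3 R i j k * sgn3 R i j k = 1 :> C.
Proof. by rewrite /sgn3; case: ifP => _; rewrite ?mulr1 // mulrN1 opprK. Qed.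

Section HalfStable.
Variable sg : 'I_N -> 'I_N -> 'I_N -> C.
Hypothesis sg_sqr : forall i j k, sg i j k * sg i j k = 1.

(** The signs of the inner indices appear twice. *)
Lemma half_mxconvol m n (u : 'M['M[C]_m.+1]_N) (u' : 'M['M[C]_n.+1]_N) :
  rel_half sg u -> rel_half sg u' -> rel_half sg (mxconvol u u').
Proof.
have expand i1 j1 i2 j2 i3 j3 : mxconvol u u' i1 j1 * mxconvol u u' i2 j2 * mxconvol u u' i3 j3 =
    \sum_k1 \sum_k2 \sum_k3 tens (u i1 k1 * u i2 k2 * u i3 k3)
                                 (u' k1 j1 * u' k2 j2 * u' k3 j3).
  rewrite !mxE !mulr_suml; apply: eq_bigr => k1 _.
  rewrite [X in X * _]mulr_sumr mulr_suml; apply: eq_bigr => k2 _.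
  by rewrite mulr_sumr; apply: eq_bigr => k3 _; rewrite !tensM.
move=> h h' i1 j1 i2 j2 i3 j3; rewrite !expand.
under [in RHS]eq_bigr do rewrite exchange_big /=.
rewrite [in RHS]exchange_big /=.
under [in RHS]eq_bigr do rewrite exchange_big /=.
rewrite scaler_sumr; apply: eq_bigr => k1 _; rewrite scaler_sumr.
apply: eq_bigr => k2 _; rewrite scaler_sumr; apply: eq_bigr => k3 _.
rewrite h h' tensZ; congr (_ *: _).
by rewrite -mulrA [sg k1 k2 k3 * (_ * _)]mulrA sg_sqr mul1r.
Qed.

Lemma half_trmodel n (u : 'M['M[C]_n.+1]_N) : rel_half sg u -> rel_half sg (trmodel u).
Proof.
move=> h i1 j1 i2 j2 i3 j3; rewrite !mxE.
have trM (x y z : 'M[C]_n.+1) : x^T * y^T * z^T = (z * y * x)^T.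
  by rewrite -[RHS]/((z *m y *m x)^T) !trmx_mul mulmxA.
have c1 (x y : C) : x * x = 1 -> y * y = 1 -> x * y * (y * x) = 1.
  by move=> hx hy; rewrite -mulrA [y * (y * x)]mulrA hy mul1r.
by rewrite !trM (h j1 i1 j2 i2 j3 i3) linearZ /= scalerA c1 ?scale1r.
Qed.

Lemma half_onemodel : rel_half sg (onemodel R N).
Proof.
move=> i1 j1 i2 j2 i3 j3; rewrite !onemodelE.
have [<-|_] := eqVneq i1 j1; last by rewrite !mul0r mulr0 scaler0.
have [<-|_] := eqVneq i2 j2; last by rewrite mulr0 !mul0r mulr0 mul0r scaler0.
have [<-|_] := eqVneq i3 j3; last by rewrite mulr0 !mul0r scaler0.
by rewrite sg_sqr scale1r.
Qed.

End HalfStable.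

(** The models g_ij gamma_i (x) gamma_j, for g real orthogonal: they are the points
    of O_N for trivial gamma, and models of its twisted version for Clifford
    generators. *)
Lemma real_model_Oplus m (gam : 'I_N -> 'M[C]_m.+1) (g : 'M[C]_N) :
  (forall c, star (gam c) = gam c) -> (forall c, gam c * gam c = 1) ->
  (forall i j, (g i j)^* = g i j) -> g *m g^T = 1%:M -> g^T *m g = 1%:M ->
  rel_Oplus (\matrix_(i, j) (g i j *: tens (gam i) (gam j))).
Proof.
move=> gs g2 gr o1 o2; split.
  by move=> i j; rewrite mxE starZ gr star_tens !gs.
have /orth_sums og : g *m g^T = 1%:M /\ g^T *m g = 1%:M by [].
apply/orth_sums => i j; have [h1 h2] := og i j; split.
  transitivity ((\sum_k g i k * g j k) *: tens (gam i * gam j) (1 : 'M[C]_m.+1)).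
    rewrite scaler_suml; apply: eq_bigr => k _; rewrite !mxE.
    by rewrite -scalerAl -scalerAr scalerA tensM g2.
  by rewrite h1; have [->|_] := eqVneq i j; rewrite ?scale0r // g2 tens11 scale1r.
transitivity ((\sum_k g k i * g k j) *: tens (1 : 'M[C]_m.+1) (gam i * gam j)).
  rewrite scaler_suml; apply: eq_bigr => k _; rewrite !mxE.
  by rewrite -scalerAl -scalerAr scalerA tensM g2.
by rewrite h2; have [->|_] := eqVneq i j; rewrite ?scale0r // g2 tens11 scale1r.
Qed.

Lemma wval_real_model m (gam : 'I_N -> 'M[C]_m.+1) (g : 'M[C]_N) w :
  wval (\matrix_(i, j) (g i j *: tens (gam i) (gam j))) w =
  wval g w *: tens (gw gam (unzip1 w)) (gw gam (unzip2 w)).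
Proof.
elim: w => [|a w IH]; first by rewrite !wval_nil !gw_nil tens11 scale1r.
by rewrite !wval_cons IH mxE -scalerAl -scalerAr scalerA tensM !gw_cons.
Qed.

Definition carries_reals m (gam : 'I_N -> 'M[C]_m.+1) (I : qgrp R N) :=
  forall g : 'M[C]_N, (forall i j, (g i j)^* = g i j) ->
  g *m g^T = 1%:M -> g^T *m g = 1%:M ->
  forall p q p' q', ann I (phi gam (wval g) p q p' q').

Lemma carries_rotations m (gam : 'I_N -> 'M[C]_m.+1) I :
  carries_reals gam I -> has_rotations I gam.
Proof.
move=> h a b ab c s cc ss cs; have e : plane a b c s (- s) c *m (plane a b c s (- s) c)^T = 1%:M.
  by rewrite plane_tr // plane_mul // -(plane1 _ ab); congr plane; rewrite -?cs; ring.
move=> p q p' q'; apply: (h _ _ e (mulmx1C e)).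
move=> i j; rewrite !mxE.
by case: (i == a); case: (i == b); case: (j == a); case: (j == b);
  rewrite ?rmorph0 ?rmorph_nat //; rewrite ?rmorphN /= ?cc ?ss.
Qed.

Lemma carries_counit m (gam : 'I_N -> 'M[C]_m.+1) I : carries_reals gam I ->
  forall p q p' q', ann I (phi gam (@wcounit R N) p q p' q').
Proof.
move=> h p q p' q'; apply: ann_ext (h 1%:M _ _ _ p q p' q') => [w|i j||].
- by rewrite /phi -alt_one alt_wval.
- by rewrite mxE rmorph_nat.
- by rewrite trmx1 mulmx1.
by rewrite trmx1 mulmx1.
Qed.

Lemma carries_of_model m (gam : 'I_N -> 'M[C]_m.+1) (I : qgrp R N) :
  (forall c, star (gam c) = gam c) -> (forall c, gam c * gam c = 1) ->
  (forall g : 'M[C]_N,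
     let u : 'M['M[C]_((m + m * m.+1).+1)]_N := \matrix_(i, j) (g i j *: tens (gam i) (gam j)) in
     rel_Oplus u -> forall P, I P -> eval u P = 0) ->
  carries_reals gam I.
Proof.
move=> gs g2 h g gr o1 o2 p q p' q'.
apply: ann_ext (ann_model (tix p p') (tix q q') (h g _)) => [w|].
  by rewrite wval_real_model mxE tensE.
exact: real_model_Oplus.
Qed.

(** Antidiagonal matrices half-commute; with unitary entries they are also self-adjoint
    involutions. *)
Definition antidiag (d : 'rV[C]_N) : 'M['M[C]_2]_N := \matrix_(i, j)
  ((i == j)%:R *: \matrix_(s, t) (if s == t then 0 else if s == 0 then d 0 i else (d 0 i)^*)).

Lemma unit_diag_of_model (I : qgrp R N) :
  (forall d : 'rV[C]_N, (forall c, d 0 c * (d 0 c)^* = 1) ->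
     forall P, I P -> eval (antidiag d) P = 0) -> unit_diag I.
Proof.
move=> h d hd; pose f q (w : seq letter) := wval (antidiag d) w 0 q.
have hf : ann I (fun w => \sum_q 1 * f q w).
  by apply: ann_sum => q; apply: ann_model; exact: h.
apply: ann_ext hf => w.
suff : \sum_q wval (antidiag d) w 0 q = alt (diag_mx d) (diag_mx (\row_c (d 0 c)^*)) w /\
  \sum_q wval (antidiag d) w 1 q = alt (diag_mx (\row_c (d 0 c)^*)) (diag_mx d) w.
  by case=> <- _; apply: eq_bigr => q _; rewrite mul1r.
elim: w => [|a w [IH0 IH1]].
  by rewrite wval_nil !big_ord_recl !big_ord0 !mxE /=; split; ring.
have E s t : wval (antidiag d) (a :: w) s t = (a.1 == a.2)%:R *
    ((if s == 0 then d 0 a.1 else (d 0 a.1)^*) * wval (antidiag d) w (if s == 0 then 1 else 0) t).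
  pose s' : 'I_2 := if s == 0 then 1 else 0.
  have ss' : (s == s') = false by rewrite /s'; case: (s) => -[|[|//]] ?.
  rewrite wval_cons mxE (bigD1 s') //= big1 ?addr0 => [|k ks].
    by rewrite !mxE ss' mulrA.
  have -> : k = s.
    by apply/eqP; move: ks; rewrite /s'; case: (s) => -[|[|//]] ?; case: (k) => -[|[|//]] ?.
  by rewrite !mxE eqxx mulr0 mul0r.
rewrite /=; under eq_bigr do rewrite E; under [in X in _ /\ X]eq_bigr do rewrite E.
rewrite -!mulr_sumr /= IH0 IH1 !mxE.
by have [->|_] := eqVneq a.1 a.2; rewrite ?mul1r ?mulr1n // mulr0n !mul0r.
Qed.

End Models.

(** * Generation *)

Section Generation.
Variables (R : realType) (N : nat).
Local Notation C := R[i].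
Local Notation letter := ('I_N * 'I_N)%type.
Local Notation poly := (ncpoly R N).

(** Diagonal matrices of self-adjoint involutions, which are models of H_N^+. *)
Definition involutions m (tau : 'I_N -> 'M[C]_m.+1) : 'M['M[C]_m.+1]_N :=
  \matrix_(i, j) ((i == j)%:R *: tau i).

Lemma involutions_sum m (tau : 'I_N -> 'M[C]_m.+1) i j :
  (forall c, tau c * tau c = 1) ->
  \sum_k involutions tau i k * involutions tau j k = (i == j)%:R /\
  \sum_k involutions tau k i * involutions tau k j = (i == j)%:R.
Proof.
move=> t2; split; rewrite (bigD1 i) //= big1 ?addr0 => [|k ki].
- rewrite !mxE eqxx scale1r eq_sym.
  by have [->|_] := eqVneq i j; rewrite ?scale1r ?t2 // scale0r mulr0.
- by rewrite !mxE eq_sym (negbTE ki) scale0r mul0r.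
- rewrite !mxE eqxx scale1r.
  by have [->|_] := eqVneq i j; rewrite ?scale1r ?t2 // scale0r mulr0.
by rewrite !mxE (negbTE ki) scale0r mul0r.
Qed.

Lemma involutions_Oplus m (tau : 'I_N -> 'M[C]_m.+1) :
  (forall c, star (tau c) = tau c) -> (forall c, tau c * tau c = 1) ->
  rel_Oplus (involutions tau).
Proof.
move=> ts t2; split; first by move=> i j; rewrite mxE starZ rmorph_nat ts.
by apply/orth_sums => i j; exact: involutions_sum.
Qed.

Lemma involutions_Hplus m (tau : 'I_N -> 'M[C]_m.+1) :
  (forall c, tau c * tau c = 1) -> rel_Hplus (involutions tau).
Proof.
move=> t2; have E i j : involutions tau i j ^+ 2 = (i == j)%:R.
  rewrite mxE expr2; case: (i == j); last by rewrite scale0r mul0r.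
  by rewrite scale1r t2.
split=> [i j|i|j].
- rewrite mxE E; split; first by case: (i == j); rewrite ?star1 ?star0.
  by case: (i == j); rewrite ?mulr1 ?mulr0.
- under eq_bigr do rewrite mxE E.
  by rewrite (bigD1 i) //= eqxx big1 ?addr0 // => j /negbTE; rewrite eq_sym => ->.
under eq_bigr do rewrite mxE E.
by rewrite (bigD1 j) //= eqxx big1 ?addr0 // => i /negbTE ->.
Qed.

Definition swapd (d : 'rV[C]_N) (i : 'I_N) : 'M[C]_2 :=
  \matrix_(s, t) (if s == t then 0 else if s == 0 then d 0 i else (d 0 i)^*).

Lemma antidiag_involutions d : antidiag d = involutions (swapd d).
Proof. by []. Qed.

Section UnitDiagonal.
Variable d : 'rV[C]_N.
Hypothesis hd : forall c, d 0 c * (d 0 c)^* = 1.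

Lemma swapd_star c : star (swapd d c) = swapd d c.
Proof.
apply/matrixP => s t; rewrite starE !mxE.
by case: s t => -[|[|//]] ? [[|[|//]] ?] /=; rewrite ?rmorph0 ?conjCK.
Qed.

Lemma swapd_mul a b s t : (swapd d a * swapd d b) s t =
  if s == t then (if s == 0 then d 0 a * (d 0 b)^* else (d 0 a)^* * d 0 b) else 0.
Proof.
rewrite mxE !big_ord_recl big_ord0 !mxE.
by case: s t => -[|[|//]] ? [[|[|//]] ?] /=; rewrite ?mul0r ?mulr0 ?add0r ?addr0.
Qed.

Lemma swapd_sqr c : swapd d c * swapd d c = 1.
Proof.
apply/matrixP => s t; rewrite swapd_mul !mxE; case: (s == t) => //.
by case: (s == 0); rewrite ?hd // mulrC hd.
Qed.

Lemma swapd_rev a b c : swapd d a * swapd d b * swapd d c = swapd d c * swapd d b * swapd d a.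
Proof.
apply/matrixP => s t; rewrite mxE [RHS]mxE; apply: etrans (eq_bigr _ _) _ => [k _|].
  rewrite swapd_mul; reflexivity.
apply/esym; apply: etrans (eq_bigr _ _) _ => [k _|].
  rewrite swapd_mul; reflexivity.
rewrite !big_ord_recl !big_ord0 !mxE.
by case: s t => -[|[|//]] ? [[|[|//]] ?] /=; rewrite ?mul0r ?mulr0 ?add0r ?addr0 //; ring.
Qed.

Lemma antidiag_half sg : (forall i j k : 'I_N, sg i j k * sg i j k = 1 :> C) ->
  rel_half sg (antidiag d).
Proof.
move=> sg2 i1 j1 i2 j2 i3 j3; rewrite antidiag_involutions !mxE.
have [<-|_] := eqVneq i1 j1; last by rewrite !scale0r !mul0r mulr0 scaler0.
have [<-|_] := eqVneq i2 j2; last by rewrite !scale0r mulr0 !mul0r mulr0 mul0r scaler0.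
have [<-|_] := eqVneq i3 j3; last by rewrite !scale0r mulr0 !mul0r scaler0.
by rewrite sg2 !scale1r swapd_rev.
Qed.

End UnitDiagonal.

Variables (L : qgrp R N) (hL : closed_qsubgroup L).

(** The finite-dimensional models of rel are models of the quantum group L. *)
Definition killed_by (rel : relations R N) := forall P, L P -> fdkernel rel P.

Lemma unit_diag_Hstar : killed_by (fun A u => rel_Hplus u /\ rel_Ostar u) -> unit_diag L.
Proof.
move=> h; apply: unit_diag_of_model => d hd P /h; apply.
  by rewrite antidiag_involutions; apply: involutions_Oplus => c; [exact: swapd_star | exact: swapd_sqr].
split; first by rewrite antidiag_involutions; apply: involutions_Hplus; exact: swapd_sqr.
by apply/rel_Ostar_half; apply: antidiag_half => // *; rewrite mulr1.
Qed.

Lemma unit_diag_Hplus : killed_by (@rel_Hplus R N) -> unit_diag L.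
Proof.
by move=> h; apply: unit_diag_Hstar => P /h k n u ou [hu _]; exact: k.
Qed.

Definition trivial_gam (c : 'I_N) : 'M[C]_1 := 1.

Lemma gw_trivial i : gw trivial_gam i = 1.
Proof. by rewrite /gw big1. Qed.

Lemma phi_trivial f w : phi trivial_gam f 0 0 0 0 w = f w.
Proof. by rewrite /phi !gw_trivial mxE eqxx !mulr1. Qed.

Lemma carries_O : killed_by (@rel_O R N) -> carries_reals trivial_gam L.
Proof.
move=> h; apply: carries_of_model => [c|c|g u ou P /h k].
- exact: star1.
- exact: mulr1.
apply: k => // i j a b; rewrite !mxE /trivial_gam tens11.
by rewrite -!scalerAl -!scalerAr !mulr1 !scalerA mulrC.
Qed.

Variables (m : nat) (gam : 'I_N -> 'M[C]_m.+1) (hgam : clifford gam).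

Lemma carries_Obar : killed_by (@rel_Obar R N) -> carries_reals gam L.
Proof.
move=> h; apply: carries_of_model => [c|c|g u ou P /h k].
- exact: cl_star.
- exact: cl_sqr.
apply: k => // i j a b nab; rewrite !mxE -!scalerAl -!scalerAr !scalerA !tensM [g a b * _]mulrC.
have tNl (X Y : 'M[C]_m.+1) : tens (- X) Y = - tens X Y.
  by apply: tens_eqP => *; rewrite [RHS]mxE !tensE mxE mulNr.
have tNr (X Y : 'M[C]_m.+1) : tens X (- Y) = - tens X Y.
  by apply: tens_eqP => *; rewrite [RHS]mxE !tensE mxE mulrN.
have [ia|ia] := eqVneq i a; have [jb|jb] := eqVneq j b => /=.
- by move: nab; rewrite ia jb eqxx.
- by rewrite ia (cl_anti hgam jb) tNr scalerN.
- by rewrite jb (cl_anti hgam ia) tNl scalerN.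
by rewrite (cl_anti hgam ia) (cl_anti hgam jb) tNl tNr opprK.
Qed.

Lemma gamdiag_Hplus : killed_by (@rel_Hplus R N) -> forall p q, ann L (gamdiag gam p q).
Proof.
move=> h p q; have k P : L P -> eval (involutions gam) P = 0.
  move/h; apply; last by apply: involutions_Hplus; exact: cl_sqr.
  by apply: involutions_Oplus; [exact: cl_star | exact: cl_sqr].
apply: ann_ext (ann_model p q k) => w; rewrite /gamdiag.
suff -> : wval (involutions gam) w = wcounit R w *: gw gam (unzip1 w) by rewrite mxE.
elim: w => [|a w IH]; first by rewrite wval_nil gw_nil /wcounit big_nil scale1r.
have -> : wcounit R (a :: w) = (a.1 == a.2)%:R * wcounit R w by exact: big_cons.
by rewrite wval_cons IH mxE -scalerAl -scalerAr scalerA /= gw_cons.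
Qed.

Lemma rot_O a b : killed_by (@rel_O R N) -> a != b -> ann L (rot R a b).
Proof.
move=> h ab; have := ann_phi_rot (carries_rotations (carries_O h)) 0 0 0 0 ab.
by apply: ann_ext => w; rewrite phi_trivial.
Qed.

Lemma twrot_Obar a b : killed_by (@rel_Obar R N) -> a != b -> ann L (twrot R a b).
Proof.
move=> h ab; apply: (ann_twrot hgam) => // p q p' q'.
exact (ann_phi_rot (carries_rotations (carries_Obar h)) p q p' q' ab).
Qed.

Lemma rot_Hplus_Obar a b : killed_by (@rel_Hplus R N) -> killed_by (@rel_Obar R N) ->
  a != b -> ann L (rot R a b).
Proof.
move=> hH hO ab; apply: (ann_of_phi hL hgam (gamdiag_Hplus hH)) => p q p' q'.
exact (ann_phi_rot (carries_rotations (carries_Obar hO)) p q p' q' ab).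
Qed.

Lemma twrot_Hplus_O a b : killed_by (@rel_Hplus R N) -> killed_by (@rel_O R N) ->
  a != b -> ann L (twrot R a b).
Proof.
move=> hH hO ab; apply: (ann_twrot hgam) => //.
exact: (ann_phi_of_gamdiag hL (gamdiag_Hplus hH) (rot_O hO ab)).
Qed.

Lemma Ostar_generation : (0 < N)%N -> unit_diag L -> killed_by (@rel_O R N) ->
  forall P, L P -> impose (@rel_Ostar R N) P.
Proof.
move=> N0 hD hO P LP A u [_ /orth_sums ou] /rel_Ostar_half hu.
apply: (half_criterion hL N0 hD _ _ _ _ _ hu ou LP) => [c|c|||a b c].
- exact: trmx1.
- exact: mulr1.
- exact: carries_rotations (carries_O hO).
- exact: carries_counit (carries_O hO).
by rewrite scale1r.
Qed.

Lemma Obarstar_generation : (0 < N)%N -> unit_diag L -> killed_by (@rel_Obar R N) ->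
  forall P, L P -> impose (@rel_Obarstar R N) P.
Proof.
move=> N0 hD hO P LP A u [_ /orth_sums ou] hu.
apply: (half_criterion hL N0 hD _ _ _ _ _ hu ou LP) => [c|c|||a b c].
- exact: (cl_tr hgam).
- exact: (cl_sqr hgam).
- exact: carries_rotations (carries_Obar hO).
- exact: carries_counit (carries_Obar hO).
have anti := cl_anti hgam; have sq := cl_sqr hgam.
rewrite /sgn3; have [->|ab] := eqVneq a b => /=.
  by rewrite scale1r sq mul1r -mulrA sq mulr1.
have [->|bc] := eqVneq b c => /=.
  by rewrite scale1r sq mul1r -mulrA sq mulr1.
have [<-|ac] := eqVneq a c => /=; first by rewrite scale1r.
rewrite eq_sym in bc; rewrite eq_sym in ac; rewrite eq_sym in ab.
rewrite scaleN1r (anti _ _ bc) mulNr -[gam b * _ * _]mulrA (anti _ _ ac).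
by rewrite mulrN opprK mulrA (anti _ _ ab) mulNr.
Qed.

(** For N = 1 the generator is an involution, so that half-commutation is automatic;
    otherwise Oplus_criterion applies with two distinct letters. *)
Lemma Oplus_generation : (0 < N)%N -> unit_diag L ->
  (forall a b, a != b -> ann L (rot R a b)) ->
  (forall a b, a != b -> ann L (twrot R a b)) ->
  forall P, L P -> impose (fun _ _ => True) P.
Proof.
move=> N0 hD hR hB P LP A u [_ ou] _.
have [N1|N2] := leqP N 1.
  have eqI (a b : 'I_N) : a = b.
    by apply: val_inj => /=; have := ltn_ord a; have := ltn_ord b; lia.
  have /orth_sums ou' := ou.
  have hu i1 j1 i2 j2 i3 j3 : u i1 j1 * u i2 j2 * u i3 j3 =
      (1 * 1) *: (u i3 j3 * u i2 j2 * u i1 j1).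
    by rewrite mulr1 scale1r (eqI i1 i3) (eqI j1 j3).
  apply: (half_criterion (gam := trivial_gam) (sg := fun _ _ _ => 1) hL N0 hD _ _ _ _ _ hu ou' LP) => [c|c|a b||a b c].
  - exact: trmx1.
  - exact: mulr1.
  - by rewrite (eqI a b) eqxx.
  - move=> p q p' q'; rewrite !ord1; apply: ann_ext (ann_counit hL) => w.
    by rewrite phi_trivial.
  by rewrite scale1r.
pose l0 := Ordinal N0; pose l1 := Ordinal N2.
have l01 : l0 != l1 by [].
exact: (Oplus_criterion hL ou l01 hR (hB _ _ l01) (ann_alternating hD l01) LP).
Qed.

End Generation.

(** * Relations and intersections *)

Section Relations.
Variables (R : realType) (N : nat).
Local Notation C := R[i].
Local Notation letter := ('I_N * 'I_N)%type.
Local Notation poly := (ncpoly R N).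

(** Intersections only see the polynomials that vanish under a relation; nothing
    is lost when the relation is itself polynomial. *)
Definition detected (rel : relations R N) := forall (A : cstarAlgType R) (u : 'M[A]_N),
  rel_Oplus u -> (forall P, impose rel P -> eval u P = 0) -> rel A u.

Lemma wval2 (A : nzRingType) (u : 'M[A]_N) a b :
  wval u [:: a; b] = u a.1 a.2 * u b.1 b.2.
Proof. by rewrite !wval_cons wval_nil mulr1. Qed.

Lemma wval3 (A : nzRingType) (u : 'M[A]_N) a b c :
  wval u [:: a; b; c] = u a.1 a.2 * u b.1 b.2 * u c.1 c.2.
Proof. by rewrite !wval_cons wval_nil mulr1 mulrA. Qed.

Lemma detect_eq (rel : relations R N) (A : cstarAlgType R) (u : 'M[A]_N) (c : C) v w :
  (forall P, impose rel P -> eval u P = 0) ->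
  (forall (B : cstarAlgType R) (u' : 'M[B]_N), rel_Oplus u' -> rel B u' ->
     wval u' v = c *: wval u' w) ->
  wval u v = c *: wval u w.
Proof.
move=> h hr; apply/eqP; rewrite -subr_eq0 -!eval_monom -evalZ -evalB.
apply/eqP; apply: h => B u' ou' ru'.
by rewrite evalB evalZ !eval_monom (hr B u' ou' ru') subrr.
Qed.

Lemma detected_half sg : detected (rel_half sg).
Proof.
move=> A u ou h i1 j1 i2 j2 i3 j3.
have := @detect_eq _ A u (sg i1 i2 i3 * sg j1 j2 j3)
  [:: (i1, j1); (i2, j2); (i3, j3)] [:: (i3, j3); (i2, j2); (i1, j1)] h.
by rewrite !wval3; apply=> B u' _ r'; rewrite !wval3 r'.
Qed.

Lemma detected_Ostar : detected (@rel_Ostar R N).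
Proof.
move=> A u ou h i1 j1 i2 j2 i3 j3.
have := @detect_eq _ A u 1
  [:: (i1, j1); (i2, j2); (i3, j3)] [:: (i3, j3); (i2, j2); (i1, j1)] h.
by rewrite !wval3 scale1r; apply=> B u' _ r'; rewrite !wval3 scale1r r'.
Qed.

Lemma detected_O : detected (@rel_O R N).
Proof.
move=> A u ou h i j k l.
have := @detect_eq _ A u 1 [:: (i, j); (k, l)] [:: (k, l); (i, j)] h.
by rewrite !wval2 scale1r; apply=> B u' _ r'; rewrite !wval2 scale1r r'.
Qed.

Lemma detected_Obar : detected (@rel_Obar R N).
Proof.
move=> A u ou h i j k l ne.
have := @detect_eq _ A u (if (i == k) || (j == l) then -1 else 1)
  [:: (i, j); (k, l)] [:: (k, l); (i, j)] h.
rewrite !wval2 /= => -> => [|B u' _ r']; first by case: ifP; rewrite ?scale1r ?scaleN1r.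
by rewrite !wval2 r' //=; case: ifP; rewrite ?scale1r ?scaleN1r.
Qed.

(** The squares are self-adjoint with sums 1 in every orthogonal matrix, so that H_N^+
    is defined by polynomials: the squares are idempotent. *)
Lemma Hplus_fourth (A : cstarAlgType R) (u : 'M[A]_N) : rel_Oplus u ->
  (rel_Hplus u <-> forall i j, wval u [:: (i, j); (i, j); (i, j); (i, j)] = wval u [:: (i, j); (i, j)]).
Proof.
move=> [su /orth_sums ou].
have E i j : wval u [:: (i, j); (i, j); (i, j); (i, j)] = u i j ^+ 2 * u i j ^+ 2.
  by rewrite !wval_cons wval_nil /= mulr1 expr2 !mulrA.
split=> [[hp _ _] i j|h].
  by have [_] := hp i j; rewrite mxE E wval2 expr2.
split=> [i j|i|j].
- rewrite mxE; split; first by rewrite expr2 starM su.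
  by rewrite -E h wval2 expr2.
- have := (ou i i).1; rewrite eqxx => e; apply: etrans e.
  by apply: eq_bigr => k _; rewrite mxE expr2.
have := (ou j j).2; rewrite eqxx => e; apply: etrans e.
by apply: eq_bigr => k _; rewrite mxE expr2.
Qed.

Lemma detected_Hplus : detected (@rel_Hplus R N).
Proof.
move=> A u ou h; apply/Hplus_fourth => // i j; rewrite -[RHS]scale1r.
apply: (detect_eq h) => B u' ou' /(Hplus_fourth ou') r'.
by rewrite scale1r r'.
Qed.

Lemma detected_and r1 r2 : detected r1 -> detected r2 ->
  detected (fun A u => r1 A u /\ r2 A u).
Proof.
move=> h1 h2 A u ou h; split; [apply: h1 => // P hP | apply: h2 => // P hP];
  by apply: h => B u' ou' [r r']; exact: hP.
Qed.

Lemma impose_ext (r1 r2 : relations R N) :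
  (forall (A : cstarAlgType R) (u : 'M[A]_N), rel_Oplus u -> r1 A u <-> r2 A u) ->
  impose r1 = impose r2.
Proof.
move=> h; apply/funext => P; apply/propext.
by split=> hP A u ou r; apply: hP => //; apply/h.
Qed.

Lemma qinter_impose r1 r2 : detected r1 -> detected r2 ->
  qinter (impose r1) (impose r2) = impose (fun A u => r1 A u /\ r2 A u).
Proof.
move=> h1 h2; apply: impose_ext => A u ou; split=> [[a b]|[a b]].
  by split; [exact: h1 | exact: h2].
by split=> P hP; exact: hP.
Qed.

Definition vrel (X : vertex) : relations R N :=
  match X with
  | vOplus => fun _ _ => True
  | vO => @rel_O R N
  | vOstar => @rel_Ostar R N
  | vObar => @rel_Obar R N
  | vObarstar => @rel_Obarstar R N
  | vHplus => @rel_Hplus R N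
  | vHstar => fun A u => rel_Hplus u /\ rel_Ostar u
  | vH => fun A u => rel_Hplus u /\ rel_O u
  end.

Lemma detected_vrel X : detected (vrel X).
Proof.
case: X => /=; last by [].
all: try exact: detected_half.
all: try exact: detected_Hplus.
all: try exact: detected_O.
all: try exact: detected_Ostar.
all: try exact: detected_Obar.
- by apply: detected_and; [exact: detected_Hplus | exact: detected_O].
by apply: detected_and; [exact: detected_Hplus | exact: detected_Ostar].
Qed.

Lemma qg_vrel X : qg R N X = impose (vrel X).
Proof.
case: X => //=; apply: qinter_impose; by [exact: detected_Hplus | exact: detected_O | exact: detected_Ostar].
Qed.

Section Identities.
Variables (A : cstarAlgType R).
Implicit Types (a b c : A).

Lemma cnorm0 : cnorm (0 : A) = 0.
Proof. by rewrite -(scale0r 0) cnormZ Normc.normc0 mul0r. Qed.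

Lemma star_sqr_eq0 a : star a * a = 0 -> a = 0.
Proof.
move=> h; apply: cnorm0_eq0; have := cnorm_starM a; rewrite h cnorm0.
by move/esym/eqP; rewrite sqrf_eq0 => /eqP.
Qed.

(** The self-adjoint element a - a^3 has square zero. *)
Lemma cube_of_fourth a : star a = a -> a * a * (a * a) = a * a -> a * a * a = a.
Proof.
move=> sa h; apply/eqP; rewrite eq_sym -subr_eq0; apply/eqP; apply: star_sqr_eq0.
have -> : star (a - a * a * a) = a - a * a * a.
  by rewrite -scaleN1r starD starZ rmorphN rmorph1 !starM sa mulrA scaleN1r.
have h6 : a * a * a * (a * a * a) = a * a.
  transitivity (a * a * (a * a) * (a * a)); first by rewrite !mulrA.
  by rewrite !h.
have h4 : a * (a * a * a) = a * a by rewrite -[RHS]h !mulrA.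
have h4' : a * a * a * a = a * a by rewrite -[RHS]h !mulrA.
by rewrite mulrBl !mulrBr h6 h4 h4' !subrr.
Qed.

(** Multiplying the relation by one of the idempotents increases the multiple and
    removes that idempotent from the sum. *)
Lemma idempotents_sum_eq0 (J : Type) (s : seq J) (q : J -> A) m (r : A) :
  (forall i, q i * q i = q i) -> (forall i k, q i * q k = q k * q i) ->
  r *+ m.+1 + \sum_(i <- s) q i * r = 0 -> r = 0.
Proof.
move=> q2 qc; elim: s m r => [|i s IH] m r.
  rewrite big_nil addr0 -scaler_nat => /eqP; rewrite scaler_eq0 pnatr_eq0 /=.
  by move/eqP.
rewrite big_cons => h.
have qr : q i * r = 0.
  apply: (IH m.+1); have e := congr1 ( *%R (q i)) h.
  rewrite mulr0 !mulrDr mulrA q2 mulrnAr in e; apply: etrans e.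
  rewrite mulrSr -addrA; congr (_ + (_ + _)); rewrite mulr_sumr.
  by apply: eq_bigr => k _; rewrite !mulrA qc.
by apply: (IH m); apply: etrans h; rewrite qr add0r.
Qed.

(** The squares p_l satisfy p_j p_k + sum of the p_l p_j p_k = 0 over l different
    from j and k, so that idempotents_sum_eq0 gives p_j p_k = 0. *)
Lemma orthogonal_family (J : finType) (a : J -> A) :
  (forall j, a j * a j * a j = a j) ->
  (forall j k, a j * a j * (a k * a k) = a k * a k * (a j * a j)) ->
  \sum_j a j * a j = 1 -> forall j k, j != k -> a j * a k = 0.
Proof.
move=> a3 ac s1 j k jk; pose p l := a l * a l.
have p2 l : p l * p l = p l by rewrite /p mulrA a3.
have pjk : p j * p k = 0.
  pose r := [seq l <- index_enum J | (l != j) && (l != k)].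
  apply: (@idempotents_sum_eq0 _ r p 0) => //.
  have e : \sum_(l | l != j) p l * p j = 0.
    have := congr1 (fun x => x * p j) s1; rewrite mul1r (bigD1 j) //= mulrDl p2.
    by rewrite mulr_suml => /(canRL (addKr _)); rewrite addNr.
  rewrite (bigD1 k) 1?eq_sym //= in e.
  have := congr1 (fun x => x * p k) e; rewrite mul0r mulrDl => e'.
  apply: etrans e'; rewrite mulr1n [p k * _]ac -[p j * _ * _]mulrA p2 big_filter mulr_suml.
  congr (_ + _).
  by apply: eq_bigr => l _; rewrite mulrA.
transitivity (a j * (p j * p k) * a k); last by rewrite pjk mulr0 mul0r.
by rewrite -{1}(a3 j) -{1}(a3 k) /p !mulrA.
Qed.

End Identities.
End Relations.

Section Inclusions.
Variables (R : realType) (N : nat).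
Local Notation C := R[i].

Section Implications.
Variables (A : cstarAlgType R) (u : 'M[A]_N).
Hypothesis ou : rel_Oplus u.

(** Reversing three letters exchanges three pairs, so the sign is the parity of the
    number of equal pairs of row indices, plus that of column indices: it is odd
    unless the three indices are distinct. *)
Lemma Obar_Obarstar : rel_Obar u -> rel_Obarstar u.
Proof.
move=> h i1 j1 i2 j2 i3 j3.
pose e (x y : 'I_N) : C := if x == y then -1 else 1.
have comm i j k l : u i j * u k l = (e i k * e j l) *: (u k l * u i j).
  rewrite /e; have [ik|ik] := eqVneq i k; have [jl|jl] := eqVneq j l.
  - by rewrite ik jl mulrN1 opprK scale1r.
  - by rewrite h ?ik ?xpair_eqE ?eqxx ?(negbTE jl) //= mulr1 scaleN1r.
  - by rewrite h ?jl ?xpair_eqE ?(negbTE ik) //= eqxx mul1r scaleN1r.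
  by rewrite h ?xpair_eqE ?(negbTE ik) ?(negbTE jl) //= mul1r scale1r.
rewrite (comm i1 j1 i2 j2) -scalerAl -[u i2 j2 * _ * _]mulrA (comm i1 j1 i3 j3).
rewrite -scalerAr [u i2 j2 * (_ * _)]mulrA (comm i2 j2 i3 j3) -scalerAl !scalerA.
congr (_ *: _).
have s3 x y z : e x y * e x z * e y z = - sgn3 R x y z.
  rewrite /e /sgn3; have [xy|xy] := eqVneq x y => /=.
    by rewrite xy; case: (y == z); ring.
  have [yz|yz] := eqVneq y z => /=; first by rewrite -yz (negbTE xy); ring.
  by case: (x == z) => /=; ring.
transitivity ((e i1 i2 * e i1 i3 * e i2 i3) * (e j1 j2 * e j1 j3 * e j2 j3)); first by ring.
by rewrite !s3 mulrNN.
Qed.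

Lemma O_Ostar : rel_O u -> rel_Ostar u.
Proof.
by move=> h i1 j1 i2 j2 i3 j3; rewrite (h i1 j1 i2 j2) -mulrA (h i1 j1) mulrA (h i2 j2).
Qed.

Definition square_central := forall i j k l, u i j * u i j * u k l = u k l * (u i j * u i j).

Lemma Ostar_square : rel_Ostar u -> square_central.
Proof. by move=> h i j k l; rewrite h mulrA. Qed.

Lemma Obarstar_square : rel_Obarstar u -> square_central.
Proof. by move=> h i j k l; rewrite h /sgn3 !eqxx /= mulr1 scale1r mulrA. Qed.

Lemma Obar_square : rel_Obar u -> square_central.
Proof. by move=> h; apply: Obarstar_square; exact: Obar_Obarstar. Qed.

Lemma O_square : rel_O u -> square_central.
Proof. by move=> h; apply: Ostar_square; exact: O_Ostar. Qed.

Lemma Hplus_cube : rel_Hplus u -> forall i j, u i j * u i j * u i j = u i j.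
Proof.
move=> [hp _ _] i j; apply: cube_of_fourth; first exact: ou.1.
by have [_] := hp i j; rewrite mxE expr2.
Qed.

Section Cubic.
Hypothesis hH : rel_Hplus u.
Hypothesis sq : square_central.

Lemma row_orth i j k : j != k -> u i j * u i k = 0.
Proof.
apply: (@orthogonal_family _ _ _ (u i)) => [l|l l'|]; first exact: Hplus_cube.
  by rewrite mulrA sq -mulrA sq mulrA.
have [_ /orth_sums o] := ou; by rewrite (o i i).1 eqxx.
Qed.

Lemma col_orth i k j : i != k -> u i j * u k j = 0.
Proof.
apply: (@orthogonal_family _ _ _ (u^~ j)) => [l|l l'|]; first exact: Hplus_cube.
  by rewrite mulrA sq -mulrA sq mulrA.
have [_ /orth_sums o] := ou; by rewrite (o j j).2 eqxx.
Qed.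

(** A negative sign needs three distinct rows and a repeated column, or conversely;
    the two letters in the repeated column are orthogonal, and if they are not
    adjacent the square of one of them crosses the middle letter. *)
Lemma triple_zero i1 j1 i2 j2 i3 j3 : sgn3 R i1 i2 i3 * sgn3 R j1 j2 j3 != 1 ->
  u i1 j1 * u i2 j2 * u i3 j3 = 0.
Proof.
have mid a b (c : A) i j : u i j = a -> a * a * b = b * (a * a) -> a * c = 0 -> a * b * c = 0.
  move=> e ab ac; rewrite -[a in a * b]e -(Hplus_cube hH i j) e.
  by rewrite -[a * a * a]mulrA -[a * _ * b]mulrA ab -!mulrA ac !mulr0.
rewrite {1 2}/sgn3.
case hi: [&& i1 != i2, i2 != i3 & i1 != i3]; case hj: [&& j1 != j2, j2 != j3 & j1 != j3];
  rewrite ?mulrN1 ?opprK ?mulr1 ?eqxx // => _.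
- have /and3P[i12 i23 i13] := hi.
  have [e|j12] := eqVneq j1 j2; first by rewrite e col_orth // mul0r.
  have [e|j23] := eqVneq j2 j3; first by rewrite -mulrA e col_orth // mulr0.
  have [e|j13] := eqVneq j1 j3; last by rewrite j12 j23 j13 in hj.
  by apply: (mid _ _ _ i1 j1 erefl); rewrite ?sq // e col_orth.
have /and3P[j12 j23 j13] := hj.
have [e|i12] := eqVneq i1 i2; first by rewrite e row_orth // mul0r.
have [e|i23] := eqVneq i2 i3; first by rewrite -mulrA e row_orth // mulr0.
have [e|i13] := eqVneq i1 i3; last by rewrite i12 i23 i13 in hi.
by apply: (mid _ _ _ i1 j1 erefl); rewrite ?sq // e row_orth.
Qed.

Lemma sgn3_rev (i j k : 'I_N) : sgn3 R k j i = sgn3 R i j k.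
Proof.
rewrite /sgn3 [k == j]eq_sym [j == i]eq_sym [k == i]eq_sym.
by rewrite (andbCA (j != k)).
Qed.

(** The two relations differ by signs at products that vanish. *)
Lemma Ostar_Obarstar_cubic : rel_Ostar u <-> rel_Obarstar u.
Proof.
have key i1 j1 i2 j2 i3 j3 : (sgn3 R i1 i2 i3 * sgn3 R j1 j2 j3) *: (u i3 j3 * u i2 j2 * u i1 j1) =
    u i3 j3 * u i2 j2 * u i1 j1.
  have [->|ne] := eqVneq (sgn3 R i1 i2 i3 * sgn3 R j1 j2 j3) 1; first by rewrite scale1r.
  rewrite -(sgn3_rev i1 i2 i3) -(sgn3_rev j1 j2 j3) in ne.
  by rewrite (triple_zero ne) scaler0.
by split=> h i1 j1 i2 j2 i3 j3; [rewrite key h | rewrite h key].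
Qed.

Lemma O_Obar_cubic : rel_O u <-> rel_Obar u.
Proof.
split=> h i j k l.
  rewrite xpair_eqE => ne; have [ik|ik] := eqVneq i k => /=.
    have jl : j != l by move: ne; rewrite ik eqxx.
    by rewrite ik !row_orth ?oppr0 // eq_sym.
  have [jl|jl] := eqVneq j l; last exact: h.
  by rewrite jl !col_orth ?oppr0 // eq_sym.
have [ik|ik] := eqVneq i k.
  have [jl|jl] := eqVneq j l; first by rewrite ik jl.
  by rewrite ik !row_orth // eq_sym.
have [jl|jl] := eqVneq j l; first by rewrite jl !col_orth // eq_sym.
by rewrite h ?xpair_eqE ?(negbTE ik) //= (negbTE jl).
Qed.

End Cubic.

(** Two different entries a, b of a row and an entry c in a third column satisfy
    a b c = c b a = - a b c; summing a b c c over the third column gives a b = 0.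
    So u_ij = u_ij u_ij^2.  For N = 1 a row has a single entry. *)
Lemma Ostar_Obarstar_Hplus : N <> 2%N -> rel_Ostar u -> rel_Obarstar u -> rel_Hplus u.
Proof.
move=> N2 hs hb; apply/Hplus_fourth => // i j.
have [_ /orth_sums o] := ou.
have row i' k l : k != l -> u i' k * u i' l = 0.
  move=> kl; have /subsetPn[q _] : ~~ ([set: 'I_N] \subset [set k; l]).
    apply/negP => /subset_leq_card; rewrite cardsT card_ord cards2 kl.
    have kl' : (k : nat) != l := kl.
    by have := ltn_ord k; have := ltn_ord l; lia.
  rewrite !inE negb_or => /andP[qk ql].
  have e1 : \sum_p u p q * u p q = 1 by rewrite (o q q).2 eqxx.
  rewrite -[LHS]mulr1 -e1 mulr_sumr big1 // => p _.
  rewrite mulrA; have z : u i' k * u i' l * u p q = 0.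
    have hs1 := hs i' k i' l p q; have := hb i' k i' l p q.
    rewrite -hs1 /sgn3 eqxx /= mul1r kl [l == q]eq_sym [k == q]eq_sym ql qk /= scaleN1r => /eqP.
    by rewrite -addr_eq0 -mulr2n -scaler_nat scaler_eq0 pnatr_eq0 /= => /eqP.
  by rewrite z mul0r.
have e1 : \sum_k u i k * u i k = 1 by rewrite (o i i).1 eqxx.
rewrite wval2 /= -[RHS]mulr1 -e1 mulr_sumr.
rewrite (bigD1 j) //= big1 ?addr0 => [|k kj].
  by rewrite !wval_cons wval_nil mulr1 /= mulrA.
by rewrite -mulrA [u i j * (u i k * _)]mulrA row 1?eq_sym // mul0r mulr0.
Qed.

End Implications.
End Inclusions.

(** * The diagram *)

Section Diagram.
Variables (R : realType) (N : nat).
Hypothesis N0 : (0 < N)%N.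
Local Notation C := R[i].

Lemma vrel_arrow X Y (A : cstarAlgType R) (u : 'M[A]_N) : rel_Oplus u -> arrow X Y ->
  vrel X u -> vrel Y u.
Proof.
move=> ou; case: X; case: Y => //= _.
- by case=> hH hO; split=> //; exact: O_Ostar.
- by case.
- by case=> hH hO; apply/O_Obar_cubic => //; exact: O_square.
- by case.
- by case.
- by case=> hH hs; apply/Ostar_Obarstar_cubic => //; exact: Ostar_square.
- exact: O_Ostar.
exact: Obar_Obarstar.
Qed.

Lemma qsub_vrel X Y : (forall (A : cstarAlgType R) (u : 'M[A]_N),
  rel_Oplus u -> vrel X u -> vrel Y u) -> qsub (qg R N X) (qg R N Y).
Proof.
by move=> h P; rewrite !qg_vrel => hP A u ou ru; apply: hP => //; exact: h.
Qed.

Lemma qsub_arrow X Y : arrow X Y -> qsub (qg R N X) (qg R N Y).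
Proof. by move=> XY; apply: qsub_vrel => A u ou; exact: vrel_arrow. Qed.

Lemma square_intersection X B D Y : square X B D Y ->
  (N = 2%N -> middle_row B || middle_row D) ->
  qg R N X = qinter (qg R N B) (qg R N D).
Proof.
move=> [BD sqr] hN; rewrite !qg_vrel qinter_impose; [|exact: detected_vrel..].
apply: impose_ext => A u ou; split.
  case/and4P: sqr => XB XD _ _ hX.
  by split; [exact: vrel_arrow XB hX | exact: vrel_arrow XD hX].
case: X B D Y BD sqr hN => -[] [] [] //= BD _ hN [h1 h2].
- by case: h1.
- by case: h1 => hH _; split=> //; apply/O_Obar_cubic => //; exact: Obar_square.
- by case: h2.
- by case: h2 => hH _; split=> //; apply/O_Obar_cubic => //; exact: Obar_square.
- by split=> //; apply/Ostar_Obarstar_cubic => //; exact: Obarstar_square.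
- by split.
- by split=> //; apply: Ostar_Obarstar_Hplus => // /hN.
- by split=> //; apply/Ostar_Obarstar_cubic => //; exact: Obarstar_square.
by split=> //; apply: Ostar_Obarstar_Hplus => // /hN.
Qed.

Definition killed (L : qgrp R N) X := killed_by L (@vrel R N X).

Lemma killed_qsub (L : qgrp R N) X : qsub (qg R N X) L -> killed L X.
Proof. by move=> h P /h; rewrite qg_vrel; exact: impose_fdkernel. Qed.

Lemma killed_arrow (L : qgrp R N) X Y : arrow X Y -> killed L Y -> killed L X.
Proof.
by move=> XY h P /h hP n u ou ru; apply: hP => //; exact: vrel_arrow XY ru.
Qed.

Section Minimality.
Variables (L : qgrp R N) (hL : closed_qsubgroup L).

Lemma Ostar_minimal : killed L vHstar -> killed L vO -> qsub (qg R N vOstar) L.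
Proof.
by move=> hH hO P LP; apply: (Ostar_generation hL N0 _ hO LP); exact: unit_diag_Hstar.
Qed.

Lemma Obarstar_minimal : killed L vHstar -> killed L vObar -> qsub (qg R N vObarstar) L.
Proof.
have [m [gam hgam]] := clifford_exists R N.
move=> hH hO P LP; apply: (Obarstar_generation hL hgam N0 _ hO LP).
exact: unit_diag_Hstar.
Qed.

Lemma Oplus_minimal_O_Obar : killed L vHstar -> killed L vO -> killed L vObar ->
  qsub (qg R N vOplus) L.
Proof.
have [m [gam hgam]] := clifford_exists R N.
move=> hH hO hB P LP; apply: (Oplus_generation hL N0 _ _ _ LP).
- exact: unit_diag_Hstar.
- by move=> a b; exact: rot_O.
by move=> a b; exact: (twrot_Obar hgam).
Qed.

Lemma Oplus_minimal_Hplus_O : killed L vHplus -> killed L vO -> qsub (qg R N vOplus) L.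
Proof.
have [m [gam hgam]] := clifford_exists R N.
move=> hH hO P LP; apply: (Oplus_generation hL N0 _ _ _ LP).
- exact: unit_diag_Hplus.
- by move=> a b; exact: rot_O.
by move=> a b; exact: (twrot_Hplus_O hL hgam).
Qed.

Lemma Oplus_minimal_Hplus_Obar : killed L vHplus -> killed L vObar ->
  qsub (qg R N vOplus) L.
Proof.
have [m [gam hgam]] := clifford_exists R N.
move=> hH hB P LP; apply: (Oplus_generation hL N0 _ _ _ LP).
- exact: unit_diag_Hplus.
- by move=> a b; exact: (rot_Hplus_Obar hL hgam).
by move=> a b; exact: (twrot_Obar hgam).
Qed.

End Minimality.

(** The polynomials vanishing on the finite-dimensional models of D form a Hopf
    ideal, to which the minimality of D applies. *)
Lemma qg_closed D : closed_qsubgroup (fdkernel (@vrel R N D)) ->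
  qsub (qg R N D) (fdkernel (@vrel R N D)) -> closed_qsubgroup (qg R N D).
Proof.
move=> hc hs; rewrite (_ : qg R N D = fdkernel (@vrel R N D)) //.
apply/funext => P; apply/propext; split; last exact: hs.
by rewrite qg_vrel; exact: impose_fdkernel.
Qed.

Lemma half_fdkernel_closed sg : (forall i j k : 'I_N, sg i j k * sg i j k = 1 :> C) ->
  closed_qsubgroup (fdkernel (rel_half sg)).
Proof.
move=> sg2; apply: fdkernel_closed; [exact: half_mxconvol | exact: half_trmodel |].
exact: half_onemodel.
Qed.

Lemma Oplus_closed : closed_qsubgroup (qg R N vOplus).
Proof.
have hc : closed_qsubgroup (fdkernel (@vrel R N vOplus)) by exact: fdkernel_closed.
have k X : killed (fdkernel (@vrel R N vOplus)) X.
  by move=> P h n u ou _; exact: h.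
by apply: qg_closed => //; exact: Oplus_minimal_O_Obar.
Qed.

Lemma Ostar_closed : closed_qsubgroup (qg R N vOstar).
Proof.
have e : fdkernel (@vrel R N vOstar) = fdkernel (rel_half (fun _ _ _ => 1)).
  by apply/funext => P; apply/propext; split=> h n u ou /rel_Ostar_half; exact: h.
have hc : closed_qsubgroup (fdkernel (@vrel R N vOstar)).
  by rewrite e; apply: half_fdkernel_closed => *; rewrite mulr1.
have k : killed (fdkernel (@vrel R N vOstar)) vOstar by [].
apply: qg_closed => //; apply: Ostar_minimal => //; exact: killed_arrow k.
Qed.

Lemma Obarstar_closed : closed_qsubgroup (qg R N vObarstar).
Proof.
have hc : closed_qsubgroup (fdkernel (@vrel R N vObarstar)).
  by apply: half_fdkernel_closed => i j k; exact: sgn3_sqr.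
have k : killed (fdkernel (@vrel R N vObarstar)) vObarstar by [].
apply: qg_closed => //; apply: Obarstar_minimal => //; exact: killed_arrow k.
Qed.

Lemma square_generation X B D Y : square X B D Y ->
  qgen (qg R N B) (qg R N D) (qg R N Y).
Proof.
move=> [BD sqr]; have /and4P[XB XD BY DY] := sqr.
split; [| exact: qsub_arrow | exact: qsub_arrow |].
  case: X B D Y BD sqr {XB XD BY DY} => -[] [] [] //= _ _; by
    [exact: Oplus_closed | exact: Ostar_closed | exact: Obarstar_closed].
move=> L hL /killed_qsub hB /killed_qsub hD.
case: X B D Y BD sqr XB XD BY DY hB hD => -[] [] [] //= _ _ _ _ _ _ h1 h2.
all: try (by [exact: Ostar_minimal | exact: Obarstar_minimal
  | apply: Oplus_minimal_Hplus_O => //; exact: killed_arrow (isT : arrow vO vOstar) _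
  | apply: Oplus_minimal_Hplus_Obar => //; exact: killed_arrow (isT : arrow vObar vObarstar) _
  | apply: Oplus_minimal_O_Obar => //;
    [exact: killed_arrow (isT : arrow vHstar vOstar) _
    |exact: killed_arrow (isT : arrow vO vOstar) _
    |exact: killed_arrow (isT : arrow vObar vObarstar) _]]).
Qed.

End Diagram.

Theorem theorem5p5 (R : realType) (N : nat) (hN : (0 < N)%N) :
  (forall X Y : vertex, arrow X Y -> qsub (qg R N X) (qg R N Y)) /\
  (forall A B C D : vertex, square A B C D ->
    ((N = 2%N -> middle_row B || middle_row C) ->
       qg R N A = qinter (qg R N B) (qg R N C)) /\
    qgen (qg R N B) (qg R N C) (qg R N D)) /\
  qgen (qg R N vHplus) (qg R N vObar) (qg R N vOplus).
Proof.
split; first by move=> X Y; exact: qsub_arrow.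
split.
  move=> A B C D sqr; split; first exact: square_intersection sqr.
  exact: square_generation sqr.
split; [exact: Oplus_closed | exact: qsub_arrow | exact: qsub_vrel |].
move=> L hL /killed_qsub hH /killed_qsub hO.
exact: Oplus_minimal_Hplus_Obar.
Qed.
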